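(* For every constant $\varepsilon>0$ there is a polynomial-time algorithm for the Cactus Augmentation Problem that achieves approximation ratio $2\ln(4)-\frac{967}{1120}+\varepsilon$ (which is less than $1.9092+\varepsilon$). That is, given an instance $(G,L)$, the algorithm runs in polynomial time and outputs a feasible solution $A\subseteq L$ with $|A|\le \left(2\ln(4)-\frac{967}{1120}+\varepsilon\right)|OPT|$, where $OPT$ is an optimal solution.
   Context: A cactus is a connected undirected graph (multigraph; parallel edges allowed, so length-2 cycles consisting of two parallel edges are allowed) in which every edge belongs to exactly one cycle; in particular it is $2$-edge-connected. In the Cactus Augmentation Problem (CacAP) the input is a cactus $G=(V,E)$ and a set $L$ of extra edges (links) on the vertex set $V$. A subset $A\subseteq L$ is feasible if the graph $(V,E\cup A)$ is $3$-edge-connected (i.e., it remains connected after deleting any $2$ of its edges). The goal is to find a feasible $A$ of minimum cardinality; $OPT$ denotes an optimal solution. *)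

(* Defs.v *)
From Stdlib Require Import Reals.
From mathcomp Require Import all_boot.
Set Implicit Arguments. Unset Strict Implicit. Unset Printing Implicit Defensive.

(* A multigraph is a sequence of edges (pairs of endpoints); parallel edges
   are distinct entries of the sequence. *)
Section Graphs.
Variable n : nat.
Local Notation V := ('I_n).

Definition adj (H : seq (V * V)) : rel V :=
  fun u v => has (fun e => (e == (u, v)) || (e == (v, u))) H.

Definition connected_mg (H : seq (V * V)) : Prop :=
  forall u v : V, connect (adj H) u v.

Definition remove2 (H : seq (V * V)) (i j : nat) : seq (V * V) :=
  [seq p.2 | p <- zip (iota 0 (size H)) H & (p.1 != i) && (p.1 != j)].

Definition three_edge_connected (H : seq (V * V)) : Prop :=
  forall i j : nat, connected_mg (remove2 H i j).

Definition edge_of (E : seq (V * V)) (i : 'I_(size E)) : V * V := tnth (in_tuple E) i.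

Definition deg_in (E : seq (V * V)) (C : {set 'I_(size E)}) (v : V) : nat :=
  \sum_(i in C) (((edge_of i).1 == v) + ((edge_of i).2 == v)).

Definition adj_in (E : seq (V * V)) (C : {set 'I_(size E)}) : rel V :=
  fun u v => [exists i in C, (edge_of i == (u, v)) || (edge_of i == (v, u))].

Definition is_cycle (E : seq (V * V)) (C : {set 'I_(size E)}) : Prop :=
  [/\ C != set0,
      (forall v : V, deg_in C v = 0 \/ deg_in C v = 2) &
      (forall i j, i \in C -> j \in C ->
         connect (adj_in C) (edge_of i).1 (edge_of j).1)].

Definition is_cactus (E : seq (V * V)) : Prop :=
  connected_mg E /\
  forall i : 'I_(size E), exists! C : {set 'I_(size E)}, is_cycle C /\ i \in C.

Definition sel_links (L : seq (V * V)) (A : {set 'I_(size L)}) : seq (V * V) :=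
  mask [seq i \in A | i <- enum 'I_(size L)] L.

Definition feasible (E L : seq (V * V)) (A : {set 'I_(size L)}) : Prop :=
  three_edge_connected (E ++ sel_links A).
End Graphs.

Inductive dir := DLeft | DRight | DStay.

(* states 'I_(k+1); start state ord0, halting state ord_max; tape alphabet
   {0,1,blank} encoded as option bool (None = blank). *)
Record TM := { tm_k : nat;
  tm_delta : 'I_tm_k.+1 -> option bool -> 'I_tm_k.+1 * option bool * dir }.

(* configuration: state, cells left of head (nearest first), head cell,
   cells right of head *)
Definition config (M : TM) :=
  ('I_(tm_k M).+1 * seq (option bool) * option bool * seq (option bool))%type.

Definition tm_step (M : TM) (c : config M) : config M :=
  let: (q, l, a, r) := c in
  if q == ord_max then c else
  let: (q', w, d) := tm_delta q a in
  match d with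
  | DStay => (q', l, w, r)
  | DLeft => match l with [::] => (q', [::], None, w :: r)
                       | b :: l' => (q', l', b, w :: r) end
  | DRight => match r with [::] => (q', w :: l, None, [::])
                        | b :: r' => (q', w :: l, b, r') end
  end.

Definition tm_run (M : TM) (t : nat) (c : config M) : config M := iter t (@tm_step M) c.

Definition tm_init (M : TM) (x : seq bool) : config M :=
  (ord0, [::], head None (map Some x), behead (map Some x)).

Definition tm_halted (M : TM) (c : config M) : bool := c.1.1.1 == ord_max.

Definition tm_output (M : TM) (c : config M) : seq bool :=
  let s := c.1.2 :: c.2 in pmap (fun o => o) (take (find (pred1 None) s) s).

Definition enc_nat (k : nat) : seq bool := nseq k true ++ [:: false].

Definition enc_edges (n : nat) (H : seq ('I_n * 'I_n)) : seq bool :=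
  enc_nat (size H) ++ flatten [seq enc_nat (val e.1) ++ enc_nat (val e.2) | e <- H].

Definition enc_instance (n : nat) (E L : seq ('I_n * 'I_n)) : seq bool :=
  enc_nat n ++ enc_edges E ++ enc_edges L.

Definition dec_solution (m : nat) (out : seq bool) : {set 'I_m} :=
  [set i : 'I_m | nth false out i].

Local Open Scope R_scope.
Definition cacap_ratio (eps : R) : R := 2 * ln 4 - 967 / 1120 + eps.

(* Main.v *)
Require Import Defs.
From Stdlib Require Import Reals Lra.
From mathcomp Require Import all_boot zify.
Set Implicit Arguments. Unset Strict Implicit. Unset Printing Implicit Defensive.

(** The algorithm is a local search over sets D of arcs: every link {u,w} may be used in
    either direction, and D is feasible when some arc of D leaves each 2-cut C of the cactus
    that avoids a fixed root.  A link costs 2 if one of its two arcs is in D and 3 if both are;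
    a step replaces D by a cheaper feasible set at Hamming distance at most 206, starting from
    all arcs, and the output is the set of links used by D.

    Ratio.  Call two links near if no 2-cut separates them.  A feasible set of links is connected
    for this relation, hence is covered by connected pieces Y of at most 41 links with little
    overlap.  Adding both arcs of every link of such a Y makes all arcs of D with tail in the hull
    of Y superfluous, except for at most one (the arc leaving the largest 2-cut that would become
    uncovered).  Every vertex is in the hull of a link of a feasible set, so summing over the pieces
    the inequality expressing that this exchange does not improve a local optimum bounds the
    size of the output by 3/2 + 1/8 times the optimum, up to an additive constant absorbed by a
    separate treatment of small optima.  Only the closure of 2-cuts under crossing unions is
    used.  The resulting factor 1.69 is below the required one, for every epsilon.

    Machine.  The local search is a program of a LOOP language whose memory is a fixed number of
    bit planes and pointers of length the input size; such programs always run in polynomial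
    time, and are compiled to the single-tape machine with the memory cells as fixed-width
    blocks of tape symbols. *)

(** * Connected sets of a symmetric relation *)

(** The costs 2 and 3 make every link of [D] worth exactly 2: an arc whose reverse is absent frees 2
    when removed, each arc of an opposite pair counts 1. Inserting a link costs at most 3, and this
    3 against 2 is the origin of 3/2. Arcs and a root are used because the cuts left uncovered by an
    exchange then all contain [Y] and avoid the root, so that unions of them are again such cuts and
    a largest one exists. A piece that is split off takes 20 to 40 links away and loses 5 in the
    accounting, 2 for the arc that stays and 3 for the one link shared with the remainder; after
    halving, this is the 1/8. The radius is 206 = 5 * 41 + 1, because at most 3 * 41 + 1 arcs leave
    and 2 * 41 enter. An optimum of at most 41 links can be exchanged in as a whole; above that the
    additive 5/2 is covered by 1.69 - 1.625. Since the input is written in unary, its length exceeds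
    three times the number of links, hence every cost: pointers and loops bounded by the input
    length suffice. *)

Section Connected.
Variables (I : finType) (near : rel I).
Hypothesis near_sym : symmetric near.

(** Connectedness of the graph induced on [O], expressed by cuts instead of paths; the empty set
    counts as connected. *)
Definition conn (O : {set I}) : Prop :=
  forall Z : {set I}, Z \subset O -> Z != set0 -> Z != O ->
    exists p q, [/\ p \in Z, q \in O :\: Z & near p q].

Lemma conn1 v : conn [set v].
Proof.
by move=> Z; rewrite subset1 => /orP [] /eqP ->; rewrite eqxx.
Qed.

Lemma conn_edge (O Z : {set I}) : conn O -> Z :&: O != set0 -> O :\: Z != set0 ->
  exists p q, [/\ p \in Z :&: O, q \in O :\: Z & near p q].
Proof.
move=> cO nZ nO.
case: (cO (Z :&: O)); rewrite ?subsetIr //.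
  by apply: contra nO => /eqP <-; rewrite setDIl setDv set0I.
move=> p [q [pZ qZ pq]]; exists p, q; split=> //.
by move: qZ; rewrite !inE negb_and; case/andP=> /orP [->|/negbTE ->].
Qed.

Lemma connU (O1 O2 : {set I}) v : conn O1 -> conn O2 -> v \in O1 -> v \in O2 ->
  conn (O1 :|: O2).
Proof.
move=> c1 c2 v1 v2.
(* WLOG the part [Z] contains the common vertex, up to exchanging [Z] with its complement *)
have main (Z : {set I}) : Z \subset O1 :|: O2 -> v \in Z -> Z != O1 :|: O2 ->
    exists p q, [/\ p \in Z, q \in (O1 :|: O2) :\: Z & near p q].
  move=> sZ vZ nZ.
  have [/eqP e1|n1] := boolP (O1 :\: Z == set0); last first.
    have n1' : Z :&: O1 != set0 by apply/set0Pn; exists v; rewrite inE vZ.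
    have [p [q [pZ qZ pq]]] := conn_edge c1 n1' n1.
    exists p, q; split=> //; first by case/setIP: pZ.
    by move: qZ; rewrite !inE => /andP [-> ->].
  have [/eqP e2|n2] := boolP (O2 :\: Z == set0); last first.
    have n2' : Z :&: O2 != set0 by apply/set0Pn; exists v; rewrite inE vZ.
    have [p [q [pZ qZ pq]]] := conn_edge c2 n2' n2.
    exists p, q; split=> //; first by case/setIP: pZ.
    by move: qZ; rewrite !inE => /andP [-> ->]; rewrite orbT.
  by case/negP: nZ; rewrite eqEsubset sZ -setD_eq0 setDUl e1 e2 setU0 eqxx.
move=> Z sZ nZ0 nZ.
have [vZ|vZ] := boolP (v \in Z); first exact: main.
have [|||p [q [pZ qZ pq]]] := main ((O1 :|: O2) :\: Z).
- exact: subsetDl.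
- by rewrite !inE vZ v1.
- apply: contra nZ0 => /eqP e; rewrite -(setIidPr sZ).
  by rewrite -{1}e setIDAC setDIl setDv setI0.
exists q, p; rewrite near_sym; split=> //.
move: qZ; rewrite !inE negb_and negbK => /andP [/orP [//|]].
by move=> /negbTE ->.
Qed.

Lemma conn2 u v : near u v -> conn [set u; v].
Proof.
move=> uv Z sZ nZ0 nZ.
have [uZ|uZ] := boolP (u \in Z); have [vZ|vZ] := boolP (v \in Z).
- case/negP: nZ; rewrite eqEsubset sZ; apply/subsetP=> x; rewrite !inE.
  by case/orP=> /eqP ->.
- by exists u, v; rewrite !inE eqxx orbT uZ vZ uv.
- by exists v, u; rewrite !inE eqxx uZ vZ near_sym uv.
case/set0Pn: nZ0 => x xZ; move/subsetP/(_ x xZ): sZ; rewrite !inE.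
by case/orP=> /eqP e; move: xZ; rewrite e ?(negbTE uZ) ?(negbTE vZ).
Qed.

(** This is the splitting of a tree into subtrees of comparable size, done without a spanning tree.
    Starting with [P] as all of [O] but one point [v], the pair shrinks until [P] has at most [2h]
    points. If [P] falls apart, both sides still hang on [v] and the descent goes to one with at
    least [h] points. If [P] is connected, the attaching point moves to a neighbour inside [P],
    which costs a single point. *)
Lemma conn_piece (O : {set I}) h : conn O -> 0 < h -> h < #|O| ->
  exists v (P : {set I}), [/\ v \in O :\: P, P \subset O, h <= #|P| <= h.*2,
    conn (v |: P) & conn (O :\: P)].
Proof.
move=> cO h0 hO.
pose good v (P : {set I}) := [/\ v \in O :\: P, P \subset O, h <= #|P|,
    conn (v |: P) & conn (O :\: P)].
suff H : forall m v (P : {set I}), #|P| < m -> good v P ->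
    exists v (P : {set I}), good v P /\ #|P| <= h.*2.
  have [v vO] : exists v, v \in O by apply/card_gt0P; lia.
  have e : v |: O :\ v = O by rewrite setD1K.
  have e2 : O :\: (O :\ v) = [set v].
    by apply/setP=> x; rewrite !inE; case: (x == v) /eqP => [->|] /=; rewrite ?vO // andNb.
  case: (H #|O| v (O :\ v)).
  - by rewrite [X in _ < X](cardsD1 v) vO.
  - split; rewrite ?e ?e2 ?set11 ?subD1set //; last exact: conn1.
    by move: hO; rewrite (cardsD1 v) vO; lia.
  by move=> v' [P [[g1 g2 g3 g4 g5] le]]; exists v', P; rewrite g3 le.
elim=> [//|m IH] v P Pm [vO sP hP cP cOP].
have [le|gt] := leqP #|P| h.*2; first by exists v, P.
have vP : v \notin P by case/setDP: vO.
have vOP : v \in O by case/setDP: vO.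
have P0 : P != set0 by rewrite -card_gt0; lia.
have [[Q [sQ nQ0 nQ noedge]]|Pconn] :
  (exists Q : {set I}, [/\ Q \subset P, Q != set0, Q != P &
     forall p q, p \in Q -> q \in P :\: Q -> ~~ near p q]) \/ conn P.
- have [/existsP [Q /and4P [a b c d]]|no] := boolP [exists Q : {set I},
    [&& Q \subset P, Q != set0, Q != P &
      [forall p in Q, [forall q in P :\: Q, ~~ near p q]]]].
    left; exists Q; split=> // p q pQ qQ.
    by move/forall_inP/(_ p pQ)/forall_inP/(_ q qQ): d.
  right=> Z sZ nZ0 nZ; move/existsPn/(_ Z): no; rewrite sZ nZ0 nZ /=.
  case/forall_inPn=> p pZ /forall_inPn [q qZ /negPn pq].
  by exists p, q.
(* No edge joins [Q1] to the rest of [P], so an edge that [cP] provides out of a part of [Q1] ends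
   in [Q1] or at [v]. *)
- have side (Q1 : {set I}) : Q1 \subset P ->
     (forall p q, p \in Q1 -> q \in P :\: Q1 -> ~~ near p q) -> conn (v |: Q1).
    move=> s1 no1.
    have edge (Z : {set I}) : Z \subset Q1 -> Z != set0 ->
        exists p q, [/\ p \in Z, q \in (v |: Q1) :\: Z & near p q].
      move=> sZ nZ.
      have sZP : Z \subset P by apply: subset_trans s1.
      have vZ : v \notin Z by apply: contra vP => /(subsetP sZP).
      have [||p [q [pZ qZ pq]]] := cP Z _ nZ.
      - by apply: subset_trans sZP _; apply: subsetUr.
      - by apply: contra vZ => /eqP ->; rewrite !inE eqxx.
      exists p, q; split=> //; move: qZ; rewrite !inE => /andP [-> /=].
      case/orP=> [->//|qP]; apply/orP; right; apply: contraT => nq.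
      have pQ := subsetP sZ p pZ.
      by move: (no1 p q pQ); rewrite !inE nq qP pq => /(_ isT).
    move=> Z sZ nZ0 nZ; have [vZ|vZ] := boolP (v \in Z); last first.
      apply: edge => //; apply/subsetP=> x xZ; move/subsetP/(_ x xZ): sZ.
      by rewrite !inE => /orP [/eqP e|//]; move: xZ; rewrite e (negbTE vZ).
    have [||p [q [pZ qZ pq]]] := edge ((v |: Q1) :\: Z).
    + apply/subsetP=> x; rewrite !inE => /andP [xZ /orP [/eqP e|//]].
      by rewrite e vZ in xZ.
    + by rewrite setD_eq0; apply: contra nZ => h1; rewrite eqEsubset sZ.
    exists q, p; rewrite near_sym; split=> //.
    move: qZ; rewrite !inE negb_and negbK => /andP [/orP [//|]].
    by move=> /negbTE ->.
  (* Descent to the side [Q1]; the other side goes over to the remainder, to which it is attached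
     through [v]. *)
  have part (Q1 : {set I}) : Q1 \subset P -> conn (v |: P :\: Q1) -> Q1 != P -> Q1 != set0 ->
     conn (v |: Q1) -> h <= #|Q1| -> exists v (P : {set I}), good v P /\ #|P| <= h.*2.
    move=> s1 c2 n1 n0 c1 hQ1; apply: (IH v Q1).
      have : #|Q1| < #|P| by apply: proper_card; rewrite properEneq n1.
      lia.
    split=> //.
    - by rewrite inE vOP andbT; apply: contra vP => /(subsetP s1).
    - exact: subset_trans sP.
    have -> : O :\: Q1 = (O :\: P) :|: (v |: (P :\: Q1)).
      apply/setP=> x; rewrite !inE.
      case: (x == v) /eqP => [->|_] /=.
        by rewrite vOP orbT andbT (contra (subsetP s1 v)).
      have := subsetP sP x; have := subsetP s1 x.
      case: (x \in Q1); case: (x \in P); case: (x \in O) => //= A B;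
        by [have := A isT | have := B isT].
    by apply: (connU (v := v)) => //; rewrite !inE eqxx.
  have s2 : P :\: Q \subset P by exact: subsetDl.
  have dd : P :\: (P :\: Q) = Q by rewrite setDDr setDv set0U; apply/setIidPr.
  have c1 := side Q sQ noedge.
  have c2 : conn (v |: P :\: Q).
    apply: side s2 _ => p q pQ; rewrite dd => qQ; rewrite near_sym.
    exact: noedge.
  have nD0 : P :\: Q != set0.
    by rewrite setD_eq0; apply: contra nQ => h1; rewrite eqEsubset sQ.
  have cPQ : #|P| = #|Q| + #|P :\: Q|.
    by rewrite cardsD (setIidPr sQ) subnKC // subset_leq_card.
  (* [P] has more than [2h] points, so one of its two sides has at least [h]. *)
  have [hQ|hQ] := leqP h #|Q|; first exact: (part Q).
  apply: (part (P :\: Q)); rewrite ?dd //; last by lia.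
  apply: contra nQ0 => /eqP e; rewrite -(setIidPr sQ).
  by rewrite -{1}e setIDAC setDIl setDv setI0.
(* Here [P] is connected. A neighbour [v'] of [v] in [P] becomes the attaching point, and the edge
   between them keeps the enlarged remainder connected. *)
have [|||p [v' [pv]]] := cP [set v] _; rewrite ?sub1set ?setU11 //.
- by apply/set0Pn; exists v; rewrite set11.
- apply: contra P0 => /eqP e; apply/eqP/setP=> x; rewrite inE; apply/negP=> xP.
  have : x \in v |: P by rewrite inE xP orbT.
  by rewrite -e inE => /eqP ee; rewrite -ee xP in vP.
move: pv; rewrite inE => /eqP -> {p}; rewrite !inE => /andP [nv].
rewrite (negbTE nv) /= => v'P vv'.
have sP' : P :\ v' \subset P by exact: subD1set.
apply: (IH v' (P :\ v')); move: (cardsD1 v' P); rewrite v'P; first by lia.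
move=> cP1; split.
- by rewrite !inE eqxx (subsetP sP).
- exact: subset_trans sP.
- by lia.
- by rewrite setD1K.
have -> : O :\: (P :\ v') = (O :\: P) :|: [set v; v'].
  apply/setP=> x; rewrite !inE.
  case: (x == v') /eqP => [->|_] /=; first by rewrite !orbT (subsetP sP).
  case: (x == v) /eqP => [->|_] /=; first by rewrite vOP (negbTE vP).
  by rewrite orbF.
by apply: (connU (v := v)) => //; rewrite ?inE ?eqxx //; apply: conn2.
Qed.

End Connected.

(** * Local optima for covering a family of cuts *)

Section Cuts.
Variables (V I : finType) (r : V) (cut : pred {set V}) (a b : I -> V).
Hypothesis cutC : forall C, cut C -> cut (~: C).
Hypothesis cutU : forall C D, cut C -> cut D -> C :&: D != set0 ->
  C :|: D != setT -> cut (C :|: D).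

Implicit Types (B Y O : {set I}) (C S : {set V}) (D X T : {set I * bool}).

Definition crosses l C := (a l \in C) != (b l \in C).
Definition inside l C := (a l \in C) && (b l \in C).
Definition covering B := forall C, cut C -> exists2 l, l \in B & crosses l C.

(* [(l, false)] is the arc from [a l] to [b l], and [(l, true)] its reverse. *)
Definition tail (f : I * bool) := if f.2 then b f.1 else a f.1.
Definition head (f : I * bool) := if f.2 then a f.1 else b f.1.
Definition leaves f C := (tail f \in C) && (head f \notin C).
Definition dicovering D := forall C, cut C -> r \notin C -> exists2 f, f \in D & leaves f C.

Definition links D : {set I} := [set f.1 | f in D].
Definition arcs Y : {set I * bool} := setX Y setT.
Definition cost D := #|D| + #|links D|.

(** For the edge cuts of a tree, two links are near when their paths share a vertex, and the [hull]
    of a link is its path. *)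
Definition near l l' :=
  ~~ [exists C : {set V}, [&& cut C, inside l C & inside l' (~: C)]].
Definition hull l : {set V} :=
  [set v | [forall C : {set V}, (cut C && ~~ crosses l C) ==> ((v \in C) == (a l \in C))]].
Definition hull_arcs D Y := [set f in D | [exists l in Y, tail f \in hull l]].

Lemma card_arcs X : #|X| = \sum_l (((l, false) \in X) + ((l, true) \in X)).
Proof.
rewrite -sum1_card big_mkcond /=.
rewrite (eq_bigr (fun f : I * bool => (nat_of_bool ((f.1, f.2) \in X)))); last first.
  by move=> [l s] _ /=; case: (_ \in X).
rewrite -(pair_bigA _ (fun l s => nat_of_bool ((l, s) \in X))) /=.
by apply: eq_bigr => l _; rewrite big_bool addnC.
Qed.

Lemma in_links D l : (l \in links D) = ((l, false) \in D) || ((l, true) \in D).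
Proof.
apply/imsetP/orP=> [[[l' [] /= fD ->]]|[fD|fD]]; [by right | by left | |].
  by exists (l, false).
by exists (l, true).
Qed.

Lemma crossesC l C : crosses l (~: C) = crosses l C.
Proof. by rewrite /crosses !inE; case: (a l \in C); case: (b l \in C). Qed.

Lemma insideC l C : inside l (~: C) = (a l \notin C) && (b l \notin C).
Proof. by rewrite /inside !inE. Qed.

Lemma near_sym : symmetric near.
Proof.
move=> l l'; congr negb; apply/existsP/existsP=> -[C /and3P [c i1 i2]];
  by exists (~: C); rewrite cutC ?setCK ?i1 ?i2.
Qed.

Lemma covering_leaves D : dicovering D -> covering (links D).
Proof.
move=> fD C cC.
have main C' : cut C' -> r \notin C' -> exists2 l, l \in links D & crosses l C'.
  move=> c /(fD _ c) [f fd /andP [t h]]; exists f.1; first exact: imset_f.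
  by move: t h; rewrite /tail /head /crosses; case: f.2 => [-> /negbTE ->|-> /negbTE ->].
have [rC|rC] := boolP (r \in C); last exact: main.
have [||l lD cl] := main (~: C); rewrite ?cutC ?inE ?rC //.
by exists l; rewrite // -crossesC.
Qed.

Lemma leaves_arcs B C l : l \in B -> crosses l C -> exists2 f, f \in arcs B & leaves f C.
Proof.
move=> lB; rewrite /crosses; case e1: (a l \in C); case e2: (b l \in C) => // _.
  by exists (l, false); rewrite ?inE ?lB // /leaves /= e1 e2.
by exists (l, true); rewrite ?inE ?lB // /leaves /= e1 e2.
Qed.

Lemma dicovering_arcs B : covering B -> dicovering (arcs B).
Proof. by move=> fB C cC rC; have [l lB cl] := fB C cC; apply: leaves_arcs cl. Qed.

Lemma dicovering_sub D T : D \subset T -> dicovering D -> dicovering T.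
Proof. by move=> s f C c rC; have [g gD lg] := f C c rC; exists g; rewrite ?(subsetP s). Qed.

(* Uncrossing: two maximal cuts avoiding [S] are disjoint, so no link can leave
   one of them if every link lives in [S] or in a cut avoiding [S]. *)
Lemma covering_escapes B S C0 : covering B -> S != set0 -> cut C0 -> [disjoint C0 & S] ->
  ~ (forall l, l \in B -> inside l S \/
       exists C, [/\ cut C, [disjoint C & S] & inside l C]).
Proof.
move=> fB /set0Pn [s sS] cC0 dC0 H.
pose P C := cut C && [disjoint C & S].
have P0 : P C0 by rewrite /P cC0.
case: (arg_maxnP (fun C => #|C|) P0) => M /andP [cM dM] maxM.
have [l lB] := fB M cM; rewrite /crosses.
have nM x : x \in S -> x \notin M.
  by move=> xS; rewrite (disjointFl dM).
case: (H l lB) => [/andP [i1 i2]|[C [cC dC /andP [i1 i2]]]].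
  by rewrite !(negbTE (nM _ _)).
move=> neq.
have nI : C :&: M != set0.
  apply/set0Pn; move: neq; case e1: (a l \in M) => neq.
    by exists (a l); rewrite inE i1.
  by exists (b l); rewrite inE i2; move: neq; case: (b l \in M).
have dU : [disjoint C :|: M & S].
  by rewrite -setI_eq0 setIUl setU_eq0 !setI_eq0 dC dM.
have PU : P (C :|: M).
  rewrite /P dU andbT; apply: cutU => //; apply/eqP => e.
  by move: (disjointFl dU sS); rewrite e inE.
have sub : C \subset M.
  have le : #|C :|: M| <= #|M| := maxM _ PU; apply/setUidPr; apply/eqP.
  by rewrite eq_sym eqEcard subsetUr le.
by move: neq; rewrite !(subsetP sub).
Qed.

Lemma hullP l v C : v \in hull l -> cut C -> ~~ crosses l C -> (v \in C) = (a l \in C).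
Proof. by rewrite inE => /forallP /(_ C) /implyP H c n; apply/eqP/H; rewrite c. Qed.

(** A link whose hull misses [v] lies inside a cut avoiding [v]. If this held for all links of [B],
    [covering_escapes] with the singleton of [v] would be contradicted; [C0] or its complement is
    the cut avoiding [v] that it asks for. *)
Lemma hull_cover B v C0 : covering B -> cut C0 -> exists2 l, l \in B & v \in hull l.
Proof.
move=> fB cC0; apply/exists_inP; apply: contraT => /exists_inPn H.
have [C1 cC1 vC1] : exists2 C, cut C & v \notin C.
  have [vC|] := boolP (v \in C0); last by exists C0.
  by exists (~: C0); rewrite ?cutC // inE vC.
case: (@covering_escapes B [set v] C1) => //.
- by apply/set0Pn; exists v; rewrite set11.
- by rewrite disjoint_sym disjoints1.
move=> l lB; right.
have := H l lB; rewrite inE => /forallPn [C].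
rewrite negb_imply => /andP [/andP [cC]]; rewrite /crosses negbK => /eqP nc neq.
have [vC|vC] := boolP (v \in C).
  exists (~: C); rewrite cutC // insideC -nc; split=> //.
    by rewrite disjoint_sym disjoints1 inE vC.
  by move: neq; rewrite vC; case: (a l \in C).
exists C; split=> //; first by rewrite disjoint_sym disjoints1.
by move: neq; rewrite /inside -nc (negbTE vC); case: (a l \in C).
Qed.

(** Two links inside opposite sides of a cut are not near, so an uncrossed cut cannot split a
    connected set of links. *)
Lemma conn_same_side Y C : conn near Y -> cut C -> (forall l, l \in Y -> ~~ crosses l C) ->
  forall l l', l \in Y -> l' \in Y -> (a l \in C) = (a l' \in C).
Proof.
move=> cY cC nc.
suff main l l' : l \in Y -> l' \in Y -> a l \in C -> a l' \in C.
  by move=> l l' lY lY'; apply/idP/idP; apply: main.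
move=> lY lY' alC; apply: contraT => nal.
have [||p [q [pZ qZ pq]]] := conn_edge cY (Z := [set x | a x \in C]).
- by apply/set0Pn; exists l; rewrite !inE alC.
- by apply/set0Pn; exists l'; rewrite !inE nal.
move: pZ qZ; rewrite !inE => /andP [pC pY] /andP [qC qY].
case/negP: pq; apply/existsP; exists C; rewrite cC /inside !inE qC pC /=.
move: (nc p pY) (nc q qY); rewrite /crosses pC (negbTE qC).
by case: (b p \in C); case: (b q \in C).
Qed.

(** Otherwise some part of [B] has no near link in the rest. A minimal such part [P] is connected,
    which allows all of it to be enclosed by one cut avoiding a given outside link. Then each link
    of [B] lies within the endpoints [S] of [P] or in a cut avoiding [S], against
    [covering_escapes]. *)
Lemma conn_covering B : covering B -> conn near B.
Proof.
move=> fB Z0 sZ0 nZ0 nZ0B.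
have [/existsP [p /existsP [q /and3P [pZ qZ pq]]]|/existsPn noe] :=
  boolP [exists p, exists q, [&& p \in Z0, q \in B :\: Z0 & near p q]].
  by exists p, q.
exfalso.
pose iso (Z : {set I}) := [&& Z \subset B, Z != set0, Z != B &
  [forall p in Z, [forall q in B :\: Z, ~~ near p q]]].
have isoZ0 : iso Z0.
  rewrite /iso sZ0 nZ0 nZ0B /=; apply/forall_inP=> p pZ; apply/forall_inP=> q qZ.
  by move/existsPn/(_ q): (noe p); rewrite pZ qZ.
case: (arg_minnP (fun Z : {set I} => #|Z|) isoZ0) => P /and4P [sP nP0 nPB noP] minP.
have sep p q : p \in P -> q \in B :\: P -> exists C, [/\ cut C, inside p C & inside q (~: C)].
  move=> pP qP; move/forall_inP/(_ p pP)/forall_inP/(_ q qP): noP.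
  by rewrite negbK => /existsP [C /and3P [c1 c2 c3]]; exists C.
(* A disconnected [P] would contain a smaller isolated part. *)
have cP : conn near P.
  move=> Z sZ nZ nZP.
  have [/existsP [p /existsP [q /and3P [pZ qZ pq]]]|/existsPn no] :=
    boolP [exists p, exists q, [&& p \in Z, q \in P :\: Z & near p q]].
    by exists p, q.
  have ltZ : #|Z| < #|P| by apply: proper_card; rewrite properEneq nZP.
  have : iso Z.
    rewrite /iso (subset_trans sZ sP) nZ /=; apply/andP; split.
      by apply: contra nPB => /eqP e; rewrite eqEsubset sP -e.
    apply/forall_inP=> p pZ; apply/forall_inP=> q; rewrite inE => /andP [qZ qB].
    have [qP|qP] := boolP (q \in P).
      by move/existsPn/(_ q): (no p); rewrite pZ !inE qZ qP.
    move/forall_inP/(_ p (subsetP sZ p pZ))/forall_inP/(_ q): noP; apply.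
    by rewrite inE qP.
  by move/minP; rewrite leqNgt ltZ.
(* From separation link by link to one cut for all of [P]: take a cut around as many links of [P] as
   possible and join to it a cut around a near neighbour [p']. Nearness forces the two cuts to meet,
   and [q] keeps their union from being everything. *)
have sepP q : q \in B :\: P ->
    exists C, [/\ cut C, forall p, p \in P -> inside p C & inside q (~: C)].
  move=> qP.
  pose good (Z : {set I}) := [&& Z \subset P, Z != set0 &
    [exists C : {set V}, [&& cut C, [forall p in Z, inside p C] & inside q (~: C)]]].
  have [p0 p0P] := set0Pn _ nP0.
  have good0 : good [set p0].
    rewrite /good sub1set p0P /=; apply/andP; split.
      by apply/set0Pn; exists p0; rewrite set11.
    have [C [cC i1 i2]] := sep p0 q p0P qP; apply/existsP; exists C; rewrite cC i2 andbT /=.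
    by apply/forall_inP=> p; rewrite inE => /eqP ->.
  case: (arg_maxnP (fun Z : {set I} => #|Z|) good0) => Z /and3P [sZ nZ].
  case/existsP=> C /and3P [cC /forall_inP iZ iq] maxZ.
  have [/eqP eZ|nZP] := boolP (Z == P).
    by exists C; split=> // p; rewrite -eZ; apply: iZ.
  exfalso.
  have [p [p' [pZ]]] := cP Z sZ nZ nZP; rewrite inE => /andP [np'Z p'P] pp'.
  have [C' [cC' i1 i2]] := sep p' q p'P qP.
  have nI : C :&: C' != set0.
    apply/negP=> /eqP e; case/negP: pp'; apply/existsP; exists C.
    rewrite cC iZ //= insideC; case/andP: i1 => u1 u2.
    apply/andP; split; apply/negP=> h.
      by have := in_set0 (a p'); rewrite -e inE h u1.
    by have := in_set0 (b p'); rewrite -e inE h u2.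
  have iqU : inside q (~: (C :|: C')).
    move: iq i2; rewrite !insideC !inE !negb_or.
    by move=> /andP [-> ->] /andP [-> ->].
  have nU : C :|: C' != setT.
    apply/eqP=> e; move: iqU; rewrite e insideC inE //.
  have : good (p' |: Z).
    rewrite /good subUset sub1set p'P sZ /=; apply/andP; split.
      by apply/set0Pn; exists p'; rewrite !inE eqxx.
    apply/existsP; exists (C :|: C'); rewrite cutU // iqU andbT /=.
    apply/forall_inP=> x; rewrite !inE => /orP [/eqP ->|/iZ];
      rewrite /inside !inE; last by case/andP=> -> ->.
    by case/andP: i1 => -> ->; rewrite !orbT.
  by move/maxZ; rewrite cardsU1 np'Z /= add1n => h; have := leq_ltn_trans h (ltnSn _); rewrite ltnn.
have [q0 q0B q0P] : exists2 q, q \in B & q \notin P.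
  have /subsetPn [q qB qP] : ~~ (B \subset P).
    by apply: contra nPB => h; rewrite eqEsubset sP.
  by exists q.
pose S := [set x | [exists p in P, (x == a p) || (x == b p)]].
have iS p : p \in P -> inside p S.
  move=> pP; rewrite /inside !inE; apply/andP; split; apply/exists_inP; exists p;
    by rewrite ?eqxx ?orbT.
have cS q : q \in B :\: P -> exists C, [/\ cut C, [disjoint C & S] & inside q C].
  move=> /sepP [C [cC iC iq]]; exists (~: C); split=> //; first exact: cutC.
  apply/pred0P=> x /=; apply/negP; rewrite !inE => /andP [nx /exists_inP [p pP]].
  by case/andP: (iC p pP) => u v /orP [] /eqP e; rewrite e ?u ?v in nx.
have [|C0 [cC0 dC0 _]] := cS q0; first by rewrite inE q0P.
apply: (@covering_escapes B S C0) => //.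
  have [p0 p0P] := set0Pn _ nP0; apply/set0Pn; exists (a p0).
  by case/andP: (iS p0 p0P).
move=> l lB; have [lP|lP] := boolP (l \in P); first by left; apply: iS.
by right; apply: cS; rewrite inE lP.
Qed.

(** The cuts uncovered by the exchange all contain [Y], hence meet pairwise, and their unions are
    uncovered as well; so there is a largest one, [M]. An arc [f0] leaving [M] leaves each of the
    others too, because its tail is in the hull of a link that all of them contain. The second
    alternative is the case without uncovered cuts. *)
Lemma drop_hull D Y : dicovering D -> conn near Y -> Y != set0 ->
  exists f0, dicovering ((D :\: (hull_arcs D Y :\ f0)) :|: arcs Y) \/
    dicovering ((D :\: hull_arcs D Y) :|: arcs Y).
Proof.
move=> fD cY nY; set W := hull_arcs D Y.
pose bad C := [&& cut C, r \notin C &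
  [forall f in (D :\: W) :|: arcs Y, ~~ leaves f C]].
have [/existsP [Cb badCb]|/existsPn nobad] := boolP [exists C, bad C]; last first.
  have [l lY] := set0Pn _ nY; exists (l, true); right => C cC rC.
  move: (nobad C); rewrite /bad cC rC /= => /forall_inPn [f fD' /negPn lf].
  by exists f.
case: (arg_maxnP (fun C : {set V} => #|C|) badCb) => M badM maxM.
have [l0 l0Y] := set0Pn _ nY.
(* [D] left the cut by an arc that was removed, so with its tail in the hull of some link of [Y]. No
   arc of [Y] leaves the cut, hence no link of [Y] crosses it, and connectedness puts all of [Y]
   inside. *)
have badP C : bad C -> [/\ cut C, r \notin C,
   forall l, l \in Y -> inside l C & exists f, [/\ f \in W, leaves f C & tail f \in C]].
  case/and3P=> cC rC /forall_inP nC.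
  have [f fD' lf] := fD C cC rC.
  have fW : f \in W.
    apply: contraT => nW; suff : ~~ leaves f C by rewrite lf.
    by apply: nC; rewrite in_setU in_setD nW fD'.
  have nc l : l \in Y -> ~~ crosses l C.
    move=> lY; apply/negP=> cl; have [g gA lg] := leaves_arcs lY cl.
    suff : ~~ leaves g C by rewrite lg.
    by apply: nC; rewrite in_setU gA orbT.
  have tC : tail f \in C by case/andP: lf.
  split=> //; last by exists f.
  move: (fW); rewrite inE => /andP [_ /exists_inP [l' lY' th]].
  have al' : a l' \in C by rewrite -(hullP th cC) ?nc.
  move=> l lY; have al : a l \in C by rewrite (conn_same_side cY cC nc lY lY').
  by rewrite /inside al; move: (nc l lY); rewrite /crosses al; case: (b l \in C).
have [cM rM iM [f0 [f0W lf0 tf0]]] := badP M badM.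
exists f0; left => C cC rC.
have [badC|nbad] := boolP (bad C).
  have [_ _ iC _] := badP C badC.
  (* Both cuts contain [Y], so they meet; an arc leaving the union leaves one of the two. *)
  have badU : bad (C :|: M).
    rewrite /bad cutU //.
    - rewrite inE negb_or rC rM /=; apply/forall_inP=> f fX.
      case/and3P: badC => _ _ /forall_inP /(_ f fX) n1.
      case/and3P: badM => _ _ /forall_inP /(_ f fX) n2.
      move: n1 n2; rewrite /leaves !inE negb_or.
      by case: (tail f \in C); case: (tail f \in M); case: (head f \in C); case: (head f \in M).
    - apply/set0Pn; exists (a l0); rewrite inE.
      by case/andP: (iC l0 l0Y) => -> _; case/andP: (iM l0 l0Y) => -> _.
    - by apply/eqP=> e; move: rC; have := in_setT r; rewrite -e inE (negbTE rM) orbF => ->.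
  have sub : C \subset M.
    have le : #|C :|: M| <= #|M| := maxM _ badU; apply/setUidPr; apply/eqP.
    by rewrite eq_sym eqEcard subsetUr le.
  (* The tail of [f0] lies in the hull of a link inside [C], hence in [C]; the head lies outside
     [M], hence outside [C]. *)
  exists f0.
    by rewrite !inE eqxx /=; move: f0W; rewrite inE => /andP [-> _].
  move: (f0W); rewrite inE => /andP [_ /exists_inP [l lY th]].
  case/andP: lf0 => _ hM; rewrite /leaves (contra (subsetP sub _) hM) andbT.
  have [i1 i2] := andP (iC l lY).
  by rewrite (hullP th cC) // /crosses i1 i2.
move: nbad; rewrite /bad cC rC /= => /forall_inPn [f fX /negPn lf].
exists f => //; move: fX; rewrite !in_setU => /orP [/setDP [fD' nW]|->]; last by rewrite orbT.
by rewrite in_setD in_setD1 (negbTE nW) andbF fD'.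
Qed.

(** * Exchange inequalities at a local optimum *)

Section LocalOptimum.
Variables (D : {set I * bool}) (K : nat).
Hypothesis coverD : dicovering D.
Hypothesis localD : forall T, #|D :\: T| + #|T :\: D| <= K -> dicovering T -> cost D <= cost T.

Definition single := [set f in D | (f.1, ~~ f.2) \notin D].
(** A lower bound for the drop in [cost] when [X] is removed from [D]. A link losing both arcs saves
    3 but is counted as 2, so that [gain] is a sum over arcs and thus subadditive. *)
Definition gain (X : {set I * bool}) := #|X| + #|X :&: single|.

Lemma gainS X X' : X \subset X' -> gain X <= gain X'.
Proof. by move=> s; apply: leq_add; apply: subset_leq_card => //; apply: setSI. Qed.

Lemma gainU X X' : gain (X :|: X') <= gain X + gain X'.
Proof.
rewrite /gain setIUl; have := cardsU X X'.
have := cardsU (X :&: single) (X' :&: single); lia.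
Qed.

Lemma gain1 f : gain [set f] <= 2.
Proof.
rewrite /gain cards1; have := subset_leq_card (subsetIl [set f] single).
by rewrite cards1; lia.
Qed.

(** Distinct single arcs belong to distinct links, and such a link does not survive in [D :\: X]. *)
Lemma cost_setD X : X \subset D -> cost (D :\: X) + gain X <= cost D.
Proof.
move=> sX; rewrite /cost /gain.
have e1 : #|D :\: X| + #|X| = #|D|.
  by rewrite cardsD (setIidPr sX) subnK // subset_leq_card.
have e2 : #|links (X :&: single)| = #|X :&: single|.
  apply: card_in_imset => -[l s] [l' s'] /= f1 f2 e.
  move: f1 f2; rewrite -{l'}e !inE /= => /and3P [_ _ n1] /and3P [_ d2 n2].
  by case: s n1 n2; case: s' d2 => // d2 /negP.
suff : #|links (D :\: X)| + #|links (X :&: single)| <= #|links D| by lia.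
rewrite -cardsUI.
have -> : links (D :\: X) :&: links (X :&: single) = set0.
  apply/setP=> l; rewrite !inE; apply/negP=> /andP [/imsetP [f fD ->] /imsetP [g gX e]].
  move: fD gX; rewrite !inE => /andP [nfX fD] /and3P [gX gD nD].
  move: nfX; rewrite (_ : f = g) ?gX //.
  case: f fD e => f1 f2 /= fD e; case: g gX gD nD e => g1 g2 /= gX gD nD e.
  rewrite e in fD *; congr pair; apply/eqP; apply: contraT => ne.
  by move: fD; rewrite (_ : f2 = ~~ g2) ?(negbTE nD) //; clear -ne; case: f2 ne; case: g2.
rewrite cards0 addn0; apply: subset_leq_card; apply/subsetP=> l; rewrite inE.
by case/orP=> /imsetP [f fX ->]; apply: imset_f; move: fX; rewrite !inE => /andP [] //;
  move=> _ /andP [].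
Qed.

Lemma cost_setU_arcs T Y : cost (T :|: arcs Y) <= cost T + 3 * #|Y|.
Proof.
rewrite /cost.
have cA : #|arcs Y| = 2 * #|Y| by rewrite cardsX cardsT card_bool mulnC.
have sL : links (T :|: arcs Y) \subset links T :|: Y.
  apply/subsetP=> l /imsetP [f]; rewrite !inE => /orP [fT ->|/andP [fY _] ->].
    by rewrite imset_f.
  by rewrite fY orbT.
have := subset_leq_card sL; have := cardsU (links T) Y; have := cardsU T (arcs Y).
lia.
Qed.

(** Local optimality only speaks of small exchanges, while [X] may be large. But each arc gains at
    least 1, so an excess already shows on [3 * #|Y| + 1] arcs of [X], and removing fewer arcs
    preserves the covering. With the [2 * #|Y|] new arcs the distance is at most [5 * #|Y| + 1]. *)
Lemma gain_drop X Y : X \subset D -> 5 * #|Y| + 1 <= K ->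
  dicovering ((D :\: X) :|: arcs Y) -> gain X <= 3 * #|Y|.
Proof.
move=> sX hK cov; rewrite leqNgt; apply/negP=> gX.
have [X' [sX' cX' gX']] : exists X' : {set I * bool},
    [/\ X' \subset X, #|X'| <= 3 * #|Y| + 1 & 3 * #|Y| < gain X'].
  have [le|gt] := leqP #|X| (3 * #|Y| + 1); first by exists X.
  exists [set f in take (3 * #|Y| + 1) (enum X)].
  have c : #|[set f in take (3 * #|Y| + 1) (enum X)]| = 3 * #|Y| + 1.
    rewrite cardsE (card_uniqP _) ?take_uniq ?enum_uniq // size_takel //.
    by rewrite -cardE; lia.
  split; rewrite ?c //; last by rewrite /gain c; lia.
  by apply/subsetP=> f; rewrite inE => /mem_take; rewrite mem_enum.
have sX'D : X' \subset D by apply: subset_trans sX.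
have := @localD ((D :\: X') :|: arcs Y).
have cA : #|arcs Y| = 2 * #|Y| by rewrite cardsX cardsT card_bool mulnC.
have h1 : #|D :\: ((D :\: X') :|: arcs Y)| <= #|X'|.
  apply: subset_leq_card; apply/subsetP=> f; rewrite !inE negb_or negb_and negbK.
  by case/andP=> /andP [/orP [//|/negbTE ->]].
have h2 : #|(D :\: X' :|: arcs Y) :\: D| <= #|arcs Y|.
  apply: subset_leq_card; apply/subsetP=> f; rewrite in_setD in_setU in_setD.
  by case/andP=> /negbTE ->; rewrite andbF.
have cov' : dicovering ((D :\: X') :|: arcs Y).
  by apply: dicovering_sub cov; apply: setSU; apply: setDS.
move=> /(_ _ cov'); have := cost_setU_arcs (D :\: X') Y; have := cost_setD sX'D.
lia.
Qed.

(** The additional 2 pays for the one arc that [drop_hull] keeps. *)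
Lemma gain_hull Y : conn near Y -> Y != set0 -> 5 * #|Y| + 1 <= K ->
  gain (hull_arcs D Y) <= 3 * #|Y| + 2.
Proof.
move=> cY nY hK; have sW : hull_arcs D Y \subset D.
  by apply/subsetP=> f; rewrite inE => /andP [].
have [f0 [cov|cov]] := drop_hull coverD cY nY; last first.
  by have := gain_drop sW hK cov; lia.
have sW' : hull_arcs D Y :\ f0 \subset D by apply: subset_trans sW; apply: subD1set.
have := gain_drop sW' hK cov.
have : gain (hull_arcs D Y) <= gain (f0 |: (hull_arcs D Y :\ f0)).
  by apply: gainS; apply/subsetP=> f fW; rewrite !inE; case: eqP => //= _; move: fW; rewrite inE.
by have := gainU [set f0] (hull_arcs D Y :\ f0); have := gain1 f0; lia.
Qed.

(** [p] is the number of pieces. Each takes at least [h] links away, except the last one, for which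
    the summand [h] makes room. Its attaching link is paid again in the remainder, which costs 3,
    and the arc kept costs 2. *)
Lemma gain_pieces h O : 0 < h -> 5 * h.*2.+1 + 1 <= K -> conn near O -> O != set0 ->
  exists2 p, h * p <= #|O| + h & gain (hull_arcs D O) <= 3 * #|O| + 5 * p.
Proof.
move=> h0 hK; move: {2}(#|O|) (leqnn #|O|) => m; elim: m O => [|m IH] O.
  by rewrite leqn0 cards_eq0 => /eqP ->; rewrite eqxx.
move=> Om cO nO; have [le|gt] := leqP #|O| h.*2.+1.
  exists 1; first by lia.
  by have := @gain_hull O cO nO; lia.
have hO : h < #|O| by lia.
have [v [P [vO sP /andP [hP Ph] cP cOP]]] := conn_piece near_sym cO h0 hO.
have cardO : #|O :\: P| + #|P| = #|O|.
  by rewrite cardsD (setIidPr sP) subnK // subset_leq_card.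
have [||p hp gp] := IH (O :\: P) _ cOP; first by lia.
  by apply/set0Pn; exists v.
have vP : v \notin P by case/setDP: vO.
have cvP : #|v |: P| = #|P|.+1 by rewrite cardsU1 vP.
have gvP : gain (hull_arcs D (v |: P)) <= 3 * #|v |: P| + 2.
  apply: gain_hull => //; last by lia.
  by apply/set0Pn; exists v; rewrite setU11.
exists p.+1; first by lia.
have : gain (hull_arcs D O) <= gain (hull_arcs D (v |: P) :|: hull_arcs D (O :\: P)).
  apply: gainS; apply/subsetP=> f; rewrite !inE => /andP [fD /exists_inP [l lO th]].
  rewrite fD /=; have [lP|lP] := boolP (l \in P); apply/orP; [left|right];
    apply/exists_inP; exists l => //; by rewrite !inE lP ?orbT.
have := gainU (hull_arcs D (v |: P)) (hull_arcs D (O :\: P)).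
by lia.
Qed.

Lemma double_links : 2 * #|links D| = gain D.
Proof.
rewrite /gain setIC (setIidPl _); last by apply/subsetP=> f; rewrite inE => /andP [].
rewrite !card_arcs -sum1_card big_mkcond big_distrr -big_split /=.
apply: eq_bigr => l _; rewrite in_links !inE /=.
by case: ((l, false) \in D); case: ((l, true) \in D).
Qed.

(** A small [B] is exchanged for the whole of [D] at once. In general all tails of arcs lie in hulls
    of links of [B], so [gain_pieces] bounds the gain of [D] itself, which is twice the number of
    its links. *)
Lemma local_optimum_bound h B : covering B -> 0 < h -> 5 * h.*2.+1 + 1 <= K ->
  (#|B| <= h.*2.+1 -> 2 * #|links D| <= 3 * #|B|) /\
  h * (2 * #|links D|) <= h * (3 * #|B|) + 5 * (#|B| + h).
Proof.
move=> fB h0 hK; rewrite double_links; split=> [le|].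
  apply: gain_drop; rewrite ?subxx //; first by lia.
  rewrite setDv set0U; exact: dicovering_arcs.
have [/eqP D0|/set0Pn [f fD]] := boolP (D == set0).
  by rewrite D0 /gain set0I !cards0 addn0 muln0.
(* Without any cut, removing one arc would already be an improvement; a nonempty local optimum
   therefore provides a cut. *)
have [C0 cC0] : exists C, cut C.
  have [/existsP [C cC]|/existsPn no] := boolP [exists C, cut C]; first by exists C.
  have : gain [set f] <= 3 * #|@set0 I|.
    apply: gain_drop; rewrite ?sub1set ?cards0 //; first by lia.
    by move=> C cC; move: (no C); rewrite cC.
  by rewrite /gain cards1 cards0.
have nB : B != set0.
  by have [l lB _] := hull_cover (a f.1) fB cC0; apply/set0Pn; exists l.
have [p hp gp] := gain_pieces h0 hK (conn_covering fB) nB.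
have : gain D <= gain (hull_arcs D B).
  apply: gainS; apply/subsetP=> g gD; rewrite inE gD /=.
  by have [l lB hl] := hull_cover (tail g) fB cC0; apply/exists_inP; exists l.
nia.
Qed.

End LocalOptimum.

End Cuts.

(** * Two-edge cuts of a cactus *)

Section Positions.
Variables (T : Type) (x0 : T) (P : pred T).

Lemma count_positions s : count P s = count (fun k => P (nth x0 s k)) (iota 0 (size s)).
Proof.
by rewrite -[in LHS](mkseq_nth x0 s) /mkseq count_map; apply: eq_count => k.
Qed.

Lemma count_le2 s i j :
  (forall k, k < size s -> P (nth x0 s k) -> k = i \/ k = j) -> count P s <= 2.
Proof.
move=> H; rewrite count_positions -size_filter.
apply: (@uniq_leq_size _ _ [:: i; j]); first by rewrite filter_uniq ?iota_uniq.
move=> k; rewrite mem_filter mem_iota add0n => /andP [Pk kl].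
by rewrite !inE; case: (H k kl Pk) => ->; rewrite eqxx ?orbT.
Qed.

Lemma count_le2_positions s : count P s <= 2 ->
  exists i j, forall k, k < size s -> P (nth x0 s k) -> k = i \/ k = j.
Proof.
rewrite count_positions -size_filter; set f := filter _ _ => sf.
(* With fewer than two positions the default 0 is as good as any index, since only membership in the
   pair is claimed. *)
exists (nth 0 f 0), (nth 0 f 1) => k kl Pk.
have : k \in f by rewrite mem_filter mem_iota add0n Pk.
by case: f sf => [|i [|j [|? ?]]] //= _; rewrite !inE;
  [move=> /eqP ->; left | case/orP=> /eqP ->; [left|right]].
Qed.

Lemma count_ge2 s i j : i < size s -> j < size s -> i != j ->
  P (nth x0 s i) -> P (nth x0 s j) -> 1 < count P s.
Proof.
move=> il jl ij Pi Pj; rewrite count_positions -size_filter.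
apply: (@uniq_leq_size _ [:: i; j]); first by rewrite /= inE ij.
by move=> k; rewrite !inE => /orP [] /eqP ->; rewrite mem_filter mem_iota add0n ?Pi ?Pj.
Qed.

End Positions.

Section Multigraph.
Variable n : nat.
Implicit Types (E H L : seq ('I_n * 'I_n)) (C : {set 'I_n}).

Definition crossing C (e : 'I_n * 'I_n) := (e.1 \in C) != (e.2 \in C).
(** In a cactus these are the cuts with exactly two edges, the ones that links have to cross. *)
Definition min_cut E C := [&& C != set0, C != setT & count (crossing C) E <= 2].

Lemma mem_remove2 x0 H i j e : e \in remove2 H i j <->
  exists k, [/\ k < size H, k != i, k != j & nth x0 H k = e].
Proof.
rewrite /remove2; split.
  case/mapP=> -[k e']; rewrite mem_filter => /andP [/= /andP [ki kj] kz] ->.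
  have sz : size (iota 0 (size H)) = size H by rewrite size_iota.
  have [m ml] := nthP (0, x0) kz; rewrite size_zip size_iota minnn in ml.
  rewrite nth_zip ?size_iota // nth_iota // add0n => -[ek ee]; exists m.
  by rewrite ek -ee -ek in ki kj *.
case=> k [kl ki kj <-]; apply/mapP; exists (k, nth x0 H k) => //.
rewrite mem_filter /= ki kj /=; apply/(nthP (0, x0)); exists k.
  by rewrite size_zip size_iota minnn.
by rewrite nth_zip ?size_iota // nth_iota.
Qed.

Lemma connect_no_crossing H C u v : (forall e, e \in H -> ~~ crossing C e) ->
  connect (adj H) u v -> (u \in C) = (v \in C).
Proof.
move=> nc; have cl : closed (adj H) (mem C).
  by move=> x y /hasP [e /nc]; rewrite /crossing negbK => /eqP ec /orP [] /eqP ee;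
    rewrite ee in ec.
by move/(closed_connect cl).
Qed.

(** Deleting the edges of a cut with at most two edges disconnects the graph. Conversely, if [u] and
    [v] are disconnected by a deletion, the vertices still reachable from [u] form a cut whose edges
    are all among the two deleted ones. *)
Lemma three_edge_connectedP H : three_edge_connected H <->
  forall C, C != set0 -> C != setT -> 2 < count (crossing C) H.
Proof.
split=> [con C /set0Pn [u uC] nT|cnt i j u v].
  rewrite ltnNge; apply/negP.
  have [v vC] : exists v, v \notin C.
    apply/existsP; rewrite -negb_forall; apply: contra nT => /forallP a.
    by apply/eqP/setP=> x; rewrite a inE.
  move=> /(count_le2_positions (u, u)) [i [j ij]].
  suff h e : e \in remove2 H i j -> ~~ crossing C e.
    by have := connect_no_crossing h (con i j u v); rewrite uC (negbTE vC).
  move=> /(mem_remove2 (u, u)) [k [kl ki kj <-]]; apply/negP=> /(ij k kl).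
  by case=> ek; [rewrite ek eqxx in ki | rewrite ek eqxx in kj].
apply: contraT => nuv; set R := remove2 H i j in nuv.
pose C := [set w | connect (adj R) u w].
have : 2 < count (crossing C) H.
  apply: cnt; first by apply/set0Pn; exists u; rewrite inE connect0.
  by apply/eqP=> e; have := in_setT v; rewrite -e inE (negbTE nuv).
rewrite ltnNge (_ : _ <= 2) //; apply: (count_le2 (x0 := (u, u)) (i := i) (j := j)).
move=> k kl ck.
have [->|ki] := eqVneq k i; first by left.
have [->|kj] := eqVneq k j; first by right.
have eR : nth (u, u) H k \in R by apply/(mem_remove2 (u, u)); exists k.
case: (nth _ _ _) eR ck => x y eR; rewrite /crossing /= !inE.
have xy : adj R x y by apply/hasP; exists (x, y); rewrite ?eqxx.
have yx : adj R y x by apply/hasP; exists (x, y); rewrite ?eqxx ?orbT.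
case/negP; apply/eqP; apply/idP/idP=> h; apply: connect_trans h _; exact: connect1.
Qed.

(** Some edge crosses the cut by connectedness, and it lies on a cycle [S]. The degrees of [S] over
    [C] have an even sum, to which an edge contributes an odd number exactly when it crosses, so a
    second edge of [S] crosses. *)
Lemma cactus_cut E C : is_cactus E -> C != set0 -> C != setT -> 1 < count (crossing C) E.
Proof.
move=> [con cyc] /set0Pn [u uC] nT.
have [v vC] : exists v, v \notin C.
  apply/existsP; rewrite -negb_forall; apply: contra nT => /forallP a.
  by apply/eqP/setP=> x; rewrite a inE.
have [e eE ce] : exists2 e, e \in E & crossing C e.
  apply/hasP; apply: contraT => /hasPn nc.
  by have := connect_no_crossing nc (con u v); rewrite uC (negbTE vC).
have [i il ei] := nthP (u, u) eE; pose oi := Ordinal il.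
have edgeE (k : 'I_(size E)) : edge_of k = nth (u, u) E k by rewrite /edge_of (tnth_nth (u, u)).
have [S [[[_ deg _] iS] _]] := cyc oi.
have [/existsP [k /and3P [kS ki ck]]|/existsPn no] :=
  boolP [exists k, [&& k \in S, k != oi & crossing C (edge_of k)]].
  by apply: (count_ge2 (x0 := (u, u)) (i := k) (j := i)); rewrite ?ei -?edgeE.
have ev : odd (\sum_(w in C) deg_in S w) = false.
  elim/big_rec: _ => // w s _; rewrite oddD => ->.
  by case: (deg w) => ->.
have : odd (\sum_(k in S) (((edge_of k).1 \in C) + ((edge_of k).2 \in C))) = false.
  rewrite -ev /deg_in exchange_big /=; congr odd; apply: eq_bigr => k _.
  have one (x : 'I_n) : \sum_(w in C) (x == w : nat) = (x \in C).
    have [xC|xC] := boolP (x \in C).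
      rewrite (bigD1 x) //= eqxx big1 // => w /andP [_ /negbTE nw].
      by rewrite eq_sym nw.
    by rewrite big1 // => w wC; case: eqP => // e'; rewrite e' wC in xC.
  by rewrite big_split /= !one.
rewrite (bigD1 oi) //= oddD.
have -> : odd (\sum_(k in S | k != oi) (((edge_of k).1 \in C) + ((edge_of k).2 \in C))) = false.
  elim/big_rec: _ => // k s /andP [kS ki] hs; rewrite oddD hs addbF.
  move: (no k); rewrite kS ki /crossing /= negbK => /eqP ->.
  by case: (_ \in C).
rewrite edgeE /= ei addbF; move: ce; rewrite /crossing.
by case: (e.1 \in C); case: (e.2 \in C).
Qed.

Lemma crossingC C e : crossing (~: C) e = crossing C e.
Proof. by rewrite /crossing !inE; case: (e.1 \in C); case: (e.2 \in C). Qed.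

Lemma min_cutC E C : min_cut E C -> min_cut E (~: C).
Proof.
rewrite /min_cut => /and3P [n0 nT c]; apply/and3P; split.
- by apply: contra nT => /eqP e; rewrite -(setCK C) e setC0.
- by apply: contra n0 => /eqP e; rewrite -(setCK C) e setCT.
- by rewrite (eq_count (crossingC C)).
Qed.

(** Submodularity: intersection and union together have at most 4 crossing edges, and the
    intersection takes at least 2 of them by [cactus_cut]. *)
Lemma min_cutU E C C' : is_cactus E -> min_cut E C -> min_cut E C' ->
  C :&: C' != set0 -> C :|: C' != setT -> min_cut E (C :|: C').
Proof.
move=> cE /and3P [n0 nT c] /and3P [n0' nT' c'] nI nU.
have nU0 : C :|: C' != set0.
  by have [x xC] := set0Pn _ n0; apply/set0Pn; exists x; rewrite inE xC.
rewrite /min_cut nU nU0 /=.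
have nIT : C :&: C' != setT.
  by apply: contra nT => /eqP e; rewrite -subTset -e subsetIl.
have := cactus_cut cE nI nIT.
suff : count (crossing (C :&: C')) E + count (crossing (C :|: C')) E <=
   count (crossing C) E + count (crossing C') E by lia.
elim: (E) => //= e s IH; rewrite addnACA [leqRHS]addnACA leq_add // {s IH}.
rewrite /crossing !inE.
by case: (e.1 \in C); case: (e.1 \in C'); case: (e.2 \in C); case: (e.2 \in C').
Qed.

Lemma has_sel_links L (A : {set 'I_(size L)}) (P : pred ('I_n * 'I_n)) :
  reflect (exists2 l, l \in A & P (edge_of l)) (has P (sel_links A)).
Proof.
have e : sel_links A = [seq edge_of l | l <- enum 'I_(size L) & l \in A].
  rewrite /sel_links filter_mask map_mask; congr mask.
  case: L A => [|x0 L] A.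
    by apply/esym/size0nil; rewrite size_map size_enum_ord.
  apply: (@eq_from_nth _ x0) => [|k kl]; first by rewrite size_map size_enum_ord.
  by rewrite (nth_map ord0) ?size_enum_ord // /edge_of (tnth_nth x0) nth_enum_ord.
rewrite e; apply: (iffP hasP) => [[_ /mapP [l + ->] Pl]|[l lA Pl]].
  by rewrite mem_filter => /andP [lA _]; exists l.
by exists (edge_of l) => //; apply: map_f; rewrite mem_filter lA mem_enum.
Qed.

Lemma feasibleP E L (A : {set 'I_(size L)}) : is_cactus E -> feasible E A <->
  covering (min_cut E) (fun l => (edge_of l).1) (fun l => (edge_of l).2) A.
Proof.
move=> cE; rewrite /feasible three_edge_connectedP; split=> [H C /and3P [n0 nT c]|H C n0 nT].
  have := H C n0 nT; rewrite count_cat => lt.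
  have /has_sel_links [l lA cl] : has (crossing C) (sel_links A) by rewrite has_count; lia.
  by exists l.
rewrite count_cat; have := cactus_cut cE n0 nT => h.
have [le|gt] := leqP (count (crossing C) E) 2; last by lia.
have [|l lA cl] := H C; first by rewrite /min_cut n0 nT.
have : has (crossing C) (sel_links A) by apply/has_sel_links; exists l.
by rewrite has_count; lia.
Qed.

End Multigraph.

(** * Structured Turing machine programs *)

Definition sym := option bool.
(** Head position and contents. The left end at 0 is an artefact of [nat]; runs start so far to its
    right that they never get there. *)
Definition tape := (nat * (nat -> sym))%type.
Definition upd (f : nat -> sym) p v q := if q == p then v else f q.
Definition mv (d : dir) (p : nat) : nat :=
  match d with DLeft => p.-1 | DRight => p.+1 | DStay => p end.

Lemma nat_fun_ext (T : Type) (f g : nat -> T) : (forall q, f q = g q) -> f = g.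
Proof. exact: FunctionalExtensionality.functional_extensionality. Qed.

Inductive tprog :=
| TStep of (sym -> sym * dir)
| TSeq of tprog & tprog
| TIf of pred sym & tprog & tprog
| TWhile of pred sym & tprog.

Inductive exec : tprog -> tape -> tape -> nat -> Prop :=
| EStep g p f : exec (TStep g) (p, f) (mv (g (f p)).2 p, upd f p (g (f p)).1) 1
| ESeq P Q s1 s2 s3 k1 k2 : exec P s1 s2 k1 -> exec Q s2 s3 k2 -> exec (TSeq P Q) s1 s3 (k1 + k2)
| EIfT (c : pred sym) P Q p f s k : c (f p) -> exec P (p, f) s k -> exec (TIf c P Q) (p, f) s k.+1
| EIfF (c : pred sym) P Q p f s k : ~~ c (f p) -> exec Q (p, f) s k -> exec (TIf c P Q) (p, f) s k.+1
| EWhileF (c : pred sym) P p f : ~~ c (f p) -> exec (TWhile c P) (p, f) (p, f) 1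
| EWhileT (c : pred sym) P p f s1 s2 k1 k2 : c (f p) -> exec P (p, f) s1 k1 ->
    exec (TWhile c P) s1 s2 k2 -> exec (TWhile c P) (p, f) s2 (k1 + k2).+1.

Fixpoint st (P : tprog) : finType :=
  match P with
  | TStep _ => unit
  | TSeq P Q => (st P + st Q)%type
  | TIf _ P Q => option (st P + st Q)
  | TWhile _ P => option (st P)
  end.

Fixpoint entry (P : tprog) : st P :=
  match P return st P with
  | TStep _ => tt
  | TSeq P Q => inl (entry P)
  | TIf _ P Q => None
  | TWhile _ P => None
  end.

(* The target [None] is the exit of the program. *)
Fixpoint delta (P : tprog) : st P -> sym -> option (st P) * (sym * dir) :=
  match P return st P -> sym -> option (st P) * (sym * dir) with
  | TStep g => fun _ a => (None, g a)
  | TSeq P Q => fun s a => match s with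
      | inl x => let y := delta x a in (Some (oapp inl (inr (entry Q)) y.1), y.2)
      | inr x => let y := delta x a in (omap inr y.1, y.2)
      end
  | TIf c P Q => fun s a => match s with
      | None => (Some (Some (if c a then inl (entry P) else inr (entry Q))), (a, DStay))
      | Some (inl x) => let y := delta x a in (omap (fun z => Some (inl z)) y.1, y.2)
      | Some (inr x) => let y := delta x a in (omap (fun z => Some (inr z)) y.1, y.2)
      end
  | TWhile c P => fun s a => match s with
      | None => (if c a then Some (Some (entry P)) else None, (a, DStay))
      | Some x => let y := delta x a in (Some (omap id y.1), y.2)
      end
  end.

Section Embedding.
Variables (Q : Type) (dl : Q -> sym -> Q * (sym * dir)).

Definition mstep (c : Q * tape) : Q * tape :=
  let y := dl c.1 (c.2.2 c.2.1) in
  (y.1, (mv y.2.2 c.2.1, upd c.2.2 c.2.1 y.2.1)).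

(** A copy of [P] inside a larger transition function, with the exit redirected to [x]. Parts of a
    compound program sit in it as such copies, which is what the induction in [exec_emb] uses. *)
Definition emb P (e : st P -> Q) (x : Q) := forall s a,
  dl (e s) a = (oapp e x (delta s a).1, (delta s a).2).

Lemma upd_id f p : upd f p (f p) = f.
Proof.
apply: nat_fun_ext => q; rewrite /upd.
by case: eqP => // ->.
Qed.

Lemma exec_emb P s s' k : exec P s s' k -> forall (e : st P -> Q) x, emb e x ->
  iter k mstep (e (entry P), s) = (x, s').
Proof.
elim=> {P s s' k} [g p f|P R s1 s2 s3 k1 k2 _ IH1 _ IH2|c P R p f s k cf _ IH|
  c P R p f s k cf _ IH|c P p f cf|c P p f s1 s2 k1 k2 cf _ IH1 _ IH2] e x em.
- by rewrite /= /mstep (em tt).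
- rewrite addnC iterD (IH1 (e \o inl) (e (inr (entry R)))).
    by apply: (IH2 (e \o inr)) => s a; rewrite /= em /=; case: (delta s a) => [[]].
  by move=> s a; rewrite /= em /=; case: (delta s a) => [[]].
- rewrite iterSr {2}/mstep /= em /= cf upd_id.
  by apply: (IH (fun z => e (Some (inl z)))) => y a; rewrite /= em /=; case: (delta y a) => [[]].
- rewrite iterSr {2}/mstep /= em /= (negbTE cf) upd_id.
  by apply: (IH (fun z => e (Some (inr z)))) => y a; rewrite /= em /=; case: (delta y a) => [[]].
- by rewrite /= /mstep /= em /= (negbTE cf) /= upd_id.
- rewrite iterSr {2}/mstep /= em /= cf upd_id addnC iterD.
  rewrite (IH1 (fun z => e (Some z)) (e None)); first exact: IH2.
  by move=> y a; rewrite /= em /=; case: (delta y a) => [[]].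
Qed.

End Embedding.

Section Machine.
Variable P : tprog.

(** The machine format reserves the first state for the start and the last for halting; the program
    states lie between. *)
Definition enc_st (s : st P) : 'I_(#|st P|.+2) :=
  lift ord0 (widen_ord (leqnSn _) (enum_rank s)).

Definition tm_of_delta (q : 'I_(#|st P|.+2)) (a : sym) : 'I_(#|st P|.+2) * (sym * dir) :=
  if q == ord0 then (enc_st (entry P), (a, DStay)) else
  if insub q.-1 is Some j then
    let y := delta (enum_val (j : 'I_#|st P|)) a in (oapp enc_st ord_max y.1, y.2)
  else (q, (a, DStay)).

Definition tm_of : TM := {| tm_k := #|st P|.+1;
  tm_delta := fun q a => let y := tm_of_delta q a in (y.1, y.2.1, y.2.2) |}.

Lemma enc_stE s : enc_st s = (enum_rank s).+1 :> nat.
Proof. by rewrite /enc_st lift0. Qed.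

Lemma emb_tm_of : emb tm_of_delta enc_st ord_max.
Proof.
move=> s a; rewrite /tm_of_delta; case: eqP => [e|_].
  by have := enc_stE s; rewrite e.
rewrite enc_stE /=.
by rewrite (valK (enum_rank s)) enum_rankK.
Qed.

Definition represents (c : config tm_of) (m : 'I_(#|st P|.+2) * tape) :=
  let: (q, l, a, r) := c in let: (q', (p, f)) := m in
  [/\ q = q', a = f p, forall i, nth None r i = f (p.+1 + i) &
    forall i, i < p -> nth None l i = f (p - i.+1)].

(** The head has to be off position 0, where [mv] stays in place while the machine moves on. *)
Lemma represents_step c m : represents c m -> 0 < m.2.1 ->
  represents (tm_step c) (mstep tm_of_delta m).
Proof.
case: c => [[[q l] a] r]; case: m => [q' [p f]] [<- -> hr hl] /= p0.
have [->|nq] := eqVneq q ord_max.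
  by rewrite /mstep /= /tm_of_delta /= insubF ?ltnn //= upd_id.
rewrite /mstep /=; case: (tm_of_delta q (f p)) => [q2 [w d]] /=.
have u i : i != p -> upd f p w i = f i by rewrite /upd => /negbTE ->.
have u0 : upd f p w p = w by rewrite /upd eqxx.
case: d => /=.
- case: l hl => [|b l] hl; split=> //.
  + by rewrite u ?subn1; [have := hl 0 p0; rewrite subn1 |lia].
  + case=> [|i]; rewrite /= ?addn0 prednK ?u0 // hr u; last by lia.
    by congr f; lia.
  + move=> i ip; rewrite nth_nil u; last by lia.
    have := hl i.+1; rewrite nth_nil => ->; last by lia.
    by congr f; lia.
  + by rewrite u ?subn1; [have := hl 0 p0; rewrite subn1 |lia].
  + case=> [|i]; rewrite /= ?addn0 prednK ?u0 // hr u; last by lia.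
    by congr f; lia.
  + move=> i ip; rewrite u; last by lia.
    have /= -> := hl i.+1; last by lia.
    by congr f; lia.
- case: r hr => [|b r] hr; split=> //.
  + by rewrite u; [have := hr 0; rewrite addn0|lia].
  + move=> i; rewrite nth_nil u; last by lia.
    by have := hr i.+1; rewrite nth_nil => ->; congr f; lia.
  + case=> [|i] ip /=; first by rewrite subn1 /= u0.
    by rewrite u; [rewrite hl; [congr f; lia|lia]|lia].
  + by rewrite u; [have := hr 0; rewrite addn0|lia].
  + move=> i; rewrite u; last by lia.
    by have /= -> := hr i.+1; congr f; lia.
  + case=> [|i] ip /=; first by rewrite subn1 /= u0.
    by rewrite u; [rewrite hl; [congr f; lia|lia]|lia].
- by split=> [//|//|i|i ip]; rewrite u ?hr ?hl //; lia.
Qed.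

Lemma represents_iter k c m : represents c m -> k <= m.2.1 ->
  represents (iter k (@tm_step _) c) (iter k (mstep tm_of_delta) m).
Proof.
elim: k c m => [//|k IH] c m rep km; rewrite !iterSr; apply: IH.
  by apply: represents_step => //; lia.
by case: m km {rep} => q [p f] /=; case: (tm_of_delta _ _).2.2 => /=; lia.
Qed.

Lemma tm_run_halted t c : tm_halted c -> tm_run (M := tm_of) t c = c.
Proof.
case: c => [[[q l] a] r]; rewrite /tm_halted /= => h.
by elim: t => //= t ->; rewrite /= h.
Qed.

(** The input starts at [p0], beyond the length of the run, so the artificial left end is out of
    reach. One extra step leaves the start state, and halted configurations are fixed, so any later
    time [t] shows the same result. *)
Lemma tm_of_correct (x : seq bool) p0 s' k t :
  exec P (p0, fun i => if i < p0 then None else nth None (map Some x) (i - p0)) s' k ->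
  k < p0 -> k < t ->
  exists l r, tm_run t (tm_init tm_of x) = (ord_max, l, s'.2 s'.1, r) /\
    forall i, nth None r i = s'.2 (s'.1.+1 + i).
Proof.
set f := fun _ => _ => ex kp kt.
have rep0 : represents (tm_init tm_of x) (ord0, (p0, f)).
  rewrite /f; clear; split=> [//||i|i ip].
  - by rewrite ltnn subnn; case: x.
  - rewrite ifF; last by lia.
    by rewrite (_ : p0.+1 + i - p0 = i.+1) ?nth_behead //; lia.
  - by rewrite nth_nil ifT //; lia.
have run : iter k.+1 (mstep tm_of_delta) (ord0, (p0, f)) = (ord_max, s').
  rewrite iterSr (_ : mstep _ _ = (enc_st (entry P), (p0, f))).
    exact: (exec_emb ex emb_tm_of).
  by rewrite /mstep /= upd_id.
have := represents_iter rep0 kp; rewrite run.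
set c := iter _ _ _ => rep.
have halt : tm_halted c.
  by case: c s' rep {run ex} => [[[q l] a] r] [p' f'] [-> _ _ _]; exact: eqxx.
have -> : tm_run t (tm_init tm_of x) = c.
  rewrite -(subnK kt) /tm_run iterD; exact: (tm_run_halted _ halt).
case: c s' rep {halt run ex} => [[[q l] a] r] [p' f'] [-> -> hr hl].
by exists l, r.
Qed.

End Machine.

(** * A LOOP language and its compilation *)

Definition execB P s s' B := exists2 k, k <= B & exec P s s' k.

Lemma execB_le P s s' B B' : execB P s s' B -> B <= B' -> execB P s s' B'.
Proof. by case=> k kB ex BB; exists k => //; apply: leq_trans BB. Qed.

Lemma execB_step g p f q f' : q = mv (g (f p)).2 p -> f' = upd f p (g (f p)).1 ->
  execB (TStep g) (p, f) (q, f') 1.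
Proof. by move=> -> ->; exists 1 => //; constructor. Qed.

Lemma execB_seq P Q s1 s2 s3 B1 B2 :
  execB P s1 s2 B1 -> execB Q s2 s3 B2 -> execB (TSeq P Q) s1 s3 (B1 + B2).
Proof.
move=> [k1 h1 e1] [k2 h2 e2]; exists (k1 + k2); first by lia.
exact: ESeq e1 e2.
Qed.

Lemma execB_if (c : pred sym) P Q p f s B :
  execB (if c (f p) then P else Q) (p, f) s B -> execB (TIf c P Q) (p, f) s B.+1.
Proof.
case e: (c (f p)) => -[k kB ex]; exists k.+1; rewrite ?ltnS //.
  exact: EIfT.
by apply: EIfF; rewrite ?e.
Qed.

Lemma execB_stop (c : pred sym) P p f : ~~ c (f p) -> execB (TWhile c P) (p, f) (p, f) 1.
Proof. by exists 1 => //; apply: EWhileF. Qed.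

Lemma execB_loop (c : pred sym) P p f s1 s2 B1 B2 : c (f p) -> execB P (p, f) s1 B1 ->
  execB (TWhile c P) s1 s2 B2 -> execB (TWhile c P) (p, f) s2 (B1 + B2).+1.
Proof.
move=> cf [k1 h1 e1] [k2 h2 e2]; exists (k1 + k2).+1; first by lia.
exact: EWhileT e1 e2.
Qed.

Definition TSkip := TStep (fun a => (a, DStay)).
Fixpoint TMoves d n := if n is m.+1 then TSeq (TStep (fun a => (a, d))) (TMoves d m) else TSkip.

Lemma execB_skip p f : execB TSkip (p, f) (p, f) 1.
Proof. by apply: execB_step; rewrite ?upd_id. Qed.

Lemma execB_right n p f : execB (TMoves DRight n) (p, f) (p + n, f) n.+1.
Proof.
elim: n p => [|n IH] p; first by rewrite addn0; apply: execB_skip.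
apply: (execB_seq (B1 := 1) (s2 := (p.+1, f))); first by apply: execB_step; rewrite ?upd_id.
by rewrite addnS -addSn.
Qed.

Lemma execB_left n p f : execB (TMoves DLeft n) (p, f) (p - n, f) n.+1.
Proof.
elim: n p => [|n IH] p; first by rewrite subn0; apply: execB_skip.
apply: (execB_seq (B1 := 1) (s2 := (p.-1, f))); first by apply: execB_step; rewrite ?upd_id.
by rewrite (_ : p - n.+1 = p.-1 - n) //; lia.
Qed.

Lemma execB_seek_right (c : pred sym) W k p f : (forall i, i < k -> c (f (p + i * W))) ->
  ~~ c (f (p + k * W)) ->
  execB (TWhile c (TMoves DRight W)) (p, f) (p + k * W, f) (k * W.+2 + 1).
Proof.
elim: k p => [|k IH] p h n; first by rewrite mul0n addn0 in n *; apply: execB_stop.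
have c0 : c (f p) by have := h 0 isT; rewrite mul0n addn0.
apply: execB_le (execB_loop c0 (execB_right W p f) _) _.
- rewrite mulSn addnA; apply: IH => [i ik|]; last by rewrite -addnA -mulSn.
  by rewrite -addnA -mulSn; apply: h.
- lia.
Qed.

Lemma execB_seek_left (c : pred sym) k p f : (forall i, i < k -> c (f (p - i))) -> ~~ c (f (p - k)) ->
  execB (TWhile c (TMoves DLeft 1)) (p, f) (p - k, f) (k * 3 + 1).
Proof.
elim: k p => [|k IH] p h n; first by rewrite subn0 in n *; apply: execB_stop.
have c0 : c (f p) by have := h 0 isT; rewrite subn0.
have e i : p - 1 - i = p - i.+1 by lia.
apply: execB_le (execB_loop c0 (execB_left 1 p f) _) _.
- by rewrite -(e k); apply: IH => [i ik|]; rewrite e //; apply: h.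
- lia.
Qed.

Inductive prog :=
| PSkip
| PPut of (bool -> bool) & nat & nat
| PInc of nat
| PReset of nat
| PSeq of prog & prog
| PIf of nat & nat & prog & prog
| PEq of nat & nat & prog & prog
| PFor of nat & prog.

(* A pointer takes its values in [0, N], where [N] stands for the null pointer. *)
Record state := State { ptr : nat -> nat; pl : nat -> nat -> bool }.
Definition setp s a i := State (fun b => if b == a then i else ptr s b) (pl s).
Definition setpl s p i v :=
  State (ptr s) (fun q j => if (q == p) && (j == i) then v else pl s q j).

Section Loop.
Variable N : nat.

Fixpoint eval P s : state :=
  match P with
  | PSkip => s
  | PPut g a p => if ptr s a < N then setpl s p (ptr s a) (g (pl s p (ptr s a))) else s
  | PInc a => if ptr s a < N then setp s a (ptr s a).+1 else s
  | PReset a => setp s a 0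
  | PSeq P Q => eval Q (eval P s)
  | PIf a p P Q => if (ptr s a < N) && pl s p (ptr s a) then eval P s else eval Q s
  | PEq a b P Q => if (ptr s a < N) && (ptr s b == ptr s a) then eval P s else eval Q s
  | PFor a P => setp (iteri N (fun i s => eval P (setp s a i)) s) a N
  end.

Fixpoint mods P : seq nat :=
  match P with
  | PSkip | PPut _ _ _ => [::]
  | PInc a | PReset a => [:: a]
  | PSeq P Q | PIf _ _ P Q | PEq _ _ P Q => mods P ++ mods Q
  | PFor a P => a :: mods P
  end.

Fixpoint plmods P : seq nat :=
  match P with
  | PSkip | PInc _ | PReset _ => [::]
  | PPut _ _ p => [:: p]
  | PSeq P Q | PIf _ _ P Q | PEq _ _ P Q => plmods P ++ plmods Q
  | PFor a P => plmods P
  end.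

Lemma eval_ptr P s a : a \notin mods P -> ptr (eval P s) a = ptr s a.
Proof.
elim: P s => //=.
- by move=> g b p s _; case: ifP.
- by move=> b s; rewrite inE => /negbTE nb; case: ifP => //= _; rewrite nb.
- by move=> b s; rewrite inE => /negbTE ->.
- by move=> P IHP Q IHQ s; rewrite mem_cat negb_or => /andP [/IHP hP /IHQ hQ]; rewrite hQ hP.
- by move=> b p P IHP Q IHQ s; rewrite mem_cat negb_or => /andP [/IHP hP /IHQ hQ]; case: ifP.
- by move=> b p P IHP Q IHQ s; rewrite mem_cat negb_or => /andP [/IHP hP /IHQ hQ]; case: ifP.
move=> b P IH s; rewrite inE negb_or => /andP [/negbTE nb /IH h]; rewrite nb.
by elim: (N) s => //= m IHm s; rewrite h /= nb IHm.
Qed.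

Lemma eval_pl P s p : p \notin plmods P -> pl (eval P s) p = pl s p.
Proof.
elim: P s => //=.
- move=> g b q s; rewrite inE => /negbTE nq; case: ifP => //= _.
  by apply: FunctionalExtensionality.functional_extensionality => j; rewrite nq.
- by move=> b s _; case: ifP.
- by move=> P IHP Q IHQ s; rewrite mem_cat negb_or => /andP [/IHP hP /IHQ hQ]; rewrite hQ hP.
- by move=> b q P IHP Q IHQ s; rewrite mem_cat negb_or => /andP [/IHP hP /IHQ hQ]; case: ifP.
- by move=> b q P IHP Q IHQ s; rewrite mem_cat negb_or => /andP [/IHP hP /IHQ hQ]; case: ifP.
move=> b P IH s /IH h.
by elim: (N) s => //= m IHm s; rewrite h /= IHm.
Qed.

Definition bounded s := forall a, ptr s a <= N.

Lemma bounded_setp s a i : bounded s -> i <= N -> bounded (setp s a i).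
Proof. by move=> b iN c /=; case: ifP. Qed.

Lemma eval_bounded P s : bounded s -> bounded (eval P s).
Proof.
elim: P s => //=.
- by move=> g b p s bs; case: ifP.
- by move=> b s bs; case: ifP => // lt; apply: bounded_setp.
- by move=> b s bs; apply: bounded_setp.
- by move=> P IHP Q IHQ s bs; apply/IHQ/IHP.
- by move=> b q P IHP Q IHQ s bs; case: ifP => _; [apply: IHP|apply: IHQ].
- by move=> b q P IHP Q IHQ s bs; case: ifP => _; [apply: IHP|apply: IHQ].
move=> b P IH s bs; apply: bounded_setp => //.
suff H m : m <= N -> bounded (iteri m (fun i s => eval P (setp s b i)) s) by apply: H.
elim: m => //= m IHm mN; apply: IH; apply: bounded_setp; last by lia.
by apply: IHm; lia.
Qed.

End Loop.

(** * Pointers as marks in memory blocks, and the compilation of programs *)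

Section Compile.
Variables (np nq W : nat).
Hypothesis WE : W = np + nq.

Fixpoint wf P : bool :=
  match P with
  | PSkip => true
  | PPut _ a p => (a < nq) && (p < np)
  | PInc a | PReset a => a < nq
  | PSeq P Q => wf P && wf Q
  | PIf a p P Q => [&& a < nq, p < np, wf P & wf Q]
  | PEq a b P Q => [&& a < nq, b < nq, wf P & wf Q]
  | PFor a P => [&& a < nq, a \notin mods P & wf P]
  end.

Definition is_blank (x : sym) := x == None.
Definition TBack := TWhile (fun x => ~~ is_blank x) (TMoves DLeft 1).
(** A pointer is a track of the memory with a single [true], in the block of its value. A null
    pointer has no mark, and the search then stops at the blank behind the memory. *)
Definition TGoto a := TSeq (TMoves DRight (np + a).+1)
  (TWhile (fun x => x == Some false) (TMoves DRight W)).
(** In the null case the head is at offset [np + a] behind the memory; the moves to the left bring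
    it to the last memory symbol, from which [TBack] finds the way home. *)
Definition TAt a P Q := TSeq (TGoto a)
  (TIf is_blank (TSeq (TMoves DLeft (np + a).+1) (TSeq TBack Q)) P).
Definition TShift o o' := TSeq (TMoves DRight (o' - o)) (TMoves DLeft (o - o')).
Definition TWrite (x : sym) := TStep (fun _ => (x, DStay)).
Definition TMapBit (g : bool -> bool) := TStep (fun x => (omap g x, DStay)).

(** When the mark would leave the last block it is just erased, and this represents the null
    value. *)
Definition TInc a := TAt a (TSeq (TWrite (Some false)) (TSeq (TMoves DRight W)
   (TIf is_blank (TSeq (TMoves DLeft (np + a).+1) TBack)
                 (TSeq (TWrite (Some true)) TBack)))) TSkip.

Definition TReset a :=
  TSeq (TAt a (TSeq (TWrite (Some false)) TBack) TSkip)
       (TSeq (TMoves DRight (np + a).+1) (TSeq (TWrite (Some true)) TBack)).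

Fixpoint compile P : tprog :=
  match P with
  | PSkip => TSkip
  | PPut g a p => TAt a (TSeq (TShift (np + a) p) (TSeq (TMapBit g) TBack)) TSkip
  | PInc a => TInc a
  | PReset a => TReset a
  | PSeq P Q => TSeq (compile P) (compile Q)
  | PIf a p P Q => TAt a (TSeq (TShift (np + a) p)
      (TIf (fun x => x == Some true) (TSeq TBack (compile P)) (TSeq TBack (compile Q)))) (compile Q)
  | PEq a b P Q => TAt a (TSeq (TShift (np + a) (np + b))
      (TIf (fun x => x == Some true) (TSeq TBack (compile P)) (TSeq TBack (compile Q)))) (compile Q)
  (* the blank left of the memory is overwritten to signal the end of the loop *)
  | PFor a P => TSeq (TReset a) (TSeq
      (TWhile is_blank (TSeq (compile P) (TSeq (TInc a) (TAt a TBack (TWrite (Some true))))))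
      (TWrite None))
  end.

Variables (N h U : nat).
Hypothesis N0 : 0 < N.
Hypothesis UE : U = W.+2 * N.+1.
Notation cell i o := (h.+1 + (i * W + o)).

(** [U] dominates a sweep over the memory, and the multiples of it are generous allowances for the
    bookkeeping of one instruction. A loop multiplies by [N], so a fixed program is polynomial in
    [N]. *)
Fixpoint time P : nat :=
  match P with
  | PSkip | PPut _ _ _ | PInc _ | PReset _ => 30 * U
  | PSeq P Q => time P + time Q
  | PIf _ _ P Q | PEq _ _ P Q => time P + time Q + 30 * U
  | PFor a P => N * (time P + 90 * U) + 90 * U
  end.

Definition bits s o i := if o < np then pl s o i else ptr s (o - np) == i.

(** The blank at [h] is the home position of the head between instructions; the blanks behind the
    memory stop the searches for null pointers. *)
Definition stores s (f : nat -> sym) :=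
  [/\ f h = None, forall i o, i < N -> o < W -> f (cell i o) = Some (bits s o i) &
      forall q, N * W <= q -> f (h.+1 + q) = None].

Lemma cell_inj i o i' o' : o < W -> o' < W -> cell i o = cell i' o' -> i = i' /\ o = o'.
Proof.
move=> oW oW' e; have e2 : i * W + o = i' * W + o' by lia.
have W0 : 0 < W by lia.
have e3 : i = i'.
  by have := congr1 (divn^~ W) e2; rewrite !divnMDl // !divn_small // !addn0.
by split=> //; move: e2; rewrite e3; lia.
Qed.

Lemma cell_lt i o : i < N -> o < W -> i * W + o < N * W.
Proof. by move=> iN oW; have : i.+1 * W <= N * W by [apply: leq_mul]; lia. Qed.

Lemma mem_upd s s' f i o v : stores s f -> i < N -> o < W ->
  (forall i' o', i' < N -> o' < W ->
     bits s' o' i' = if (o' == o) && (i' == i) then v else bits s o' i') ->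
  stores s' (upd f (cell i o) (Some v)).
Proof.
move=> [f0 fM fN] iN oW H; have lt := cell_lt iN oW; split.
- by rewrite /upd ifF //; lia.
- move=> i' o' iN' oW'; rewrite H // /upd.
  case: eqP => [/(cell_inj oW' oW) [-> ->]|ne]; first by rewrite !eqxx.
  rewrite fM //; case: eqP => [eo|//]; case: eqP => [ei|//].
  by case: ne; rewrite eo ei.
- by move=> q qN; rewrite /upd ifF ?fN //; apply/eqP; lia.
Qed.

Lemma mem_ext s s' f : stores s f ->
  (forall i o, i < N -> o < W -> bits s' o i = bits s o i) -> stores s' f.
Proof. by move=> [f0 fM fN] H; split=> // i o iN oW; rewrite fM ?H. Qed.

Lemma execB_back s f q : stores s f -> q < N * W -> execB TBack (h.+1 + q, f) (h, f) (4 * U).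
Proof.
move=> [f0 fM fN] qN; have W0 : 0 < W by case: (W) qN; rewrite ?muln0.
have H : execB TBack (h.+1 + q, f) (h.+1 + q - q.+1, f) (q.+1 * 3 + 1).
  apply: execB_seek_left => [i iq|].
    have -> : h.+1 + q - i = h.+1 + (q - i) by lia.
    rewrite (divn_eq (q - i) W) fM ?ltn_pmod // ltn_divLR //; lia.
  by rewrite (_ : _ - _ = h) ?f0 //; lia.
rewrite (_ : _ - _ = h) in H; last by lia.
apply: execB_le H _; rewrite UE; nia.
Qed.

Lemma execB_goto s f a : stores s f -> bounded N s -> a < nq ->
  execB (TGoto a) (h, f) (cell (ptr s a) (np + a), f) (2 * U).
Proof.
move=> [f0 fM fN] bs aq; have aW : np + a < W by rewrite WE; lia.
have e : cell (ptr s a) (np + a) = h + (np + a).+1 + ptr s a * W by lia.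
have bt i : bits s (np + a) i = (ptr s a == i).
  by rewrite /bits ltnNge leq_addr addKn.
rewrite e; apply: execB_le (execB_seq (execB_right _ _ _) (@execB_seek_right _ W _ _ _ _ _)) _.
- move=> i ip; have -> : h + (np + a).+1 + i * W = cell i (np + a) by lia.
  rewrite fM //; last by have := bs a; lia.
  by rewrite bt gtn_eqF.
- rewrite -e; have := bs a; rewrite leq_eqVlt => /orP [/eqP ->|lt].
    by rewrite fN //; lia.
  by rewrite fM // bt eqxx.
- have := bs a; rewrite UE; nia.
Qed.

Lemma execB_at s f a P Q s' B : stores s f -> bounded N s -> a < nq ->
  (ptr s a < N -> execB P (cell (ptr s a) (np + a), f) s' B) ->
  (ptr s a = N -> execB Q (h, f) s' B) ->
  execB (TAt a P Q) (h, f) s' (B + 8 * U).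
Proof.
move=> mf bs aq hP hQ; have [f0 fM fN] := mf.
have aW : np + a < W by rewrite WE; lia.
have U2 : W.+2 <= U by rewrite UE; nia.
have : ptr s a <= N := bs a; rewrite leq_eqVlt => /orP [/eqP e|lt].
  apply: execB_le (execB_seq (execB_goto mf bs aq) (execB_if (B := W.+2 + (4 * U + B)) _)) _; last by lia.
  rewrite e fN ?leq_addr // /is_blank eqxx.
  apply: execB_seq.
    by apply: execB_le (execB_left _ _ _) _; lia.
  apply: execB_seq (hQ e).
  have -> : cell N (np + a) - (np + a).+1 = h.+1 + (N * W).-1.
    by have : 0 < N * W; [rewrite muln_gt0 N0; lia|lia].
  by apply: execB_back mf _; rewrite prednK // muln_gt0 N0; lia.
apply: execB_le (execB_seq (execB_goto mf bs aq) (execB_if (B := B) _)) _; last by lia.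
by rewrite fM // /is_blank; apply: hP.
Qed.

Lemma execB_shift i o o' f : o < W -> o' < W ->
  execB (TShift o o') (cell i o, f) (cell i o', f) (2 * U).
Proof.
move=> oW oW'; apply: execB_le (execB_seq (execB_right _ _ _) _) _.
- have -> : cell i o' = cell i o + (o' - o) - (o - o') by lia.
  exact: execB_left.
- rewrite UE; nia.
Qed.

Lemma execB_write x p f : execB (TWrite x) (p, f) (p, upd f p x) 1.
Proof. exact: execB_step. Qed.

Lemma bits_ptr s a i : bits s (np + a) i = (ptr s a == i).
Proof. by rewrite /bits ltnNge leq_addr addKn. Qed.

Lemma bits_setp s a j i o : o < W ->
  bits (setp s a j) o i = if o == np + a then j == i else bits s o i.
Proof.
move=> oW; rewrite /bits /=; case: ltnP => [lt|ge]; first by rewrite ifF //; lia.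
by rewrite (_ : (o - np == a) = (o == np + a)); [case: (o == np + a)|lia].
Qed.

Definition realizes T s s' B := forall f, stores s f ->
  exists2 f', stores s' f' & execB T (h, f) (h, f') B.

Lemma realizes_le T s s' B B' : realizes T s s' B -> B <= B' -> realizes T s s' B'.
Proof. by move=> H le f /H [f' mf ex]; exists f' => //; apply: execB_le le. Qed.

Lemma realizes_seq T T' s1 s2 s3 B B' :
  realizes T s1 s2 B -> realizes T' s2 s3 B' -> realizes (TSeq T T') s1 s3 (B + B').
Proof.
move=> H H' f /H [f2 m2 e2]; have [f3 m3 e3] := H' _ m2; exists f3 => //.
exact: execB_seq e2 e3.
Qed.

Lemma realizes_skip s : realizes TSkip s s 1.
Proof. by move=> f mf; exists f => //; apply: execB_skip. Qed.

(** One lemma for both tests: [PIf] inspects a plane and [PEq] the mark of the second pointer, and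
    either is a track of the block to which [a] points. *)
Lemma realizes_test s a o P Q s' B : bounded N s -> a < nq -> o < W ->
  realizes (if (ptr s a < N) && bits s o (ptr s a) then P else Q) s s' B ->
  realizes (TAt a (TSeq (TShift (np + a) o)
      (TIf (fun x => x == Some true) (TSeq TBack P) (TSeq TBack Q))) Q) s s' (B + 16 * U).
Proof.
move=> bs aq oW H f mf; have [f' mf' ex] := H f mf; exists f' => //.
have aW : np + a < W by rewrite WE; lia.
apply: execB_le (execB_at (B := B + 7 * U) mf bs aq _ _) _; last by lia.
- move=> lt; rewrite lt /= in ex; have [f0 fM fN] := mf.
  apply: execB_le (execB_seq (execB_shift _ _ aW oW) (execB_if (B := 4 * U + B) _)) _; last first.
    by rewrite UE; lia.
  rewrite fM //; case: (bits s o _) ex => ex; apply: execB_seq ex;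
    by apply: execB_back mf _; apply: cell_lt.
- by move=> e; rewrite e ltnn /= in ex; apply: execB_le ex _; lia.
Qed.

Lemma realizes_put s g a p : bounded N s -> a < nq -> p < np ->
  realizes (compile (PPut g a p)) s (eval N (PPut g a p) s) (30 * U).
Proof.
move=> bs aq pp f mf /=; have [f0 fM fN] := mf.
have aW : np + a < W by rewrite WE; lia.
have pW : p < W by rewrite WE; lia.
case: ltnP => [lt|ge]; last first.
  exists f => //; apply: execB_le (execB_at (B := 1) mf bs aq _ _) _; rewrite ?UE; try lia.
  by move=> _; apply: execB_skip.
set v := g _; pose f' := upd f (cell (ptr s a) p) (Some v).
have mf' : stores (setpl s p (ptr s a) v) f'.
  apply: mem_upd mf _ _ _ => // i o iN oW; rewrite /bits /=.
  by case: ltnP => // ge; rewrite ifF //; lia.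
exists f' => //; apply: execB_le (execB_at (B := 7 * U) mf bs aq _ _) _; try lia.
move=> _; apply: execB_le (execB_seq (execB_shift _ _ aW pW) (execB_seq (execB_step (q := cell (ptr s a) p) (f' := f') _ _) (execB_back mf' _))) _ => //.
- by rewrite fM //= /bits pp.
- exact: cell_lt.
- by rewrite UE; lia.
Qed.

Lemma realizes_inc s a : bounded N s -> a < nq ->
  realizes (TInc a) s (eval N (PInc a) s) (30 * U).
Proof.
move=> bs aq f mf /=; have [f0 fM fN] := mf.
have aW : np + a < W by rewrite WE; lia.
have W0 : 0 < W by lia.
case: ltnP => [lt|ge]; last first.
  exists f => //; apply: execB_le (execB_at (B := 1) mf bs aq _ _) _; rewrite ?UE; try lia.
  by move=> _; apply: execB_skip.
pose f1 := upd f (cell (ptr s a) (np + a)) (Some false).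
have mf1 : stores (setp s a N) f1.
  apply: mem_upd mf _ _ _ => // i o iN oW; rewrite bits_setp //.
  case: eqP => [->|//]; rewrite bits_ptr eq_sym.
  by rewrite (ltn_eqF iN) /= eq_sym; case: (ptr s a == i).
pose f2 := if (ptr s a).+1 < N then upd f1 (cell (ptr s a).+1 (np + a)) (Some true) else f1.
have mf2 : stores (setp s a (ptr s a).+1) f2.
  rewrite /f2; case: ltnP => [lt2|ge2].
    apply: mem_upd mf1 _ _ _ => // i o iN oW; rewrite !bits_setp //.
    by case: eqP => //= _; rewrite eq_sym; case: eqP => // _; lia.
  apply: mem_ext mf1 _ => i o iN oW; rewrite !bits_setp //.
  by case: eqP => // _; lia.
exists f2 => //; apply: execB_le (execB_at (B := 16 * U) mf bs aq _ _) _; try lia.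
move=> _; have [g0 gM gN] := mf1.
apply: execB_le (execB_seq (execB_write _ _ _) (execB_seq (execB_right _ _ _) (execB_if (B := 8 * U) _))) _; last first.
  by rewrite UE; nia.
have -> : cell (ptr s a) (np + a) + W = cell (ptr s a).+1 (np + a) by lia.
rewrite -/f1 /f2; case: (ltnP _.+1 N) => [lt2|ge2].
  rewrite gM // /is_blank /=.
  apply: execB_le (execB_seq (execB_write _ _ _) (execB_back (s := setp s a (ptr s a).+1) _ _)) _.
  + by move: mf2; rewrite /f2 lt2.
  + exact: cell_lt.
  + by rewrite UE; lia.
rewrite gN; last by have : N * W <= (ptr s a).+1 * W by [apply: leq_mul]; lia.
rewrite /is_blank eqxx; apply: execB_le (execB_seq (execB_left _ _ _) _) _.
- have -> : cell (ptr s a).+1 (np + a) - (np + a).+1 = h.+1 + (N * W).-1.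
    have -> : (ptr s a).+1 = N by lia.
    by have : 0 < N * W; [rewrite muln_gt0 N0; lia|lia].
  by apply: execB_back mf1 _; rewrite prednK // muln_gt0 N0.
- by rewrite UE; nia.
Qed.

Lemma realizes_reset s a : bounded N s -> a < nq ->
  realizes (TReset a) s (eval N (PReset a) s) (30 * U).
Proof.
move=> bs aq /=; have aW : np + a < W by rewrite WE; lia.
apply: realizes_le (realizes_seq (s2 := setp s a N) (B := 14 * U) (B' := 10 * U) _ _) _; last by lia.
- move=> f mf; pose f1 := upd f (cell (ptr s a) (np + a)) (Some false).
  have [lt|ge] := ltnP (ptr s a) N.
    have mf1 : stores (setp s a N) f1.
      apply: mem_upd mf _ _ _ => // i o iN oW; rewrite bits_setp //.
      case: eqP => [->|//]; rewrite bits_ptr eq_sym.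
      by rewrite (ltn_eqF iN) /= eq_sym; case: (ptr s a == i).
    exists f1 => //; apply: execB_le (execB_at (B := 6 * U) mf bs aq _ _) _; try lia.
    move=> _; apply: execB_le (execB_seq (execB_write _ _ _) (execB_back mf1 _)) _.
      exact: cell_lt.
    by rewrite UE; lia.
  exists f.
    apply: mem_ext mf _ => i o iN oW; rewrite bits_setp //; case: eqP => // ->.
    by rewrite bits_ptr; have := bs a; lia.
  apply: execB_le (execB_at (B := 1) mf bs aq _ _) _; rewrite ?UE; try lia.
  by move=> _; apply: execB_skip.
move=> f mf; pose f1 := upd f (cell 0 (np + a)) (Some true).
have mf1 : stores (setp s a 0) f1.
  apply: mem_upd mf _ _ _ => // i o iN oW; rewrite !bits_setp //.
  by case: eqP => //= _; rewrite eq_sym; case: eqP => // _; lia.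
exists f1 => //.
apply: execB_le (execB_seq (execB_right _ _ _) (execB_seq (execB_write _ _ _) _)) _.
- have -> : h + (np + a).+1 = cell 0 (np + a) by lia.
  by apply: execB_back mf1 _; apply: cell_lt.
- by rewrite UE; nia.
Qed.

Lemma realizes_for s a P T : bounded N s -> a < nq -> a \notin mods P ->
  (forall s, bounded N s -> realizes (compile P) s (eval N P s) T) ->
  realizes (compile (PFor a P)) s (eval N (PFor a P) s) (N * (T + 90 * U) + 90 * U).
Proof.
move=> bs aq na IH.
pose st i := iteri i (fun i s => eval N P (setp s a i)) s.
have stS i : st i.+1 = eval N P (setp (st i) a i) by [].
have bst i : i <= N -> bounded N (st i).
  elim: i => //= i IHi iN; apply: eval_bounded; apply: bounded_setp; last by lia.
  by apply: IHi; lia.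
pose body := TSeq (compile P) (TSeq (TInc a) (TAt a TBack (TWrite (Some true)))).
(* [k.+1] iterations remain. The last one is the base case, because there the increment makes the
   pointer null and the flag is set at [h]. *)
have loop k i f : i + k.+1 = N -> stores (setp (st i) a i) f -> exists2 f', stores (setp (st N) a N) f' &
    execB (TWhile is_blank body) (h, f) (h, upd f' h (Some true)) (k.+1 * (T + 50 * U) + 1).
  elim: k i f => [|k IHk] i f iN mf; have [f0 _ _] := mf.
  - have bi : bounded N (setp (st i) a i) by apply: bounded_setp; [apply: bst|]; lia.
    have [f1 mf1 e1] := IH _ bi f mf.
    have bi1 := eval_bounded P bi.
    have [f2 mf2 e2] := realizes_inc bi1 aq mf1.
    have pa : ptr (eval N P (setp (st i) a i)) a = i by rewrite eval_ptr //= eqxx.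
    rewrite /= pa ifT in mf2; last by lia.
    have ei : i.+1 = N by lia.
    rewrite -stS ei in mf2.
    have e3 : execB (TAt a TBack (TWrite (Some true))) (h, f2) (h, upd f2 h (Some true)) (1 + 8 * U).
      apply: execB_at mf2 _ aq _ _; first by apply: bounded_setp; [apply: bst|].
        by rewrite /= eqxx ltnn.
      by move=> _; apply: execB_write.
    have cf : is_blank (f h) by rewrite f0.
    exists f2 => //; apply: execB_le (execB_loop cf (execB_seq e1 (execB_seq e2 e3)) (execB_stop _ _)) _.
      by rewrite /upd eqxx.
    by rewrite UE; lia.
  - have bi : bounded N (setp (st i) a i) by apply: bounded_setp; [apply: bst|]; lia.
    have [f1 mf1 e1] := IH _ bi f mf.
    have bi1 := eval_bounded P bi.
    have [f2 mf2 e2] := realizes_inc bi1 aq mf1.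
    have pa : ptr (eval N P (setp (st i) a i)) a = i by rewrite eval_ptr //= eqxx.
    rewrite /= pa ifT in mf2; last by lia.
    rewrite -stS in mf2.
    have [|f3 mf3 e3] := IHk i.+1 f2 _ mf2; first by lia.
    have e4 : execB (TAt a TBack (TWrite (Some true))) (h, f2) (h, f2) (4 * U + 8 * U).
      apply: (execB_at mf2 _ aq); first by apply: bounded_setp; [apply: bst|]; lia.
        move=> _ /=; rewrite eqxx; apply: execB_back mf2 _; apply: cell_lt; first by lia.
        by rewrite WE; lia.
      by move=> /= ; rewrite eqxx; lia.
    have cf : is_blank (f h) by rewrite f0.
    exists f3 => //; apply: execB_le (execB_loop cf (execB_seq e1 (execB_seq e2 e4)) e3) _.
    by rewrite UE; lia.
move=> f mf; have [f1 mf1 e1] := realizes_reset bs aq mf.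
have [|f2 mf2 e2] := loop N.-1 0 f1 _ mf1; first by lia.
rewrite prednK // in e2.
exists f2 => //; have [f0 _ _] := mf2.
apply: execB_le (execB_seq e1 (execB_seq e2 (execB_step (q := h) (f' := f2) _ _))) _ => //.
  apply: nat_fun_ext => q; rewrite /upd /=.
  by case: eqP => // ->.
by rewrite UE; nia.
Qed.

Lemma compile_correct P s : wf P -> bounded N s ->
  realizes (compile P) s (eval N P s) (time P).
Proof.
have U0 : 0 < U by rewrite UE; lia.
elim: P s => /=.
- by move=> s _ _; refine (realizes_le (@realizes_skip s) _); lia.
- by move=> g a p s /andP [aq pp] bs; apply: realizes_put.
- by move=> a s aq bs; apply: realizes_inc.
- by move=> a s aq bs; apply: realizes_reset.
- move=> P IHP Q IHQ s /andP [wP wQ] bs; refine (realizes_seq (IHP _ wP bs) _).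
  by apply: IHQ => //; apply: eval_bounded.
- move=> a p P IHP Q IHQ s /and4P [aq pp wP wQ] bs.
  refine (realizes_le (realizes_test (o := p) (B := time P + time Q) bs aq _ _) _); last by lia.
    by rewrite WE; lia.
  rewrite /bits pp; case: ifP => _.
    by refine (realizes_le (IHP _ wP bs) _); lia.
  by refine (realizes_le (IHQ _ wQ bs) _); lia.
- move=> a b P IHP Q IHQ s /and4P [aq bq wP wQ] bs.
  refine (realizes_le (realizes_test (o := np + b) (B := time P + time Q) bs aq _ _) _); last by lia.
    by rewrite WE; lia.
  rewrite bits_ptr; case: ifP => _.
    by refine (realizes_le (IHP _ wP bs) _); lia.
  by refine (realizes_le (IHQ _ wQ bs) _); lia.
- move=> a P IH s /and3P [aq na wP] bs; apply: realizes_for => // s' bs'.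
  exact: IH.
Qed.

End Compile.

(** * Moving data between two tape regions *)

Fixpoint TErase w :=
  if w is v.+1 then TSeq (TStep (fun _ => (None, DRight))) (TErase v) else TSkip.
Definition TEmit (l : seq bool) :=
  foldr (fun v => TSeq (TStep (fun _ => (Some v, DRight)))) TSkip l.
Definition TForth := TWhile (fun x => ~~ is_blank x) (TMoves DRight 1).

Definition TChunk w o g (v : bool) :=
  TSeq (TMoves DLeft o) (TSeq (TErase w) (TSeq TForth (TSeq (TMoves DRight 1) (TSeq TForth
  (TSeq (TEmit (g v)) (TSeq (TMoves DLeft 1) (TSeq TBack (TSeq (TMoves DLeft 1)
  (TSeq TBack (TMoves DRight 1)))))))))).

(* Consumes, from left to right, the width-[w] chunks of the block under the head, and for a
   chunk with bit [v] at offset [o] appends [g v] to the block right of the next blank. *)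
Definition TTrans w o g :=
  TWhile (fun x => ~~ is_blank x) (TSeq (TMoves DRight o)
    (TIf (fun x => x == Some true) (TChunk w o g true) (TChunk w o g false))).

Section Transducer.
Variables (w o : nat) (g : bool -> seq bool) (b K m : nat) (src : nat -> bool) (f : nat -> sym).

Definition output j := flatten (mkseq (fun i => g (src (i * w + o))) j).

Lemma outputS j : output j.+1 = output j ++ g (src (j * w + o)).
Proof. by rewrite /output /mkseq -addn1 iotaD map_cat flatten_cat /= cats0. Qed.

(** The intermediate tape: the source block at [b] with its first [e] cells erased, a separating
    blank, and the output [D] behind it. *)
Definition tp e (D : seq bool) q :=
  if q < b then f q else if q < b + e then None else if q < b + K * w then f q
  else if q == b + K * w then None else nth None (map Some D) (q - (b + K * w).+1).

Lemma execB_erase n e D : e + n <= K * w ->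
  execB (TErase n) (b + e, tp e D) (b + (e + n), tp (e + n) D) n.+1.
Proof.
elim: n e => [|n IH] e le; first by rewrite addn0; apply: execB_skip.
rewrite addnS -addSn; apply: (execB_seq (B1 := 1) (s2 := (b + e.+1, tp e.+1 D))).
  apply: execB_step; first by rewrite addnS.
  apply: nat_fun_ext => q; rewrite /tp /upd /=.
  have [->|ne] := eqVneq q (b + e).
    by rewrite ltnNge leq_addr /= addnS ltnSn.
  by rewrite addnS ltnS (leq_eqVlt q (b + e)) (negbTE ne).
by apply: IH; lia.
Qed.

Lemma execB_emit l e D : e <= K * w ->
  execB (TEmit l) ((b + K * w).+1 + size D, tp e D)
    ((b + K * w).+1 + size (D ++ l), tp e (D ++ l)) (size l).+1.
Proof.
move=> le; elim: l D => [|v l IH] D; first by rewrite cats0; apply: execB_skip.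
rewrite -cat_rcons; apply: (execB_seq (B1 := 1)); last exact: IH.
apply: execB_step; first by rewrite size_rcons addnS.
apply: nat_fun_ext => q; rewrite /tp /upd /=.
rewrite map_rcons nth_rcons size_map.
case: ltnP => qb; first by rewrite ifF //; lia.
case: ltnP => qe; first by rewrite ifF //; lia.
case: ltnP => qK; first by rewrite ifF //; lia.
case: eqVneq => qz; first by rewrite ifF //; lia.
have -> : (q == (b + K * w).+1 + size D) = (q - (b + K * w).+1 == size D) by lia.
case: ltnP => qD; first by rewrite ltn_eqF.
by case: eqP => // _; rewrite nth_default // size_map.
Qed.

Lemma tp_erased e D q : q < e -> tp e D (b + q) = None.
Proof. by move=> qe; rewrite /tp !ltn_add2l qe ltnNge leq_addr. Qed.

Lemma tp_sep e D : e <= K * w -> tp e D (b + K * w) = None.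
Proof. by move=> le; rewrite /tp !ltn_add2l ltnn !ltnNge leq_addr le eqxx. Qed.

Lemma tp_dst e D i : e <= K * w ->
  tp e D ((b + K * w).+1 + i) = nth None (map Some D) i.
Proof.
move=> le; rewrite /tp addKn.
by rewrite ifN; [rewrite ifN; [rewrite ifN; [rewrite ifN //|]|]|]; lia.
Qed.

Hypothesis ow : o < w.
Hypothesis g0 : forall v, 0 < size (g v).
Hypothesis fsrc : forall q, q < K * w -> f (b + q) = Some (src q).

Hypothesis sm : size (output K) <= m.

Lemma size_output j : j <= K -> size (output j) <= m.
Proof.
move=> jK; apply: leq_trans sm; rewrite -(subnKC jK).
elim: (K - j) => [|i IH]; first by rewrite addn0.
by rewrite addnS outputS size_cat; lia.
Qed.

Lemma tp_src e D q : e <= q -> q < K * w -> tp e D (b + q) = Some (src q).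
Proof. by move=> eq qK; rewrite /tp !ltn_add2l qK !ltnNge leq_addr eq fsrc. Qed.

Lemma execB_chunk j : j < K ->
  execB (TSeq (TMoves DRight o)
    (TIf (fun x => x == Some true) (TChunk w o g true) (TChunk w o g false)))
    (b + j * w, tp (j * w) (output j)) (b + j.+1 * w, tp (j.+1 * w) (output j.+1))
    (20 * (K * w + m + 1)).
Proof.
move=> jK; set e := j * w; set e2 := j.+1 * w; set D := output j; set D' := output j.+1.
have e2K : e2 <= K * w by rewrite leq_mul.
have e2E : e2 = e + w by rewrite /e2 mulSn addnC.
have mD' : size D' <= m by apply: size_output.
have sD : size D + size (g (src (e + o))) = size D' by rewrite /D' outputS size_cat.
have D'E : D' = D ++ g (src (e + o)) by rewrite /D' outputS.
have gp := g0 (src (e + o)).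
have atsrc : tp e D (b + e + o) = Some (src (e + o)) by rewrite -addnA tp_src //; lia.
have eK : e + w <= K * w by rewrite -e2E.
clearbody e e2 D D'; clear jK.
have chunk : execB (TChunk w o g (src (e + o))) (b + e + o, tp e D) (b + e2, tp e2 D')
    (o.+1 + (w.+1 + ((K * w - e2) * 3 + 1 + (2 + (size D * 3 + 1 + ((size (g (src (e + o)))).+1 +
     (2 + (size D' * 3 + 1 + (2 + ((K * w - e2) * 3 + 1 + 2)))))))))).
  apply: execB_seq; first exact: execB_left.
  rewrite addnK; apply: execB_seq; first exact: execB_erase.
  rewrite -e2E; apply: execB_seq.
    apply: (@execB_seek_right _ 1 (K * w - e2)) => [i ik|].
      by rewrite -addnA tp_src //; lia.
    by rewrite -addnA muln1 subnKC // tp_sep.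
  rewrite -addnA muln1 subnKC //; apply: execB_seq; first exact: execB_right.
  rewrite addn1; apply: execB_seq.
    apply: (@execB_seek_right _ 1 (size D)) => [i ik|].
      by rewrite muln1 tp_dst // (nth_map false).
    by rewrite muln1 tp_dst // nth_default ?size_map.
  rewrite muln1; apply: execB_seq; first exact: execB_emit.
  rewrite -D'E; apply: execB_seq; first exact: execB_left.
  have -> : (b + K * w).+1 + size D' - 1 = b + K * w + size D' by lia.
  apply: execB_seq.
    apply: (@execB_seek_left _ (size D')) => [i ik|]; last by rewrite addnK tp_sep.
    have -> : b + K * w + size D' - i = (b + K * w).+1 + (size D' - i.+1) by lia.
    by rewrite tp_dst // (nth_map false) //; lia.
  rewrite addnK; apply: execB_seq; first exact: execB_left.
  apply: execB_seq.
    apply: (@execB_seek_left _ (K * w - e2)) => [i ik|].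
      have -> : b + K * w - 1 - i = b + (K * w - i.+1) by lia.
      by rewrite tp_src //; lia.
    (* The way back ends on the last erased cell; it exists since [w] is positive, also when the
       source is used up. *)
    have -> : b + K * w - 1 - (K * w - e2) = b + (e2 - 1) by lia.
    by rewrite tp_erased //; lia.
  have -> : b + e2 = b + K * w - 1 - (K * w - e2) + 1 by lia.
  exact: execB_right.
have bound : execB (TChunk w o g (src (e + o))) (b + e + o, tp e D) (b + e2, tp e2 D')
    (10 * (K * w + m + 1)) by apply: execB_le chunk _; lia.
apply: execB_le (execB_seq (execB_right _ _ _) (execB_if (B := 10 * (K * w + m + 1)) _)) _.
  by rewrite atsrc; case: (src (e + o)) bound.
by lia.
Qed.

Lemma execB_trans : f (b + K * w) = None -> (forall q, b + K * w < q -> f q = None) ->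
  execB (TTrans w o g) (b, f) (b + K * w, tp (K * w) (output K))
    (K * (20 * (K * w + m + 1)).+1 + 1).
Proof.
move=> fz fd.
have start : f = tp 0 (output 0).
  apply: nat_fun_ext => q; rewrite /tp addn0.
  case: ltnP => // qb; case: ltnP => // qK; case: eqVneq => [->//|ne].
  by rewrite nth_nil fd //; lia.
suff H k : k <= K -> execB (TTrans w o g) (b + (K - k) * w, tp ((K - k) * w) (output (K - k)))
     (b + K * w, tp (K * w) (output K)) (k * (20 * (K * w + m + 1)).+1 + 1).
  by have := H K (leqnn K); rewrite subnn mul0n addn0 -start.
elim: k => [|k IH] kK; first by rewrite subn0; apply: execB_stop; rewrite tp_sep.
have kj : K - k = (K - k.+1).+1 by lia.
apply: execB_le (execB_loop _ (execB_chunk _) _) _.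
- rewrite /= tp_src //; have : (K - k.+1).+1 * w <= K * w by rewrite leq_mul //; lia.
  by rewrite mulSn; lia.
- by lia.
- by rewrite -kj; apply: IH; lia.
- by lia.
Qed.

End Transducer.

(** * The complete machine *)

Definition poly_bounded (f : nat -> nat) := exists c d, forall N, 0 < N -> f N <= c * N ^ d.

Lemma poly_bounded_const a : poly_bounded (fun _ => a).
Proof. by exists a, 0 => N _; rewrite expn0 muln1. Qed.

Lemma poly_bounded_id : poly_bounded id.
Proof. by exists 1, 1 => N _; rewrite expn1 mul1n. Qed.

Lemma poly_bounded_add f g : poly_bounded f -> poly_bounded g ->
  poly_bounded (fun N => f N + g N).
Proof.
move=> [c [d H]] [c' [d' H']]; exists (c + c'), (d + d') => N N0.
rewrite mulnDl; apply: leq_add.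
  by apply: leq_trans (H N N0) _; rewrite leq_mul2l leq_pexp2l ?leq_addr ?orbT.
by apply: leq_trans (H' N N0) _; rewrite leq_mul2l leq_pexp2l ?leq_addl ?orbT.
Qed.

Lemma poly_bounded_mul f g : poly_bounded f -> poly_bounded g ->
  poly_bounded (fun N => f N * g N).
Proof.
move=> [c [d H]] [c' [d' H']]; exists (c * c'), (d + d') => N N0.
by rewrite expnD mulnACA leq_mul ?H ?H'.
Qed.

Ltac poly_bounded_tac := repeat first
  [ exact: poly_bounded_const | exact: poly_bounded_id
  | apply: poly_bounded_add | apply: poly_bounded_mul ].

Lemma poly_bounded_time W P : poly_bounded (fun N => time N (W.+2 * (N + 1)) P).
Proof.
elim: P => [|g a p|a|a|P IHP Q IHQ|a p P IHP Q IHQ|a b P IHP Q IHQ|a P IH] /=;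
  by poly_bounded_tac.
Qed.

Definition input_state (x : seq bool) : state :=
  State (fun _ => size x) (fun p i => (p == 0) && nth false x i).

(** A memory block with the input bit in plane 0 and no pointer marks: all pointers start as null,
    as in [input_state]. *)
Definition spread W (v : bool) := v :: nseq W.-1 false.

(** The memory is built to the right of the input, and plane [o] is later extracted to the right of
    the memory. The last move puts the head on the first output symbol, where [tm_output] starts to
    read. *)
Definition machine np nq o P :=
  TSeq (TTrans 1 0 (spread (np + nq))) (TSeq (compile np (np + nq) P) (TSeq (TMoves DRight 1)
  (TSeq (TTrans (np + nq) o (fun v => [:: v])) (TMoves DRight 1)))).

Lemma nth_output w o g src W j i r : (forall v, size (g v) = W) -> i < j -> r < W ->
  nth false (output w o g src j) (i * W + r) = nth false (g (src (i * w + o))) r.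
Proof.
move=> gW ij rW; have sz k : size (output w o g src k) = k * W.
  by elim: k => // k IH; rewrite outputS size_cat IH gW mulSn addnC.
elim: j ij => // j IH; rewrite ltnS outputS nth_cat sz leq_eqVlt.
case: eqP => [->|_] /= ij; first by rewrite ltnNge leq_addr addKn.
rewrite ifT ?IH //; have : i.+1 * W <= j * W by rewrite leq_mul.
by rewrite mulSn; lia.
Qed.

Lemma size_output_const w o g src W j : (forall v, size (g v) = W) ->
  size (output w o g src j) = j * W.
Proof. by move=> gW; elim: j => // j IH; rewrite outputS size_cat IH gW mulSn addnC. Qed.

Lemma tm_output_nth (s : seq sym) (D : seq bool) :
  (forall i, nth None s i = nth None (map Some D) i) ->
  pmap (fun o => o) (take (find (pred1 None) s) s) = D.
Proof.
elim: D s => [|v D IH] [|a s] H //.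
- by have := H 0 => /= ->.
- by have := H 0.
- by have /= -> := H 0; rewrite /= IH // => i; have := H i.+1.
Qed.

Section MachineCorrect.
Variables (np nq o : nat) (P : prog).
Hypothesis wfP : wf np nq P.
Hypothesis onp : o < np.
Variable W : nat.
Hypothesis WE : W = np + nq.

Definition machine_time N :=
  (N * (20 * (N * 1 + N * W + 1) + 1) + 1) + (time N (W.+2 * (N + 1)) P + (2 +
  ((N * (20 * (N * W + N + 1) + 1) + 1) + 2))).

Lemma machine_exec x p0 : 0 < size x -> 0 < p0 -> exists s',
  execB (machine np nq o P)
    (p0, fun i => if i < p0 then None else nth None (map Some x) (i - p0)) s'
    (machine_time (size x)) /\
  forall i, s'.2 (s'.1 + i) =
    nth None (map Some (mkseq (pl (eval (size x) P (input_state x)) o) (size x))) i.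
Proof.
move=> N0 p00; set f0 := (fun i => if i < p0 then _ else _); set N := size x in N0 *.
have W0 : 0 < W by lia.
have f0src q : q < N * 1 -> f0 (p0 + q) = Some (nth false x q).
  by rewrite muln1 /f0 => qN; rewrite ltnNge leq_addr addKn (nth_map false).
have f0blank q : N <= q -> f0 (p0 + q) = None.
  by rewrite /f0 => qN; rewrite ltnNge leq_addr addKn nth_default ?size_map.
have f0z : f0 (p0 + N * 1) = None by rewrite muln1 f0blank.
have f0d q : p0 + N * 1 < q -> f0 q = None.
  by move=> lt; have := f0blank (q - p0); rewrite subnKC; [apply|]; lia.
clearbody f0.
have gW v : size (spread W v) = W by rewrite /= size_nseq prednK.
have sz : size (output 1 0 (spread W) (nth false x) N) <= N * W.
  by rewrite (size_output_const _ _ _ _ gW).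
have g0 v : 0 < size (spread W v) by rewrite gW.
have e1 := execB_trans (ltn0Sn 0) g0 f0src sz f0z f0d.
(* The blank that separated source and output becomes the home position of the memory. *)
set f1 := tp _ _ _ _ _ _ in e1; set h := p0 + N * 1 in e1.
have st1 : stores np W N h (input_state x) f1.
  split.
  - by rewrite /f1 /h tp_sep.
  - move=> i r iN rW; rewrite /f1 /h tp_dst // (nth_map false).
      congr Some; rewrite (nth_output _ _ _ gW iN rW) muln1 addn0 /bits /=.
      case: r rW => [|r] rW /=; first by rewrite (leq_ltn_trans _ onp).
      by rewrite nth_nseq if_same; case: ifP => // _; rewrite gtn_eqF.
    rewrite (size_output_const _ _ _ _ gW).
    have : i.+1 * W <= N * W by rewrite leq_mul.
    by rewrite mulSn; lia.
  - move=> q qN; rewrite /f1 /h tp_dst // nth_default // size_map.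
    by rewrite (size_output_const _ _ _ _ gW).
have bi : bounded N (input_state x) by move=> a /=.
have [f2 [f20 f2M f2N] e2] := compile_correct WE N0 (erefl _) wfP bi st1.
set s2 := eval _ _ _ in f2M *.
have f2src q : q < N * W -> f2 (h.+1 + q) = Some (bits np s2 (q %% W) (q %/ W)).
  move=> qN; rewrite {1}(divn_eq q W) f2M ?ltn_pmod //.
  by rewrite ltn_divLR.
have oW : o < W by lia.
have sz3 : size (output W o (fun v => [:: v]) (fun q => bits np s2 (q %% W) (q %/ W)) N) <= N.
  by rewrite (@size_output_const _ _ _ _ 1) ?muln1.
have f2z : f2 (h.+1 + N * W) = None by rewrite f2N.
have f2d q : h.+1 + N * W < q -> f2 q = None.
  by move=> lt; have := f2N (q - h.+1); rewrite subnKC; [apply|]; lia.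
have g3 (v : bool) : 0 < size [:: v] by [].
have e3 := execB_trans oW g3 f2src sz3 f2z f2d.
set f3 := tp _ _ _ _ _ _ in e3.
exists ((h.+1 + N * W).+1, f3); split.
  rewrite /machine -WE.
  apply: execB_le (execB_seq e1 (execB_seq e2 (execB_seq (execB_right 1 _ _) _))) _.
  - rewrite addn1; apply: execB_seq e3 _.
    by rewrite -[(_ + _).+1]addn1; apply: execB_right.
  - by rewrite /machine_time !addn1.
move=> i /=; rewrite /f3 tp_dst //; congr (nth None (map Some _) i).
apply: (@eq_from_nth _ false).
  by rewrite (@size_output_const _ _ _ _ 1) // muln1 size_mkseq.
move=> k; rewrite (@size_output_const _ _ _ _ 1) // muln1 => kN.
have := @nth_output W o (fun v => [:: v]) (fun q => bits np s2 (q %% W) (q %/ W)) 1 N k 0.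
rewrite muln1 addn0 => -> //; rewrite nth_mkseq //= modnMDl modn_small //.
by rewrite divnMDl // divn_small // addn0 /bits onp.
Qed.

Lemma machine_time_poly : poly_bounded machine_time.
Proof.
rewrite /machine_time; have := poly_bounded_time W P => H.
by do ![exact: H|exact: poly_bounded_const|exact: poly_bounded_id
  |apply: poly_bounded_add|apply: poly_bounded_mul].
Qed.

Theorem machine_correct : exists (M : TM) c d, forall x, 0 < size x ->
  let cfg := tm_run (c * size x ^ d + c) (tm_init M x) in
  tm_halted cfg /\
  tm_output cfg = mkseq (pl (eval (size x) P (input_state x)) o) (size x).
Proof.
have [c [d H]] := machine_time_poly.
exists (tm_of (machine np nq o P)), c.+1, d => x x0; set t := _ + _.
(* The input is placed one cell further than the running time, as [tm_of_correct] requires. *)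
have [s' [[k kB ex] out]] := @machine_exec x (machine_time (size x)).+1 x0 isT.
have tB : machine_time (size x) < t.
  have := H _ x0; rewrite /t mulSn; have : 0 < size x ^ d by rewrite expn_gt0 x0.
  by lia.
have [l [r [-> hr]]] := tm_of_correct ex (leq_ltn_trans kB (ltnSn _)) (leq_ltn_trans kB tB).
split; first exact: eqxx.
apply: (@tm_output_nth (s'.2 s'.1 :: r)) => i; rewrite -out.
by case: i => [|i] /=; rewrite ?addn0 // hr addSnnS.
Qed.

End MachineCorrect.

(** * Reading the input *)

Arguments eval : simpl never.

Section EvalLemmas.
Variable N : nat.
Implicit Types (P Q : prog) (s : state).

Lemma eval_seq P Q s : eval N (PSeq P Q) s = eval N Q (eval N P s).
Proof. by []. Qed.
Lemma eval_skip s : eval N PSkip s = s.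
Proof. by []. Qed.
Lemma eval_put g a p s : ptr s a < N ->
  eval N (PPut g a p) s = setpl s p (ptr s a) (g (pl s p (ptr s a))).
Proof. by move=> lt; rewrite /eval lt. Qed.
Lemma eval_inc a s : ptr s a < N -> eval N (PInc a) s = setp s a (ptr s a).+1.
Proof. by move=> lt; rewrite /eval lt. Qed.
Lemma eval_reset a s : eval N (PReset a) s = setp s a 0.
Proof. by []. Qed.
Lemma eval_if a p P Q s : ptr s a < N ->
  eval N (PIf a p P Q) s = if pl s p (ptr s a) then eval N P s else eval N Q s.
Proof. by move=> lt; rewrite /eval -/eval lt; case: (pl _ _ _). Qed.
Lemma eval_eq a b P Q s : ptr s a < N ->
  eval N (PEq a b P Q) s = if ptr s b == ptr s a then eval N P s else eval N Q s.
Proof. by move=> lt; rewrite /eval -/eval lt; case: (_ == _). Qed.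

Lemma eval_for_ind a P s (Inv : nat -> state -> Prop) : Inv 0 s ->
  (forall i s', i < N -> Inv i s' -> Inv i.+1 (eval N P (setp s' a i))) ->
  exists2 s', Inv N s' & eval N (PFor a P) s = setp s' a N.
Proof.
move=> H0 HS; exists (iteri N (fun i s => eval N P (setp s a i)) s) => //.
suff H m : m <= N -> Inv m (iteri m (fun i s => eval N P (setp s a i)) s) by apply: H.
by elim: m => // m IH mN /=; apply: HS => //; apply: IH; lia.
Qed.

Definition it := 9.
(** Loops always run [N] times; the counter [e] stops at the value of [cnt], and from then on the
    rounds skip. *)
Definition Items e cnt body :=
  PSeq (PReset e) (PFor it (PEq e cnt PSkip (PSeq body (PInc e)))).

Lemma eval_items e cnt body m s (Inv : nat -> state -> Prop) :
  m < N -> ptr s cnt = m -> e != cnt -> e != it -> cnt != it ->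
  cnt \notin mods body -> e \notin mods body ->
  (forall k s a i, (a == e) || (a == it) -> Inv k s -> Inv k (setp s a i)) ->
  Inv 0 s ->
  (forall k s', k < m -> ptr s' e = k -> Inv k s' -> Inv k.+1 (eval N body s')) ->
  Inv m (eval N (Items e cnt body) s).
Proof.
move=> mN sc ec eit cit nc ne stable I0 IS.
pose J i s' := [/\ ptr s' cnt = m, ptr s' e = minn i m & Inv (minn i m) s'].
have [|i s' iN [c1 c2 c3]|s' [_ _ c3] es] := @eval_for_ind it
    (PEq e cnt PSkip (PSeq body (PInc e))) (setp s e 0) J.
- split; rewrite /= ?eqxx ?min0n //; first by rewrite eq_sym (negbTE ec).
  by apply: stable => //; rewrite eqxx.
- have e1 : ptr (setp s' it i) e = minn i m by rewrite /= (negbTE eit).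
  have c1' : ptr (setp s' it i) cnt = m by rewrite /= (negbTE cit).
  have c3' : Inv (minn i m) (setp s' it i) by apply: stable => //; rewrite eqxx orbT.
  rewrite eval_eq ?e1; last by lia.
  case: ifP => [/eqP e2|/eqP e2]; rewrite c1' in e2.
    have eS : minn i.+1 m = minn i m by lia.
    by rewrite eval_skip; split; rewrite ?eS.
  have im : i < m by lia.
  have eS : minn i.+1 m = i.+1 by lia.
  have ei : minn i m = i by lia.
  rewrite eval_seq; set s2 := eval N body _.
  have e3 : ptr s2 e = i by rewrite /s2 eval_ptr // e1 ei.
  have e4 : ptr s2 cnt = m by rewrite /s2 eval_ptr.
  rewrite eval_inc ?e3; last by lia.
  split; rewrite ?eS /= ?eqxx //.
    by rewrite eq_sym (negbTE ec).
  apply: stable; first by rewrite eqxx.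
  by apply: IS; [|rewrite e1|move: c3'; rewrite ei].
- rewrite /Items eval_seq eval_reset es; apply: stable; first by rewrite eqxx orbT.
  by move: c3; rewrite (minn_idPr _) // ltnW.
Qed.

End EvalLemmas.

(** Names of pointers, followed from [xX] on by those of planes. [zp] stays at cell 0, where the
    flags [xBad] and [xLess] are kept. [xX] is the input, [xO] the output, [xT] the trial set of
    arcs, [xD] the current one, [xR] the set of reached vertices. *)
Definition zp := 0. Definition pos := 1. Definition pu := 2. Definition pv := 3.
Definition pt := 4. Definition cE := 5. Definition cL := 6. Definition nn := 7.
Definition pe := 8. Definition pi := 10. Definition pj := 11. Definition rnd := 12.
Definition pb := 13. Definition pc := 14. Definition pd := 15. Definition pass := 16.
Definition xX := 0. Definition xO := 1. Definition xT := 2. Definition xD := 3.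
Definition xR := 4. Definition xBad := 5. Definition xLess := 6.

(** Numbers are unary, so reading is counting ones; the last increment skips the terminating
    zero. *)
Definition ReadNum u := PSeq (PReset u) (PSeq
  (PFor pt (PIf pos xX (PSeq (PInc pos) (PInc u)) PSkip)) (PInc pos)).

Definition encode (nums : seq nat) := flatten (map enc_nat nums).

Section Parsing.
Variable nums : seq nat.
Let x := encode nums.
Let N := size x.

Definition offset c := size (encode (take c nums)).

Lemma encode_cat s1 s2 : encode (s1 ++ s2) = encode s1 ++ encode s2.
Proof. by rewrite /encode map_cat flatten_cat. Qed.

Lemma size_enc_nat k : size (enc_nat k) = k.+1.
Proof. by rewrite size_cat size_nseq addn1. Qed.

Lemma offsetS c : c < size nums -> offset c.+1 = offset c + (nth 0 nums c).+1.
Proof.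
move=> lt; rewrite /offset (take_nth 0) // -cats1 encode_cat size_cat.
by rewrite /= /encode /= cats0 size_enc_nat.
Qed.

Lemma offset_le c : offset c <= N.
Proof.
by rewrite /N /x /offset -[X in _ <= size (encode X)](cat_take_drop c nums) encode_cat size_cat leq_addr.
Qed.

Lemma nth_encode c r : c < size nums -> r <= nth 0 nums c ->
  nth false x (offset c + r) = (r < nth 0 nums c).
Proof.
move=> lt le; rewrite /x -{1}(cat_take_drop c nums) encode_cat nth_cat ltnNge leq_addr /= addKn.
rewrite (drop_nth 0) // [encode _]/= nth_cat size_enc_nat ltnS le nth_cat size_nseq.
case: ltnP => h; first by rewrite nth_nseq h.
by rewrite (_ : r - _ = 0) //; lia.
Qed.

Definition has_input s := forall q, pl s xX q = nth false x q.

Lemma eval_readnum u c s : u != pos -> u != pt -> c < size nums ->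
  has_input s -> ptr s pos = offset c ->
  ptr (eval N (ReadNum u) s) u = nth 0 nums c /\
  ptr (eval N (ReadNum u) s) pos = offset c.+1.
Proof.
move=> up ut lt inp sp; set k := nth 0 nums c.
have kN : offset c + k.+1 <= N by rewrite -offsetS // offset_le.
pose J i s' := [/\ ptr s' pos = offset c + minn i k, ptr s' u = minn i k & has_input s'].
have [|i s' iN [c1 c2 c3]|s' [c1 c2 c3] es] := @eval_for_ind N pt
    (PIf pos xX (PSeq (PInc pos) (PInc u)) PSkip) (setp s u 0) J.
- split; rewrite /= ?eqxx ?min0n ?addn0 //.
  by rewrite eq_sym (negbTE up).
- have e1 : ptr (setp s' pt i) pos = offset c + minn i k by [].
  have e2 : ptr (setp s' pt i) u = minn i k by rewrite /= (negbTE ut).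
  rewrite eval_if ?e1; last by lia.
  rewrite [pl _ _ _]c3 nth_encode //; last by rewrite -/k; lia.
  case: ifP; rewrite -/k => h.
    rewrite eval_seq (eval_inc (a := pos)); last by rewrite e1; lia.
    rewrite e1 eval_inc /= (negbTE up) (negbTE ut) c2; last by lia.
    split => //=; rewrite ?eqxx //; last by lia.
    by rewrite eq_sym (negbTE up); lia.
  rewrite eval_skip; split=> //=; first by rewrite c1; lia.
  by rewrite (negbTE ut) c2; lia.
rewrite /ReadNum !eval_seq eval_reset es.
have e1 : ptr (setp s' pt N) pos = offset c + k by rewrite /= c1; lia.
rewrite eval_inc e1; last by lia.
split; last by rewrite /= -addnS offsetS.
by rewrite /= (negbTE up) (negbTE ut) c2; lia.
Qed.

End Parsing.

(** * The feasibility test *)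

Definition ReadPair := PSeq (ReadNum pu) (ReadNum pv).
Definition SetIf a b := PIf a xR (PPut (fun _ => true) b xR) PSkip.
Definition EBody := PSeq ReadPair
  (PEq pe pi PSkip (PEq pe pj PSkip (PSeq (SetIf pu pv) (SetIf pv pu)))).
(** An arc passes reachability from its head to its tail, since the reached set is to be the
    complement of a cut that no arc leaves. [pb] runs over the two plane positions of each link. *)
Definition LBody := PSeq ReadPair (PSeq (PIf pb xT (SetIf pv pu) PSkip)
  (PSeq (PInc pb) (PSeq (PIf pb xT (SetIf pu pv) PSkip) (PInc pb)))).
Definition Round := PSeq (PReset pos) (PSeq (ReadNum pu) (PSeq (ReadNum pu)
  (PSeq (Items pe cE EBody) (PSeq (ReadNum pu) (PSeq (PReset pb) (Items pe cL LBody)))))).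
Definition Fill p v := PFor pc (PPut (fun _ => v) pc p).
Definition Inner := PSeq (Fill xR false) (PSeq (PPut (fun _ => true) zp xR)
  (PSeq (PFor rnd Round)
  (Items pc nn (PIf pc xR PSkip (PPut (fun _ => true) zp xBad))))).
(** [pi] and [pj] are the cactus edges left out. When they are the edges of a cut that avoids the
    root 0 and that no arc leaves, the vertices of the cut are not reached. Equal indices and
    indices beyond the last edge are harmless: they leave out fewer edges. *)
Definition Feas := PSeq (PPut (fun _ => false) zp xBad) (PFor pi (PFor pj Inner)).

Section Propagation.
Implicit Types (R Q : nat -> bool) (cs : seq (nat * nat)).

Definition apply1 R (c : nat * nat) q := R q || ((q == c.2) && R c.1).
Definition apply cs R := foldl apply1 R cs.
Definition closed_under cs Q := all (fun c => Q c.1 ==> Q c.2) cs.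

Lemma apply1_ext R R' c : R =1 R' -> apply1 R c =1 apply1 R' c.
Proof. by move=> e q; rewrite /apply1 !e. Qed.

Lemma apply_cat cs cs' R : apply (cs ++ cs') R = apply cs' (apply cs R).
Proof. exact: foldl_cat. Qed.

Lemma apply_infl cs R q : R q -> apply cs R q.
Proof. by elim: cs R => //= c cs IH R Rq; apply: IH; rewrite /apply1 Rq. Qed.

Lemma apply_con cs R c : c \in cs -> R c.1 -> apply cs R c.2.
Proof.
elim: cs R => //= d cs IH R; rewrite inE => /orP [/eqP <-|ccs] Rc.
  by apply: apply_infl; rewrite /apply1 eqxx Rc orbT.
by apply: IH => //; rewrite /apply1 Rc.
Qed.

Lemma apply_sound cs Q R : closed_under cs Q -> (forall q, R q -> Q q) ->
  forall q, apply cs R q -> Q q.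
Proof.
elim: cs R => //= c cs IH R /andP [cQ csQ] RQ; apply: IH => // q.
by rewrite /apply1 => /orP [/RQ //|/andP [/eqP -> /RQ]]; apply/implyP.
Qed.

Definition reach cs k := iter k (apply cs) (pred1 0).

Lemma reach_sound cs k Q : closed_under cs Q -> Q 0 -> forall q, reach cs k q -> Q q.
Proof.
move=> cQ Q0; elim: k => [|k IH] /=; first by move=> q /eqP ->.
exact: apply_sound.
Qed.

(** A round applied to a set that is not closed reaches a new number below [N]. If this happens in
    all [N] rounds, every number below [N] is reached and the set is closed for that reason. *)
Lemma reach_closed cs N : all (fun c => c.2 < N) cs -> closed_under cs (reach cs N).
Proof.
move=> bnd; pose cnt k := count (reach cs k) (iota 0 N).
have step k : closed_under cs (reach cs k) \/ cnt k < cnt k.+1.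
  have mono : {subset filter (reach cs k) (iota 0 N) <= filter (reach cs k.+1) (iota 0 N)}.
    move=> q; rewrite !mem_filter => /andP [rq ->]; rewrite andbT.
    exact: apply_infl.
  have [cl|ncl] := boolP (closed_under cs (reach cs k)); first by left.
  right; move: ncl => /allPn [c ccs]; rewrite negb_imply => /andP [r1 nr2].
  have r2 := apply_con ccs r1; rewrite /cnt -!size_filter.
  have -> : (size (filter (reach cs k) (iota 0 N))).+1 =
      size (c.2 :: filter (reach cs k) (iota 0 N)) by [].
  apply: uniq_leq_size.
    by rewrite /= mem_filter (negbTE nr2) filter_uniq ?iota_uniq.
  move=> q; rewrite inE => /orP [/eqP ->|/mono //].
  rewrite mem_filter mem_iota add0n (allP bnd c ccs) leq0n /= andbT; exact: r2.
have keep k : closed_under cs (reach cs k) -> closed_under cs (reach cs k.+1).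
  move=> cl; apply/allP=> c ccs; apply/implyP=> r1; apply: apply_infl.
  by apply: (implyP (allP cl c ccs)); apply: apply_sound r1.
have main m : closed_under cs (reach cs m) \/ m <= cnt m.
  elim: m => [|m [cl|le]]; [by right | by left; apply: keep |].
  by case: (step m) => [cl|lt]; [left; apply: keep | right; lia].
case: (main N) => // full; apply/allP=> c ccs; apply/implyP=> _.
have : all (reach cs N) (iota 0 N) by rewrite all_count eqn_leq count_size size_iota.
by move/allP; apply; rewrite mem_iota (allP bnd c ccs).
Qed.

End Propagation.

Definition flat_prefix (T : Type) (f : nat -> seq T) k := flatten (mkseq f k).

Lemma flat_prefixS T (f : nat -> seq T) k : flat_prefix f k.+1 = flat_prefix f k ++ f k.
Proof. by rewrite /flat_prefix /mkseq -addn1 iotaD map_cat flatten_cat /= cats0. Qed.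

Lemma mem_flat_prefix (T : eqType) (f : nat -> seq T) k c :
  reflect (exists2 i, i < k & c \in f i) (c \in flat_prefix f k).
Proof.
apply: (iffP flattenP) => [[_ /mapP [i + ->] cf]|[i ik cf]].
  by rewrite mem_iota => ik; exists i.
by exists (f i) => //; apply: map_f; rewrite mem_iota.
Qed.

Lemma has_iotaS p k : has p (iota 0 k.+1) = has p (iota 0 k) || p k.
Proof. by rewrite -addn1 iotaD has_cat /= orbF. Qed.

Definition pairs (s : seq (nat * nat)) := flatten [seq [:: e.1; e.2] | e <- s].

Lemma size_pairs s : size (pairs s) = (size s).*2.
Proof. by elim: s => //= e s ->. Qed.

Lemma nth_pairs s k : nth 0 (pairs s) k.*2 = (nth (0, 0) s k).1 /\
  nth 0 (pairs s) k.*2.+1 = (nth (0, 0) s k).2.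
Proof. by elim: s k => [|e s IH] [|k] //=; rewrite ?nth_nil. Qed.

Lemma size_encode s : size (encode s) = sumn s + size s.
Proof.
elim: s => //= k s IH; rewrite /encode /= size_cat -/(encode s) IH size_enc_nat; lia.
Qed.

Section Program.
Variables (n : nat) (E L : seq (nat * nat)).
Definition nums := n :: size E :: pairs E ++ size L :: pairs L.
Notation x := (encode nums).
Notation N := (size x).
Implicit Types (s : state) (T R : nat -> bool).

Definition eu k := (nth (0, 0) E k).1.
Definition ev k := (nth (0, 0) E k).2.
Definition lu k := (nth (0, 0) L k).1.
Definition lv k := (nth (0, 0) L k).2.

Lemma size_nums : size nums = (size E).*2 + (size L).*2 + 3.
Proof. by rewrite /= size_cat /= !size_pairs; lia. Qed.

(** Unary encoding contributes [n] ones, a one per edge or link in the two counts, and a terminating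
    zero per number, of which there are two for each edge or link and three more. In particular
    every cost is below [N] and fits into a pointer. *)
Lemma N_large : n + 3 * size E + 3 * size L + 3 <= N.
Proof. by rewrite size_encode size_nums /= sumn_cat /=; lia. Qed.

Lemma nth_nums_E k : k < size E -> nth 0 nums (2 + k.*2) = eu k /\ nth 0 nums (2 + k.*2).+1 = ev k.
Proof.
move=> kE; rewrite /= !nth_cat size_pairs !ifT; try lia.
exact: nth_pairs.
Qed.

Lemma nth_nums_sizeL : nth 0 nums (2 + (size E).*2) = size L.
Proof. by rewrite /= nth_cat size_pairs ltnn subnn. Qed.

Lemma nth_nums_L k : nth 0 nums (3 + (size E).*2 + k.*2) = lu k /\
  nth 0 nums (3 + (size E).*2 + k.*2).+1 = lv k.
Proof.
rewrite /= !nth_cat size_pairs !ifN; try lia.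
rewrite (_ : _ - _ = k.*2.+1); last lia.
rewrite (_ : _ - _ = k.*2.+2); last lia.
exact: nth_pairs.
Qed.

Lemma nth_nums_lt c : c < size nums -> nth 0 nums c < N.
Proof. by move=> lt; have := offset_le nums c.+1; rewrite offsetS //; lia. Qed.

Definition hdr s := [/\ ptr s zp = 0, ptr s nn = n, ptr s cE = size E, ptr s cL = size L &
  has_input nums s].

Definition frame P := [&& zp \notin mods P, nn \notin mods P, cE \notin mods P,
  cL \notin mods P & xX \notin plmods P].

Lemma hdr_frame P s : frame P -> hdr s -> hdr (eval N P s).
Proof.
case/and5P=> m1 m2 m3 m4 m5 [h1 h2 h3 h4 h5].
by split; rewrite ?eval_ptr // => q; rewrite eval_pl.
Qed.

Lemma hdr_input s : hdr s -> has_input nums s.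
Proof. by case. Qed.

Lemma hdr_setp s a i : a \notin [:: zp; nn; cE; cL] -> hdr s -> hdr (setp s a i).
Proof.
rewrite !inE !negb_or => /and4P [a1 a2 a3 a4] [h1 h2 h3 h4 h5].
by split; rewrite //= eq_sym ifN.
Qed.

Lemma eval_readpair s c : has_input nums s -> ptr s pos = offset nums c -> c.+1 < size nums ->
  [/\ ptr (eval N ReadPair s) pu = nth 0 nums c,
      ptr (eval N ReadPair s) pv = nth 0 nums c.+1 &
      ptr (eval N ReadPair s) pos = offset nums c.+2].
Proof.
move=> hi sp lt; rewrite eval_seq.
have [r1 r2] := @eval_readnum nums pu c s isT isT (ltnW lt) hi sp.
have hi1 : has_input nums (eval N (ReadNum pu) s) by move=> q; rewrite eval_pl.
have [r3 r4] := @eval_readnum nums pv c.+1 _ isT isT lt hi1 r2.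
by split=> //; rewrite eval_ptr.
Qed.

Lemma eval_setif a b s : ptr s a < N -> ptr s b < N ->
  pl (eval N (SetIf a b) s) xR =1 apply1 (pl s xR) (ptr s a, ptr s b).
Proof.
move=> lta ltb q; rewrite /SetIf eval_if // /apply1 /=.
case: ifP => [Ra|Ra]; rewrite ?eval_put ?eval_skip ?Ra ?andbF ?orbF // andbT /=.
by case: eqP => //=; rewrite ?orbT ?orbF.
Qed.

Definition itemE i j k :=
  if (k == i) || (k == j) then [::] else [:: (eu k, ev k); (ev k, eu k)].
Definition itemL T l :=
  (if T l.*2 then [:: (lv l, lu l)] else [::]) ++ (if T l.*2.+1 then [:: (lu l, lv l)] else [::]).
Definition constraints i j T :=
  flat_prefix (itemE i j) (size E) ++ flat_prefix (itemL T) (size L).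

(** The plane [xR] is updated in place, so later constraints of a round see the effect of earlier
    ones; the fold [apply] follows the same order. *)
Lemma eval_round i j T R s : hdr s -> i < N -> j < N -> ptr s pi = i -> ptr s pj = j ->
  pl s xT =1 T -> pl s xR =1 R ->
  pl (eval N Round s) xR =1 apply (constraints i j T) R.
Proof.
move=> hs iN jN si sj sT sR; have NL := N_large.
rewrite /Round eval_seq eval_reset.
set s0 := setp s pos 0; have h0 : hdr s0 by apply: hdr_setp.
rewrite eval_seq; set s1 := eval N (ReadNum pu) s0.
have h1 : hdr s1 by apply: hdr_frame.
have p1 : ptr s1 pos = offset nums 1.
  by have [_ _ _ _ hi] := h0; have [] := @eval_readnum nums pu 0 s0 isT isT isT hi erefl.
rewrite eval_seq; set s2 := eval N (ReadNum pu) s1.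
have h2 : hdr s2 by apply: hdr_frame.
have p2 : ptr s2 pos = offset nums 2.
  by have [_ _ _ _ hi] := h1; have [] := @eval_readnum nums pu 1 s1 isT isT isT hi p1.
pose InvE k s := [/\ hdr s, ptr s pos = offset nums (2 + k.*2), ptr s pi = i /\ ptr s pj = j,
  pl s xT =1 T & pl s xR =1 apply (flat_prefix (itemE i j) k) R].
have IE : InvE (size E) (eval N (Items pe cE EBody) s2).
  apply: (@eval_items N pe cE EBody (size E) s2 InvE) => //; first by lia.
  - by case: h2.
  - move=> k t a q /orP [] /eqP -> [t1 t2 [t3 t4] t5 t6]; split=> //; exact: hdr_setp.
  - split=> //; rewrite /s2 /s1 ?eval_ptr //; first by rewrite !eval_pl.
    by rewrite !eval_pl.
  move=> k t kE te [t1 t2 [t3 t4] t5 t6]; rewrite /EBody eval_seq.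
  have [|q1 q2 q3] := eval_readpair (hdr_input t1) t2; first by rewrite size_nums; lia.
  have [n1 n2] := nth_nums_E kE; rewrite {}n1 in q1; rewrite {}n2 in q2.
  set t' := eval N ReadPair t in q1 q2 q3 *.
  have ht' : hdr t' by apply: hdr_frame.
  have e1 : ptr t' pe = k by rewrite /t' eval_ptr.
  have e2 : ptr t' pi = i by rewrite /t' eval_ptr.
  have e3 : ptr t' pj = j by rewrite /t' eval_ptr.
  have e4 : pl t' xT =1 T by rewrite /t' eval_pl.
  have e5 : pl t' xR =1 apply (flat_prefix (itemE i j) k) R by rewrite /t' eval_pl.
  have uN : eu k < N.
    have [<- _] := nth_nums_E kE; apply: nth_nums_lt; rewrite size_nums; lia.
  have vN : ev k < N.
    have [_ <-] := nth_nums_E kE; apply: nth_nums_lt; rewrite size_nums; lia.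
  have pS : 2 + k.+1.*2 = (2 + k.*2).+2 by lia.
  clearbody t'.
  rewrite eval_eq e1 ?e2; last by lia.
  case: ifP => [/eqP ei|ni].
    have it0 : itemE i j k = [::] by rewrite /itemE ei eqxx.
    by rewrite eval_skip; split; rewrite ?pS // flat_prefixS it0 cats0.
  rewrite eval_eq e1 ?e3; last by lia.
  case: ifP => [/eqP ej|nj].
    have it0 : itemE i j k = [::] by rewrite /itemE ej eqxx orbT.
    by rewrite eval_skip; split; rewrite ?pS // flat_prefixS it0 cats0.
  rewrite eval_seq; split.
  - by do 2 apply: hdr_frame => //.
  - by rewrite !eval_ptr // q3 pS.
  - by rewrite !eval_ptr.
  - by rewrite !eval_pl.
  move=> q; rewrite flat_prefixS apply_cat /itemE eq_sym ni eq_sym nj /=.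
  rewrite eval_setif ?eval_ptr ?q1 ?q2 //; apply: apply1_ext => {}q.
  by rewrite eval_setif ?q1 ?q2 //; apply: apply1_ext.
rewrite eval_seq; set s3 := eval N (Items pe cE EBody) s2 in IE *.
case: IE => h3 p3 [i3 j3] T3 R3.
rewrite eval_seq; set s4 := eval N (ReadNum pu) s3.
have h4 : hdr s4 by apply: hdr_frame.
have p4 : ptr s4 pos = offset nums (3 + (size E).*2).
  have [_ _ _ _ hi] := h3; have [|_ ->] := @eval_readnum nums pu _ s3 isT isT _ hi p3 => //.
  by rewrite size_nums; lia.
rewrite eval_seq eval_reset; set s5 := setp s4 pb 0.
pose InvL k s := [/\ hdr s, ptr s pos = offset nums (3 + (size E).*2 + k.*2), ptr s pb = k.*2,
  pl s xT =1 T & pl s xR =1 apply (flat_prefix (itemE i j) (size E) ++ flat_prefix (itemL T) k) R].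
have [//] : InvL (size L) (eval N (Items pe cL LBody) s5).
apply: (@eval_items N pe cL LBody (size L) s5 InvL) => //; first by lia.
- by case: h4.
- move=> k t a q /orP [] /eqP -> [t1 t2 t3 t4 t5]; split=> //; exact: hdr_setp.
- split; rewrite /= ?addn0 ?cats0 //.
  + by rewrite /s4 eval_pl.
  + by rewrite /s4 eval_pl.
move=> k t kL te [t1 t2 t3 t4 t5]; rewrite /LBody eval_seq.
have [|q1 q2 q3] := eval_readpair (hdr_input t1) t2; first by rewrite size_nums; lia.
have uN : lu k < N.
  have [<- _] := nth_nums_L k; apply: nth_nums_lt; rewrite size_nums; lia.
have vN : lv k < N.
  have [_ <-] := nth_nums_L k; apply: nth_nums_lt; rewrite size_nums; lia.
have [n1 n2] := nth_nums_L k; rewrite {}n1 in q1; rewrite {}n2 in q2.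
set t' := eval N ReadPair t in q1 q2 q3 *.
have ht' : hdr t' by apply: hdr_frame.
have e1 : ptr t' pb = k.*2 by rewrite /t' eval_ptr.
have e4 : pl t' xT =1 T by rewrite /t' eval_pl.
have e5 : pl t' xR =1 apply (flat_prefix (itemE i j) (size E) ++ flat_prefix (itemL T) k) R.
  by rewrite /t' eval_pl.
have pS : 3 + (size E).*2 + k.+1.*2 = (3 + (size E).*2 + k.*2).+2 by lia.
clearbody t'; rewrite eval_seq; set t1' := eval N _ t'.
have f1 : hdr t1' by apply: hdr_frame.
have f2 : ptr t1' pb = k.*2 by rewrite /t1' eval_ptr.
have f3 : ptr t1' pu = lu k by rewrite /t1' eval_ptr.
have f4 : ptr t1' pv = lv k by rewrite /t1' eval_ptr.
have f5 : pl t1' xT =1 T by rewrite /t1' eval_pl.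
have f6 : ptr t1' pos = offset nums (3 + (size E).*2 + k.*2).+2 by rewrite /t1' eval_ptr.
have f7 : pl t1' xR =1 apply (flat_prefix (itemE i j) (size E) ++ flat_prefix (itemL T) k ++
    (if T k.*2 then [:: (lv k, lu k)] else [::])) R.
  move=> q; rewrite /t1' eval_if e1 ?e4; last by lia.
  rewrite catA apply_cat; case: (T k.*2); last by rewrite eval_skip e5.
  by rewrite eval_setif ?q1 ?q2 //; apply: apply1_ext.
clearbody t1'; rewrite eval_seq eval_inc f2; last by lia.
set t2' := setp t1' pb _.
rewrite eval_seq; set t3' := eval N _ t2'.
have g2 : ptr t3' pb = k.*2.+1 by rewrite /t3' eval_ptr.
rewrite eval_inc g2; last by lia.
have g3 : hdr t3' by apply: hdr_frame => //; apply: hdr_setp.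
split=> /=.
- exact: hdr_setp.
- by rewrite pS /t3' eval_ptr.
- by [].
- by rewrite /t3' eval_pl.
move=> q; rewrite flat_prefixS /itemL /t3' eval_if /=; last by lia.
rewrite [pl t1' xT _]f5.
rewrite (_ : flat_prefix _ _ ++ flat_prefix _ _ ++ _ =
  (flat_prefix (itemE i j) (size E) ++ flat_prefix (itemL T) k ++
    (if T k.*2 then [:: (lv k, lu k)] else [::])) ++
  (if T k.*2.+1 then [:: (lu k, lv k)] else [::])); last by rewrite !catA.
rewrite apply_cat; case: (T k.*2.+1); last by rewrite eval_skip f7.
by rewrite eval_setif /= ?f3 ?f4 //; apply: apply1_ext.
Qed.

End Program.

(** * One pass of the local search *)

(** The instruction [incr] is a parameter, so that one program serves both for counting a cost and
    for comparing a second cost with it. *)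
Definition CostProg p incr := PSeq (PReset pb) (Items pe cL (PSeq
  (PIf pb p (PSeq incr (PSeq incr (PSeq (PInc pb) (PIf pb p incr PSkip))))
            (PSeq (PInc pb) (PIf pb p (PSeq incr incr) PSkip)))
  (PInc pb))).
Definition IncLess := PSeq (PEq pd pc (PPut (fun _ => true) zp xLess) PSkip) (PInc pd).
(* [xLess] is set when the cost of [xD], counted by [pd], passes the cost of [xT], stored in [pc]. *)
Definition CompareCosts := PSeq (PReset pc) (PSeq (CostProg xT (PInc pc))
  (PSeq (PPut (fun _ => false) zp xLess) (PSeq (PReset pd) (CostProg xD IncLess)))).
Definition Copy p q := PFor pc (PIf pc p (PPut (fun _ => true) pc q) (PPut (fun _ => false) pc q)).
Definition Check := PSeq Feas (PSeq CompareCosts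
  (PIf zp xBad PSkip (PIf zp xLess (Copy xT xD) PSkip))).
Definition toggle k := 17 + k.
(** Nested loops toggle up to [k] bits of [xT] and restore them. [xD] is replaced as soon as a trial
    is better, while the trials stay centred at the set copied at the beginning of the pass. *)
Fixpoint Try k := PSeq Check (if k is k'.+1 then
  PFor (toggle k') (PSeq (PPut negb (toggle k') xT) (PSeq (Try k') (PPut negb (toggle k') xT)))
  else PSkip).
Definition Header := PSeq (PReset zp) (PSeq (PReset pos) (PSeq (ReadNum nn) (PSeq (ReadNum cE)
  (PSeq (Items pe cE ReadPair) (ReadNum cL))))).
Definition Output := PSeq (PReset pb) (Items pe cL (PSeq
  (PIf pb xD (PSeq (PPut (fun _ => true) pe xO) (PInc pb))
     (PSeq (PInc pb) (PIf pb xD (PPut (fun _ => true) pe xO) PSkip))) (PInc pb))).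
Definition LocalSearch K := PSeq Header (PSeq (Fill xD true)
  (PSeq (PFor pass (PSeq (Copy xD xT) (Try K))) Output)).

Section Support.
Variable N : nat.

Definition supported s := forall p q, N <= q -> pl s p q = false.

Lemma eval_supported P s : supported s -> supported (eval N P s).
Proof.
elim: P s => [|g a p|a|a|P IHP Q IHQ|a p P IHP Q IHQ|a b P IHP Q IHQ|a P IH] s h; rewrite /eval -/eval //.
- case: (ltnP (ptr s a) N) => // lt p' q qN /=; rewrite (h p' q qN).
  by case: ifP => // /andP [_ /eqP e]; move: qN; rewrite e leqNgt lt.
- by case: ifP.
- by apply: IHQ; apply: IHP.
- by case: ifP => _; [apply: IHP|apply: IHQ].
- by case: ifP => _; [apply: IHP|apply: IHQ].
suff H m : supported (iteri m (fun i s => eval N P (setp s a i)) s) by apply: H.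
by elim: m => //= m IHm; apply: IH.
Qed.

Lemma eval_fill p v s : supported s ->
  pl (eval N (Fill p v) s) p = fun q => (q < N) && v.
Proof.
move=> h; have [|i s' iN H q|s' H es] := @eval_for_ind N pc (PPut (fun _ => v) pc p) s
  (fun k s' => forall q, pl s' p q = if q < k then v else pl s p q).
- by [].
- rewrite eval_put /= ?eqxx //= H ltnS (leq_eqVlt q i).
  by case: (q == i).
rewrite /Fill es; apply: nat_fun_ext => q /=; rewrite H.
by case: ltnP => //= qN; apply: h.
Qed.

Lemma eval_copy p p' s : supported s -> p' != p -> pl (eval N (Copy p p') s) p' = pl s p.
Proof.
move=> h ne; have [|i s' iN [H H2]|s' [H _] es] := @eval_for_ind N pc
    (PIf pc p (PPut (fun _ => true) pc p') (PPut (fun _ => false) pc p')) s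
  (fun k s' => (forall q, pl s' p' q = if q < k then pl s p q else pl s p' q) /\ pl s' p = pl s p).
- by [].
- rewrite eval_if /= ?eqxx // H2; split.
    move=> q; rewrite ltnS leq_eqVlt; case e: (pl s p i); rewrite eval_put /= ?eqxx //= H;
      by case: eqP => //= ->; rewrite e.
  by case: ifP => _; rewrite eval_put /= ?eqxx //; apply: nat_fun_ext => q;
    rewrite eq_sym (negbTE ne) /= H2.
rewrite /Copy es; apply: nat_fun_ext => q /=; rewrite H.
by case: ltnP => //= qN; rewrite !h.
Qed.

End Support.

Definition link_cost (T : nat -> bool) l := T l.*2 + T l.*2.+1 + (T l.*2 || T l.*2.+1).
Fixpoint plane_cost T k := if k is k'.+1 then plane_cost T k' + link_cost T k' else 0.

Definition flip (T : nat -> bool) a q := if q == a then ~~ T q else T q.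
Fixpoint within N k (T T' : nat -> bool) : Prop :=
  T' = T \/ if k is k'.+1 then exists2 a, a < N & within N k' (flip T a) T' else False.

Lemma plane_cost_le T k : plane_cost T k <= 3 * k.
Proof.
elim: k => //= k IH; rewrite /link_cost.
by case: (T k.*2); case: (T k.*2.+1) => /=; lia.
Qed.

Section Search.
Variables (n : nat) (E L : seq (nat * nat)).
Notation x := (encode (nums n E L)).
Notation N := (size x).
Notation hdr := (hdr n E L).
Notation constraints := (constraints E L).
Notation m := (size L).

Definition violated i j T := has (fun c => ~~ reach (constraints i j T) N c) (iota 0 n).
Definition infeasible T := has (fun i => has (fun j => violated i j T) (iota 0 N)) (iota 0 N).
Definition improves D T := ~~ infeasible T && (plane_cost T m < plane_cost D m).

Lemma eval_inner i j T s : hdr s -> supported N s -> i < N -> j < N ->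
  ptr s pi = i -> ptr s pj = j -> pl s xT = T ->
  pl (eval N Inner s) xBad 0 = pl s xBad 0 || violated i j T.
Proof.
move=> hs su iN jN si sj sT; have NL := N_large n E L.
rewrite /Inner eval_seq; set s1 := eval N (Fill xR false) s.
have h1 : hdr s1 by apply: hdr_frame.
have R1 : pl s1 xR = fun _ => false.
  by rewrite /s1 eval_fill //; apply: nat_fun_ext => q; rewrite andbF.
have z1 : ptr s1 zp = 0 by case: h1.
have i1 : ptr s1 pi = i by rewrite /s1 eval_ptr.
have j1 : ptr s1 pj = j by rewrite /s1 eval_ptr.
have T1 : pl s1 xT = T by rewrite /s1 eval_pl.
have b1 : pl s1 xBad = pl s xBad by rewrite /s1 eval_pl.
clearbody s1; rewrite eval_seq eval_put z1; last by lia.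
set s2 := setpl s1 xR 0 _.
have h2 : hdr s2 by case: h1.
rewrite eval_seq.
have [|k t kN [t1 t2 t3 t4 t5]|t [t1 t2 t3 t4 t5] es] := @eval_for_ind N rnd Round s2
  (fun k t => [/\ hdr t, ptr t pi = i /\ ptr t pj = j, pl t xT = T,
     pl t xBad = pl s xBad & pl t xR =1 reach (constraints i j T) k]).
- by split=> // q; rewrite /s2 /= R1; case: (q == 0).
- split.
  + by apply: hdr_frame => //; apply: hdr_setp.
  + by rewrite !eval_ptr.
  + by rewrite eval_pl.
  + by rewrite eval_pl.
  have [t21 t22] := t2.
  apply: (@eval_round n E L i j T) => // q /=.
  by rewrite t3.
rewrite es; set s3 := setp t rnd N.
have h3 : hdr s3 by apply: hdr_setp.
pose Inv k t' := [/\ hdr t', pl t' xR =1 reach (constraints i j T) N &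
  pl t' xBad 0 = pl s xBad 0 || has (fun c => ~~ reach (constraints i j T) N c) (iota 0 k)].
suff [//] : Inv n (eval N (Items pc nn (PIf pc xR PSkip (PPut (fun _ => true) zp xBad))) s3).
apply: (@eval_items N pc nn (PIf pc xR PSkip (PPut (fun _ => true) zp xBad)) n s3 Inv) => //.
  - by lia.
  - by case: h3.
  - by move=> k t' a q /orP [] /eqP -> [u1 u2 u3]; split=> //; exact: hdr_setp.
  - by split=> //=; rewrite t4 orbF.
  move=> k t' kn tc [u1 u2 u3].
  have z : ptr t' zp = 0 by case: u1.
  rewrite eval_if tc ?u2; last by lia.
  rewrite /Inv has_iotaS; case: ifP => r.
    by rewrite eval_skip; split=> //; rewrite u3 orbF.
  rewrite eval_put z; last by lia.
  split=> //.
  by rewrite /= !orbT.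
Qed.

Lemma eval_feas T s : hdr s -> supported N s -> pl s xT = T ->
  pl (eval N Feas s) xBad 0 = infeasible T.
Proof.
move=> hs su sT; have NL := N_large n E L.
have z : ptr s zp = 0 by case: hs.
rewrite /Feas eval_seq.
have su1 : supported N (eval N (PPut (fun _ => false) zp xBad) s) by apply: eval_supported.
have h1 : hdr (eval N (PPut (fun _ => false) zp xBad) s) by apply: hdr_frame.
have T1 : pl (eval N (PPut (fun _ => false) zp xBad) s) xT = T by rewrite eval_pl.
have b1 : pl (eval N (PPut (fun _ => false) zp xBad) s) xBad 0 = false.
  by rewrite eval_put z //; lia.
set s1 := eval N _ s in su1 h1 T1 b1 *; clearbody s1.
have [|i t iN [t1 t2 t3 t4]|t [_ _ _ t4] -> //] := @eval_for_ind N pi (PFor pj Inner) s1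
  (fun k t => [/\ hdr t, supported N t, pl t xT = T &
     pl t xBad 0 = has (fun i => has (fun j => violated i j T) (iota 0 N)) (iota 0 k)]).
- by [].
have [|j u jN [u1 u2 u3 u4 u5]|u [u1 u2 u3 u4 u5] es] := @eval_for_ind N pj Inner (setp t pi i)
  (fun k u => [/\ hdr u, supported N u, pl u xT = T, ptr u pi = i &
     pl u xBad 0 = has (fun i => has (fun j => violated i j T) (iota 0 N)) (iota 0 i)
       || has (fun j => violated i j T) (iota 0 k)]).
- by split=> //; rewrite orbF.
- split.
  + by apply: hdr_frame => //; apply: hdr_setp.
  + exact: eval_supported.
  + by rewrite eval_pl.
  + by rewrite eval_ptr.
  rewrite (@eval_inner i j T) //.
  by rewrite has_iotaS orbA /= u5.
rewrite es; split=> //.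
by rewrite has_iotaS.
Qed.

(** [Q k] is what [k] executions of [incr] establish. Its step may assume [k < N] because the cost
    stays below [N]. *)
Lemma eval_cost p incr T (Q : nat -> state -> Prop) s :
  [&& pe \notin mods incr, cL \notin mods incr, pb \notin mods incr & p \notin plmods incr] ->
  (forall k s a i, a \in [:: pe; it; pb] -> Q k s -> Q k (setp s a i)) ->
  (forall k s, k < N -> Q k s -> Q k.+1 (eval N incr s)) ->
  Q 0 s -> ptr s cL = m -> pl s p = T ->
  Q (plane_cost T m) (eval N (CostProg p incr) s).
Proof.
move=> /and4P [i1 i2 i3 i4] stable step Q0 sL sT; have NL := N_large n E L.
pose J c b t := [/\ ptr t pb = b, pl t p = T & Q c t].
have incJ c b t : J c b t -> c < N -> J c.+1 b (eval N incr t).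
  move=> [t1 t2 t3] cN; split; [by rewrite eval_ptr | by rewrite eval_pl | exact: step].
have pbJ c b t : J c b t -> b < N -> J c b.+1 (eval N (PInc pb) t).
  move=> [t1 t2 t3] bN; rewrite eval_inc ?t1 //; split=> //.
  by apply: stable.
have ifJ c b t P P' : J c b t -> b < N ->
    eval N (PIf pb p P P') t = if T b then eval N P t else eval N P' t.
  by move=> [t1 t2 t3] bN; rewrite eval_if t1 // t2.
rewrite /CostProg eval_seq eval_reset.
pose Inv k t := J (plane_cost T k) k.*2 t.
suff [] : Inv m (eval N (Items pe cL (PSeq
  (PIf pb p (PSeq incr (PSeq incr (PSeq (PInc pb) (PIf pb p incr PSkip))))
            (PSeq (PInc pb) (PIf pb p (PSeq incr incr) PSkip)))
  (PInc pb))) (setp s pb 0)) by [].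
apply: eval_items => //; first by lia.
- by rewrite /= !(mem_cat, inE) !negb_or /= !i2.
- by rewrite /= !(mem_cat, inE) !negb_or /= !i1.
- move=> k t a i ha [t1 t2 t3]; split=> //; last first.
    by apply: stable => //; rewrite !inE; case/orP: ha => ->; rewrite ?orbT.
  by case/orP: ha => /eqP ->.
- by split=> //; apply: stable.
move=> k t km te tJ; have kc := plane_cost_le T k.
rewrite eval_seq (ifJ _ _ _ _ _ tJ); last by lia.
rewrite /Inv /= /link_cost doubleS; case e1: (T k.*2); last first.
  rewrite eval_seq; have t1 := pbJ _ _ _ tJ (ltac:(lia)).
  rewrite (ifJ _ _ _ _ _ t1); last by lia.
  case e2: (T k.*2.+1); rewrite ?eval_seq ?eval_skip.
    have t2 := incJ _ _ _ t1 (ltac:(lia)); have t3 := incJ _ _ _ t2 (ltac:(lia)).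
    by rewrite addn2; apply: pbJ => //; lia.
  by rewrite addn0; apply: pbJ => //; lia.
rewrite !eval_seq; have t1 := incJ _ _ _ tJ (ltac:(lia)).
have t2 := incJ _ _ _ t1 (ltac:(lia)); have t3 := pbJ _ _ _ t2 (ltac:(lia)).
rewrite (ifJ _ _ _ _ _ t3); last by lia.
case e2: (T k.*2.+1); rewrite ?eval_skip.
  have t4 := incJ _ _ _ t3 (ltac:(lia)).
  by rewrite addn3; apply: pbJ => //; lia.
by rewrite addn2; apply: pbJ => //; lia.
Qed.

Lemma eval_compare T D s : hdr s -> pl s xT = T -> pl s xD = D ->
  pl (eval N CompareCosts s) xLess 0 = (plane_cost T m < plane_cost D m).
Proof.
move=> hs sT sD; have NL := N_large n E L.
rewrite /CompareCosts eval_seq eval_reset eval_seq.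
set s1 := eval N (CostProg xT (PInc pc)) _.
have c1 : ptr s1 pc = plane_cost T m.
  apply: (@eval_cost xT (PInc pc) T (fun k t => ptr t pc = k)) => //.
  - by move=> k t a i; rewrite !inE => /or3P [] /eqP ->.
  - by move=> k t kN e; rewrite eval_inc e.
  - by case: hs.
have h1 : hdr s1 by apply: hdr_frame.
have z1 : ptr s1 zp = 0 by case: h1.
have D1 : pl s1 xD = D by rewrite /s1 eval_pl.
have cT := plane_cost_le T m; have cD := plane_cost_le D m.
clearbody s1; rewrite eval_seq eval_put z1; last by lia.
rewrite eval_seq eval_reset; set s2 := setp _ _ _.
have := @eval_cost xD IncLess D (fun k t => [/\ ptr t pd = k, ptr t pc = plane_cost T m,
   ptr t zp = 0 & pl t xLess 0 = (plane_cost T m < k)]) s2.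
case=> //.
- by move=> k t a i; rewrite !inE => /or3P [] /eqP -> [].
- move=> k t kN [t1 t2 t3 t4]; rewrite /IncLess eval_seq eval_eq t1 // t2.
  case: ifP => [/eqP e|/eqP ne].
    rewrite eval_put t3; last by lia.
    by rewrite eval_inc /= t1 //; split=> //=; rewrite e ltnSn.
  by rewrite eval_skip eval_inc t1 //; split=> //=; rewrite t4; lia.
- by case: h1.
Qed.

Lemma eval_check T D s : hdr s -> supported N s -> pl s xT = T -> pl s xD = D ->
  pl (eval N Check s) xD = if improves D T then T else D.
Proof.
move=> hs su sT sD; have NL := N_large n E L.
rewrite /Check eval_seq eval_seq.
have bad := eval_feas hs su sT.
have h1 : hdr (eval N Feas s) by apply: hdr_frame.
have u1 := eval_supported (N := N) Feas su.
have T1 : pl (eval N Feas s) xT = T by rewrite eval_pl.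
have D1 : pl (eval N Feas s) xD = D by rewrite eval_pl.
set s1 := eval N Feas s in bad h1 u1 T1 D1 *; clearbody s1.
have less := eval_compare h1 T1 D1.
have h2 : hdr (eval N CompareCosts s1) by apply: hdr_frame.
have u2 := eval_supported (N := N) CompareCosts u1.
have T2 : pl (eval N CompareCosts s1) xT = T by rewrite eval_pl.
have D2 : pl (eval N CompareCosts s1) xD = D by rewrite eval_pl.
have b2 : pl (eval N CompareCosts s1) xBad 0 = infeasible T by rewrite eval_pl.
set s2 := eval N CompareCosts s1 in less h2 u2 T2 D2 b2 *; clearbody s2.
have z2 : ptr s2 zp = 0 by case: h2.
rewrite eval_if z2 ?b2 /improves; last by lia.
case: ifP => _ /=; first by rewrite eval_skip.
rewrite eval_if z2 ?less; last by lia.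
by case: ifP => _; rewrite ?eval_skip // eval_copy.
Qed.

Lemma mods_Try0 : mods (Try 0) = mods Check ++ [::]. Proof. by []. Qed.
Lemma mods_TryE k : mods (Try k.+1) = mods Check ++ toggle k :: mods (Try k) ++ [::].
Proof. by []. Qed.
Lemma plmods_Try0 : plmods (Try 0) = plmods Check ++ [::]. Proof. by []. Qed.
Lemma plmods_TryE k : plmods (Try k.+1) = plmods Check ++ xT :: plmods (Try k) ++ [:: xT].
Proof. by []. Qed.

Lemma mods_TryS k a : (a \notin mods (Try k.+1)) =
  [&& a \notin mods Check, a != toggle k & a \notin mods (Try k)].
Proof.
by rewrite mods_TryE cats0 mem_cat inE !negb_or.
Qed.

Lemma mods_Try k a : a < 17 -> a \notin mods Check -> a \notin mods (Try k).
Proof.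
move=> a17 ac; elim: k => [|k IH]; first by rewrite mods_Try0 cats0.
by rewrite mods_TryS ac IH /toggle; lia.
Qed.

Lemma mods_toggle k j : k <= j -> toggle j \notin mods (Try k).
Proof.
have H : all (fun a => a < 17) (mods Check) by [].
have ac : toggle j \notin mods Check by apply/negP=> /(allP H); rewrite /toggle; lia.
elim: k => [|k IH] kj; first by rewrite mods_Try0 cats0.
by rewrite mods_TryS ac IH /toggle; lia.
Qed.

Lemma plmods_Try k p : p != xT -> p \notin plmods Check -> p \notin plmods (Try k).
Proof.
move=> pT pc; elim: k => [|k IH]; first by rewrite plmods_Try0 cats0.
rewrite plmods_TryE; move: (plmods Check) pc => c pc.
by rewrite mem_cat in_cons mem_cat mem_seq1 !negb_or pc pT IH.
Qed.

Lemma frame_Try k : frame (Try k).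
Proof. by rewrite /frame !mods_Try // plmods_Try. Qed.

Lemma ptr_setp s a i : ptr (setp s a i) a = i.
Proof. by rewrite /= eqxx. Qed.

Lemma flipK T a : flip (flip T a) a = T.
Proof. by apply: nat_fun_ext => q; rewrite /flip; case: eqP; rewrite ?negbK. Qed.

Lemma eval_flip a T s i : pl s xT = T -> ptr s a = i -> i < N ->
  pl (eval N (PPut negb a xT) s) xT = flip T i.
Proof.
move=> sT si iN; rewrite eval_put si //; apply: nat_fun_ext => q /=.
by rewrite sT /flip; case: eqP => // ->.
Qed.

Lemma improves_trans D D' T : improves D D' -> improves D' T -> improves D T.
Proof. by rewrite /improves => /andP [_ lt] /andP [-> lt'] /=; lia. Qed.

(** During the search [xD] may change several times, and by transitivity it keeps improving on [D].
    Only an unchanged [xD] certifies that no trial is better, which is all that the outer loop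
    needs. *)
Lemma eval_try k T D s : hdr s -> supported N s -> pl s xT = T -> pl s xD = D ->
  pl (eval N (Try k) s) xT = T /\
  ((pl (eval N (Try k) s) xD = D /\ forall T', within N k T T' -> ~~ improves D T') \/
   (improves D (pl (eval N (Try k) s) xD) /\ exists2 T', within N k T T' & improves D T')).
Proof.
elim: k T D s => [|k IH] T D s hs su sT sD.
  rewrite /Try eval_seq eval_skip eval_pl // (eval_check hs su sT sD); split=> //.
  case: ifP => h; first by right; split=> //; exists T => //; left.
  by left; split=> // T' [->|//]; rewrite h.
rewrite [Try _]/= eval_seq.
have c1 := eval_check hs su sT sD.
have h1 : hdr (eval N Check s) by apply: hdr_frame.
have u1 := eval_supported (N := N) Check su.
have T1 : pl (eval N Check s) xT = T by rewrite eval_pl.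
set s1 := eval N Check s in c1 h1 u1 T1 *; clearbody s1.
(* The part of [within N k.+1] explored before iteration [i]. *)
pose reached i T' := T' = T \/ exists2 a, a < i & within N k (flip T a) T'.
pose outcome i D' := (D' = D /\ forall T', reached i T' -> ~~ improves D T') \/
  (improves D D' /\ exists2 T', reached i T' & improves D T').
pose body := PSeq (PPut negb (toggle k) xT) (PSeq (Try k) (PPut negb (toggle k) xT)).
have frb : frame body.
  have mb : mods body = mods (Try k) ++ [::] by [].
  have pb : plmods body = xT :: plmods (Try k) ++ [:: xT] by [].
  rewrite /frame mb pb cats0 !mods_Try // in_cons mem_cat mem_seq1 !negb_or.
  by rewrite plmods_Try.
have [|i t iN [t1 t2 t3 t4]|t [t1 t2 t3 t4] es] := @eval_for_ind N (toggle k) body s1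
  (fun i t => [/\ hdr t, supported N t, pl t xT = T & outcome i (pl t xD)]).
- split=> //; rewrite c1 /outcome; case: ifP => h.
    by right; split=> //; exists T => //; left.
  by left; split=> // T' [->|[]//]; rewrite h.
- have ht : hdr (setp t (toggle k) i) by apply: hdr_setp.
  set t' := eval N (PPut negb (toggle k) xT) (setp t (toggle k) i).
  have f1 : pl t' xT = flip T i by apply: eval_flip; rewrite ?ptr_setp.
  have h' : hdr t' by apply: hdr_frame.
  have u' : supported N t' by apply: eval_supported.
  have d' : pl t' xD = pl t xD by rewrite /t' eval_pl.
  have [f2 res] := IH _ _ t' h' u' f1 d'.
  split; [exact: hdr_frame | exact: eval_supported | |].
    rewrite /body !eval_seq -/t' (eval_flip f2 (i := i)) ?flipK //.
    by rewrite eval_ptr ?mods_toggle // /t' eval_ptr // ptr_setp.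
  rewrite /body !eval_seq -/t' eval_pl //.
  case: t4 => [[d0 none]|[imp [T' rT' iT']]]; last first.
    right; split; last first.
      exists T' => //; case: rT' => [->|[a ai nr]]; first by left.
      by right; exists a => //; lia.
    by case: res => [[-> _]|[imp' _]] //; exact: improves_trans imp imp'.
  rewrite d0 in res; case: res => [[-> none']|[imp' [T' nT' iT']]]; last first.
    by right; split=> //; exists T' => //; right; exists i.
  left; split=> // T' [->|[a]]; first by apply: none; left.
  rewrite ltnS leq_eqVlt => /orP [/eqP ->|ai] nr; first exact: none'.
  by apply: none; right; exists a.
by rewrite es.
Qed.

End Search.

(** * The local search program *)

Section Main.
Variables (n : nat) (E L : seq (nat * nat)).
Notation x := (encode (nums n E L)).
Notation N := (size x).
Notation hdr := (hdr n E L).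
Notation m := (size L).

Lemma eval_header s : has_input (nums n E L) s -> hdr (eval N Header s).
Proof.
move=> hi; have NL := N_large n E L; have sz := size_nums n E L.
rewrite /Header eval_seq eval_reset eval_seq eval_reset.
set s0 := setp _ pos 0; have hi0 : has_input (nums n E L) s0 by [].
have z0 : ptr s0 zp = 0 by [].
have [||n1 p1] := @eval_readnum (nums n E L) nn 0 s0 isT isT _ hi0; rewrite ?sz //; first by lia.
rewrite eval_seq; set s1 := eval N (ReadNum nn) s0 in n1 p1 *.
have hi1 : has_input (nums n E L) s1 by move=> q; rewrite /s1 eval_pl.
have z1 : ptr s1 zp = 0 by rewrite /s1 eval_ptr.
clearbody s1.
have [|n2 p2] := @eval_readnum (nums n E L) cE 1 s1 isT isT _ hi1 p1; rewrite ?sz; first by lia.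
rewrite eval_seq; set s2 := eval N (ReadNum cE) s1 in n2 p2 *.
have hi2 : has_input (nums n E L) s2 by move=> q; rewrite /s2 eval_pl.
have z2 : ptr s2 zp = 0 by rewrite /s2 eval_ptr.
have n2' : ptr s2 nn = n by rewrite /s2 eval_ptr.
clearbody s2.
pose Inv k t := [/\ has_input (nums n E L) t, ptr t pos = offset (nums n E L) (2 + k.*2),
  ptr t zp = 0, ptr t nn = n & ptr t cE = size E].
have : Inv (size E) (eval N (Items pe cE ReadPair) s2).
  apply: (@eval_items N pe cE ReadPair (size E) s2 Inv) => //; first by lia.
    by move=> k t a i /orP [] /eqP ->.
  move=> k t kE te [t1 t2 t3 t4 t5].
  have [|_ _ p3] := eval_readpair t1 t2; first by rewrite sz; lia.
  have pS : 2 + k.+1.*2 = (2 + k.*2).+2 by lia.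
  by split; rewrite ?pS //; [move=> q; rewrite eval_pl | rewrite eval_ptr..].
rewrite eval_seq; set s3 := eval N (Items pe cE ReadPair) s2 => -[hi3 p3 z3 n3 e3].
clearbody s3.
have [|n4 _] := @eval_readnum (nums n E L) cL _ s3 isT isT _ hi3 p3; first by rewrite sz; lia.
split; [by rewrite eval_ptr.. | by rewrite n4 nth_nums_sizeL |].
by move=> q; rewrite eval_pl.
Qed.

Lemma eval_output D s : hdr s -> pl s xD = D -> (forall q, pl s xO q = false) ->
  forall l, l < m -> pl (eval N Output s) xO l = D l.*2 || D l.*2.+1.
Proof.
move=> hs sD sO; have NL := N_large n E L.
rewrite /Output eval_seq eval_reset.
pose Inv k t := [/\ ptr t pb = k.*2, pl t xD = D &
  forall l, pl t xO l = (l < k) && (D l.*2 || D l.*2.+1)].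
set body := PSeq (PIf _ _ _ _) _.
suff [_ _ H] : Inv m (eval N (Items pe cL body) (setp s pb 0)).
  by move=> l lm; rewrite H lm.
apply: (@eval_items N pe cL body m _ Inv) => //; first by lia.
- by case: hs.
- by move=> k t a i /orP [] /eqP ->.
move=> k t km te [t1 t2 t3]; rewrite /body eval_seq eval_if t1 ?t2; last by lia.
have kE l : (l < k.+1) && (D l.*2 || D l.*2.+1) =
   if l == k then D k.*2 || D k.*2.+1 else (l < k) && (D l.*2 || D l.*2.+1).
  by rewrite ltnS leq_eqVlt; case: eqP => [->|].
case d0: (D k.*2).
  rewrite eval_seq eval_put te; last by lia.
  have e1 : eval N (PInc pb) (setpl t xO k true) = setp (setpl t xO k true) pb k.*2.+1.
    by rewrite eval_inc /= t1 //; lia.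
  rewrite e1 eval_inc; last by rewrite ptr_setp; lia.
  by split=> //= l; rewrite kE d0 t3; case: (l == k).
have e1 : eval N (PInc pb) t = setp t pb k.*2.+1 by rewrite eval_inc t1 //; lia.
rewrite eval_seq e1 eval_if ptr_setp; last by lia.
rewrite [pl _ _ _](congr1 (@^~ _) t2); case d1: (D k.*2.+1).
  rewrite eval_put /= te; last by lia.
  rewrite eval_inc; last by rewrite /=; lia.
  by split=> //= l; rewrite kE d0 d1 t3; case: (l == k).
rewrite eval_skip eval_inc; last by rewrite ptr_setp; lia.
by split=> //= l; rewrite kE d0 d1 t3; case: (l =P k) => // ->; rewrite ltnn.
Qed.

(** A pass either finds no improvement, and then the set is locally optimal and stays so, or lowers
    the cost by at least 1. The cost starts at no more than [3 * m], which is less than the number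
    [N] of passes. *)
Lemma eval_local_search K s : has_input (nums n E L) s -> supported N s ->
  (forall q, pl s xO q = false) -> ~~ infeasible n E L (fun q => (q < N) && true) ->
  exists D, [/\ ~~ infeasible n E L D, forall T, within N K D T -> ~~ improves n E L D T &
    forall l, l < m -> pl (eval N (LocalSearch K) s) xO l = D l.*2 || D l.*2.+1].
Proof.
move=> hi su sO feas0; have NL := N_large n E L.
rewrite /LocalSearch eval_seq.
have h1 := eval_header hi.
have u1 : supported N (eval N Header s) by apply: eval_supported.
have O1 q : pl (eval N Header s) xO q = false by rewrite eval_pl.
set s1 := eval N Header s in h1 u1 O1 *; clearbody s1.
rewrite eval_seq.
have h2 : hdr (eval N (Fill xD true) s1) by apply: hdr_frame.
have u2 : supported N (eval N (Fill xD true) s1) by apply: eval_supported.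
have O2 q : pl (eval N (Fill xD true) s1) xO q = false by rewrite eval_pl.
have D2 := eval_fill xD true u1.
set s2 := eval N (Fill xD true) s1 in h2 u2 O2 D2 *; clearbody s2.
pose local D := forall T, within N K D T -> ~~ improves n E L D T.
have [|i t iN [t1 t2 t3 t4 t5]|t [t1 t2 t3 t4 t5] es] :=
  @eval_for_ind N pass (PSeq (Copy xD xT) (Try K)) s2
  (fun i t => [/\ hdr t, supported N t, forall q, pl t xO q = false,
     ~~ infeasible n E L (pl t xD) & local (pl t xD) \/ plane_cost (pl t xD) m + i <= 3 * m]).
- by split=> //; rewrite D2 // addn0; right; apply: plane_cost_le.
- have h' : hdr (eval N (Copy xD xT) (setp t pass i)) by apply: hdr_frame => //; apply: hdr_setp.
  have u' : supported N (eval N (Copy xD xT) (setp t pass i)) by apply: eval_supported.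
  have T' : pl (eval N (Copy xD xT) (setp t pass i)) xT = pl t xD by rewrite eval_copy.
  have D' : pl (eval N (Copy xD xT) (setp t pass i)) xD = pl t xD by rewrite eval_pl.
  have O' q : pl (eval N (Copy xD xT) (setp t pass i)) xO q = false by rewrite eval_pl //; exact: t3.
  rewrite eval_seq; set t' := eval N _ _ in h' u' T' D' O' *; clearbody t'.
  have [_ res] := eval_try K h' u' T' D'.
  split; [exact: hdr_frame (frame_Try K) h' | exact: eval_supported | | |].
  + by move=> q; rewrite eval_pl ?plmods_Try.
  + by case: res => [[-> _]|[/andP []]].
  case: res => [[-> none]|[imp [T nT iT]]]; first by left.
  case: t5 => [loc|bnd]; first by have := loc _ nT; rewrite iT.
  by right; move: imp => /andP [_]; lia.
rewrite eval_seq es; exists (pl t xD); split=> //.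
  by case: t5 => // bad; lia.
exact: eval_output.
Qed.

End Main.

(** * The approximation ratio *)

Lemma wf_Try K k : k <= K -> wf 7 (17 + K) (Try k).
Proof.
have wfC : wf 7 (17 + K) Check by [].
elim: k => [|k IH] kK.
  have -> : wf 7 (17 + K) (Try 0) = wf 7 (17 + K) Check && true by [].
  by rewrite wfC.
have -> : wf 7 (17 + K) (Try k.+1) = wf 7 (17 + K) Check &&
   [&& toggle k < 17 + K, toggle k \notin mods (Try k) ++ [::] &
     (toggle k < 17 + K) && (xT < 7) && (wf 7 (17 + K) (Try k) && ((toggle k < 17 + K) && (xT < 7)))] by [].
have tK : toggle k < 17 + K by rewrite /toggle ltn_add2l.
by rewrite cats0; apply/and5P; split; rewrite ?tK ?mods_toggle ?IH // ltnW.
Qed.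

Lemma wf_LocalSearch K : wf 7 (17 + K) (LocalSearch K).
Proof.
have -> : wf 7 (17 + K) (LocalSearch K) = wf 7 (17 + K) Header && (wf 7 (17 + K) (Fill xD true) &&
  ([&& pass < 17 + K, pass \notin mods (Copy xD xT) ++ mods (Try K) &
     wf 7 (17 + K) (Copy xD xT) && wf 7 (17 + K) (Try K)] && wf 7 (17 + K) Output)) by [].
have pm : pass \notin mods (Copy xD xT) ++ mods (Try K).
  by rewrite mem_cat negb_or mods_Try.
by apply/and5P; split; rewrite ?pm ?wf_Try.
Qed.

Lemma withinS N k T T' : within N k T T' -> within N k.+1 T T'.
Proof.
elim: k T => [|k IH] T; first by case=> // ->; left.
by case=> [->|[a aN /IH h]]; [left | right; exists a].
Qed.

Lemma within_of_diff N T T' s : all (fun q => q < N) s -> (forall q, T' q != T q -> q \in s) ->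
  within N (size s) T T'.
Proof.
elim: s T => [|a s IH] T /=.
  by move=> _ H; left; apply: nat_fun_ext => q; apply/eqP; apply: contraT => nq; move: (H q nq).
case/andP=> aN sN H; have [e|ne] := eqVneq (T' a) (T a).
  apply: withinS; apply: IH => // q nq; move: (H q nq); rewrite inE => /orP [/eqP eqa|//].
  by rewrite eqa e eqxx in nq.
right; exists a => //; apply: IH => // q; rewrite /flip; case: (q =P a) => [->|/eqP nq].
  by case: (T' a) ne; case: (T a).
by move/H; rewrite inE (negbTE nq).
Qed.

Lemma within_le N k k' T T' : k <= k' -> within N k T T' -> within N k' T T'.
Proof. by move=> /subnK <-; elim: (k' - k) => // j IH h; apply/withinS/IH. Qed.

(** * Bit planes as sets of arcs of a given instance *)

Section Instance.
Variables (n' : nat).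
Local Notation n := n'.+1.
Variables (E L : seq ('I_n * 'I_n)).
Hypothesis cactusE : is_cactus E.

Definition nat_pairs (s : seq ('I_n * 'I_n)) := [seq (val e.1, val e.2) | e <- s].
Local Notation En := (nat_pairs E).
Local Notation Ln := (nat_pairs L).
Local Notation x := (encode (nums n En Ln)).
Local Notation N := (size x).
Local Notation m := (size L).
Local Notation a := (fun l : 'I_m => (edge_of l).1).
Local Notation b := (fun l : 'I_m => (edge_of l).2).
Local Notation dicov := (dicovering ord0 (min_cut E) a b).

Lemma encode_instance : enc_instance E L = x.
Proof.
have pairsE s : encode (pairs (nat_pairs s)) =
    flatten [seq enc_nat (val e.1) ++ enc_nat (val e.2) | e <- s].
  elim: s => // e s IH /=; rewrite -IH.
  by rewrite /encode /= catA.
rewrite /enc_instance /enc_edges -!pairsE.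
have cons k s : encode (k :: s) = enc_nat k ++ encode s by [].
by rewrite /nums !cons encode_cat cons !size_map -!catA.
Qed.

Definition idx (f : 'I_m * bool) := (val f.1).*2 + f.2.
Definition arc_set (T : nat -> bool) : {set 'I_m * bool} := [set f | T (idx f)].

Lemma idx_lt f : idx f < m.*2.
Proof. by case: f => l [] /=; rewrite /idx /=; have := ltn_ord l; lia. Qed.

Lemma sizeN : 0 < N /\ size E < N /\ m.*2 < N /\ n <= N.
Proof.
have eE : size En = size E by rewrite size_map.
have eL : size Ln = m by rewrite size_map.
by have := N_large n En Ln; rewrite eE eL; lia.
Qed.

Lemma edge_ends (s : seq ('I_n * 'I_n)) k (kl : k < size s) x0 :
  nth (0, 0) (nat_pairs s) k = (val (nth x0 s k).1, val (nth x0 s k).2).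
Proof. by rewrite (nth_map x0). Qed.

Lemma link_ends (l : 'I_m) : lu Ln l = val (a l) /\ lv Ln l = val (b l).
Proof.
rewrite /lu /lv (edge_ends (ltn_ord l) (ord0, ord0)) /=.
by rewrite /edge_of (tnth_nth (ord0, ord0)).
Qed.

Lemma constraints_bounded i j T : all (fun c => c.2 < N) (constraints En Ln i j T).
Proof.
have [_ [_ [_ nN]]] := sizeN.
apply/allP=> c; rewrite mem_cat => /orP [] /mem_flat_prefix [k].
  rewrite size_map => kE; rewrite /itemE /eu /ev (edge_ends kE (ord0, ord0)); case: ifP => // _.
  by rewrite !inE => /orP [] /eqP -> /=; apply: leq_trans nN; apply: ltn_ord.
rewrite size_map => kL; rewrite /itemL /lu /lv (edge_ends kL (ord0, ord0)).
rewrite mem_cat => /orP []; case: (T _); rewrite ?in_nil // mem_seq1 => /eqP -> /=;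
  by apply: leq_trans nN; apply: ltn_ord.
Qed.

Lemma leaves_constraint i j T C (f : 'I_m * bool) : f \in arc_set T -> leaves a b f C ->
  exists u v : 'I_n, [/\ (val u, val v) \in constraints En Ln i j T, u \notin C & v \in C].
Proof.
rewrite inE /leaves /idx => Tf /andP [tC hC].
exists (head a b f), (tail a b f); split=> //.
rewrite mem_cat; apply/orP; right; apply/mem_flat_prefix; exists (val f.1).
  by rewrite size_map; exact: ltn_ord.
have [e1 e2] := link_ends f.1.
move: Tf; rewrite /itemL e1 e2 /head /tail.
case: f {tC hC e1 e2} => l [] /=; rewrite ?addn1 ?addn0 => ->; rewrite mem_cat ?inE ?eqxx ?orbT //.
Qed.

(** If a two-edge cut avoids the root and no arc leaves it, its complement is closed under the
    constraints that omit its two edges, so its vertices are never reached. Conversely, unreached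
    vertices form such a cut, as reachability is closed after [N] rounds. *)
Lemma feasible_planes T : ~~ infeasible n En Ln T <-> dicov (arc_set T).
Proof.
have [N0 [EN [LN nN]]] := sizeN; split.
  move=> feas C cC rC; apply/exists_inP; apply: contraT => /exists_inPn noleave.
  case/negP: feas.
  have /and3P [/set0Pn [w wC] _ cnt] := cC.
  have [i [j ij]] := count_le2_positions (ord0, ord0) cnt.
  (* An index beyond the last edge is lowered to [size E], which still omits nothing and is in the
     range of the loops. *)
  pose i' := minn i (size E); pose j' := minn j (size E).
  have i'N : i' < N by rewrite /i'; lia.
  have j'N : j' < N by rewrite /j'; lia.
  have ij' k : k < size E -> crossing C (nth (ord0, ord0) E k) -> k = i' \/ k = j'.
    by move=> kE /(ij k kE); rewrite /i' /j'; lia.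
  (* The complement of [C] as a predicate on numbers; numbers that are not vertices satisfy it
     vacuously. *)
  pose Q q := [forall v : 'I_n, (val v == q) ==> (v \notin C)].
  have QE (v : 'I_n) : Q (val v) = (v \notin C).
    apply/forallP/idP=> [/(_ v)|vC u]; first by rewrite eqxx.
    by apply/implyP=> /eqP/val_inj ->.
  apply/hasP; exists i'; first by rewrite mem_iota.
  apply/hasP; exists j'; first by rewrite mem_iota.
  apply/hasP; exists (val w); first by rewrite mem_iota /= ltn_ord.
  apply/negP=> rw.
  have : Q (val w); last by rewrite QE wC.
  apply: reach_sound rw; last by rewrite (QE ord0).
  apply/allP=> c; rewrite mem_cat => /orP [] /mem_flat_prefix [k].
    rewrite size_map => kE; rewrite /itemE; case: ifP => // /negbT; rewrite negb_or => /andP [ki kj].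
    have nc : ~~ crossing C (nth (ord0, ord0) E k).
      by apply/negP=> /(ij' k kE) [e|e]; [rewrite e eqxx in ki | rewrite e eqxx in kj].
    rewrite /eu /ev (edge_ends kE (ord0, ord0)) /= !inE.
    move: nc; rewrite /crossing negbK => /eqP ec.
    by case/orP=> /eqP -> /=; rewrite !QE ec implybb.
  rewrite size_map => kL; pose l := Ordinal kL.
  have [e1 e2] := link_ends l; rewrite /itemL [lu _ _]e1 [lv _ _]e2.
  rewrite mem_cat => /orP [].
    case Tk: (T k.*2); rewrite ?in_nil // inE => /eqP -> /=; rewrite !QE.
    have := noleave (l, false); rewrite inE /idx /= addn0 Tk /leaves /tail /head /= => /(_ isT).
    by case: ((edge_of l).1 \in C); case: ((edge_of l).2 \in C).
  case Tk: (T k.*2.+1); rewrite ?in_nil // inE => /eqP -> /=; rewrite !QE.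
  have := noleave (l, true); rewrite inE /idx /= addn1 Tk /leaves /tail /head /= => /(_ isT).
  by case: ((edge_of l).1 \in C); case: ((edge_of l).2 \in C).
move=> cov; apply/negP=> /hasP [i _] /hasP [j _] /hasP [c]; rewrite mem_iota add0n => /= cn nr.
have closed := reach_closed (constraints_bounded i j T).
pose C : {set 'I_n} := [set v : 'I_n | ~~ reach (constraints En Ln i j T) N (val v)].
have reach0 : reach (constraints En Ln i j T) N 0.
  by elim: (N) => //= k IH; apply: apply_infl.
have rC : ord0 \notin C by rewrite inE negbK.
have con (u v : 'I_n) : (val u, val v) \in constraints En Ln i j T -> u \notin C -> v \notin C.
  move=> uv; rewrite !inE !negbK => ru.
  exact: (implyP (allP closed _ uv)).
have cC : min_cut E C.
  apply/and3P; split.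
  - by apply/set0Pn; exists (Ordinal cn); rewrite inE.
  - by apply/eqP=> e; have := in_setT (ord0 : 'I_n); rewrite -e (negbTE rC).
  apply: (count_le2 (x0 := (ord0, ord0)) (i := i) (j := j)) => k kE.
  have [->|ki] := eqVneq k i; first by left.
  have [->|kj] := eqVneq k j; first by right.
  have mem c' : c' \in itemE En i j k -> c' \in constraints En Ln i j T.
    by move=> h; rewrite mem_cat; apply/orP; left; apply/mem_flat_prefix; exists k; rewrite ?size_map.
  move: mem; rewrite /itemE (negbTE ki) (negbTE kj) /= /eu /ev (edge_ends kE (ord0, ord0)) /=.
  set u := (nth _ E k).1; set v := (nth _ E k).2 => mem.
  have c1 : u \notin C -> v \notin C by apply: con; apply: mem; rewrite !inE eqxx.
  have c2 : v \notin C -> u \notin C by apply: con; apply: mem; rewrite !inE eqxx orbT.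
  rewrite /crossing -/u -/v; case uC: (u \in C) c1 c2; case vC: (v \in C) => //= c1 c2.
    by have := c2 isT.
  by have := c1 isT.
have [f fT lf] := cov C cC rC.
have [u [v [uv uC vC]]] := leaves_constraint i j fT lf.
by have := con u v uv uC; rewrite vC.
Qed.

Lemma plane_cost_arcs T : plane_cost T m = cost (arc_set T).
Proof.
have -> k : plane_cost T k = \sum_(l < k) link_cost T l.
  by elim: k => [|k IH]; rewrite ?big_ord0 // big_ord_recr /= -IH.
rewrite /cost card_arcs -[#|links _|]sum1_card [X in _ = _ + X]big_mkcond -big_split /=.
apply: eq_bigr => l _; rewrite in_links !inE /idx /= addn0 addn1 /link_cost.
by case: (T _); case: (T _).
Qed.

Lemma local_arcs K T : (forall T', within N K T T' -> ~~ improves n En Ln T T') ->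
  forall X, #|arc_set T :\: X| + #|X :\: arc_set T| <= K -> dicov X ->
    cost (arc_set T) <= cost X.
Proof.
move=> loc X dX covX; have [N0 [EN [LN nN]]] := sizeN.
(* Beyond the arc positions [T'] copies [T], so only the symmetric difference of the arc sets has to
   be toggled. *)
pose T' q := if q./2 < m then [exists f : 'I_m * bool, (f \in X) && (idx f == q)] else T q.
have idxK (f g : 'I_m * bool) : idx f = idx g -> f = g.
  case: f g => l s [l' s']; rewrite /idx /= => e.
  have el : l = l' by apply: val_inj => /=; lia.
  by subst l'; congr pair; case: s e; case: s' => //=; lia.
have T'X : arc_set T' = X.
  apply/setP=> f; rewrite inE /T' ifT; last first.
    by rewrite /idx; have := ltn_ord f.1; case: (f.2); rewrite /= ?addn1 ?addn0 /= ?uphalf_double ?doubleK.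
  apply/existsP/idP=> [[g /andP [gX /eqP/idxK <-]] //|fX].
  by exists f; rewrite fX eqxx.
have nT : within N K T T'.
  pose S := (arc_set T :\: X) :|: (X :\: arc_set T).
  apply: (@within_le _ (size (map idx (enum S)))).
    rewrite size_map -cardE; apply: leq_trans dX.
    by rewrite -cardsUI leq_addr.
  apply: within_of_diff.
    by apply/allP=> _ /mapP [f _ ->]; apply: ltn_trans (idx_lt f) LN.
  move=> q; rewrite {1}/T'; case: ifP => qm; last by rewrite eqxx.
  pose f : 'I_m * bool := (Ordinal qm, odd q).
  have fq : idx f = q by rewrite /idx /= addnC odd_double_half.
  have -> : [exists f0 : 'I_m * bool, (f0 \in X) && (idx f0 == q)] = (f \in X).
    apply/existsP/idP=> [[g /andP [gX /eqP gq]]|fX]; last by exists f; rewrite fX fq eqxx.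
    by rewrite (idxK f g) // fq gq.
  move=> ne; apply/mapP; exists f => //; rewrite mem_enum /S !in_setU !in_setD inE fq.
  by case: (f \in X) ne; case: (T q).
have := loc _ nT; rewrite /improves size_map !plane_cost_arcs T'X negb_and negbK.
case/orP=> [inf|]; last by rewrite -leqNgt.
have : ~~ infeasible n En Ln T' by apply/feasible_planes; rewrite T'X.
by rewrite inf.
Qed.

Lemma local_ratio T (B : {set 'I_m}) : (forall T', within N 206 T T' -> ~~ improves n En Ln T T') ->
  dicov (arc_set T) -> feasible E B -> 100 * #|links (arc_set T)| <= 169 * #|B|.
Proof.
move=> loc cov /(feasibleP B cactusE) fB.
have [small large] := local_optimum_bound (@min_cutC _ E)
  (fun C D => min_cutU cactusE) cov (local_arcs loc) (h := 20) fB isT isT.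
move: small large; move: #|B| #|links _| => q p small large.
(* For [q >= 42] the large bound reads [40 * p <= 65 * q + 100], that is
   [100 * p <= 162.5 * q + 250], and 250 is below [7.5 * q]. *)
have [le|gt] := leqP q 41; first by have := small le; lia.
by move: large; lia.
Qed.

Lemma local_search_instance : (exists B : {set 'I_m}, feasible E B) ->
  let A := dec_solution m (mkseq (pl (eval N (LocalSearch 206) (input_state x)) xO) N) in
  feasible E A /\ forall B : {set 'I_m}, feasible E B -> 100 * #|A| <= 169 * #|B|.
Proof.
move=> [B0 /(feasibleP _ cactusE) fB0]; have [N0 [EN [LN nN]]] := sizeN.
have [||//||T [feasT locT outT]] := @eval_local_search n En Ln 206 (input_state x).
- by [].
- by move=> p q qN /=; rewrite nth_default ?andbF.
- apply/feasible_planes; apply: dicovering_sub (dicovering_arcs fB0).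
  by apply/subsetP=> f _; rewrite inE andbT; apply: ltn_trans (idx_lt f) LN.
have covT : dicov (arc_set T) by apply/feasible_planes.
have -> : dec_solution m (mkseq (pl (eval N (LocalSearch 206) (input_state x)) xO) N) =
    links (arc_set T).
  apply/setP=> l; have lm := ltn_ord l.
  rewrite inE nth_mkseq; last by lia.
  by rewrite outT ?size_map // in_links !inE /idx /= addn0 addn1.
split; last by move=> B; apply: local_ratio.
apply/(feasibleP _ cactusE); apply: covering_leaves covT; exact: min_cutC.
Qed.

End Instance.

Lemma local_search_correct n (E L : seq ('I_n * 'I_n)) : is_cactus E ->
  (exists B : {set 'I_(size L)}, feasible E B) ->
  let x := enc_instance E L in
  let A := dec_solution (size L)
    (mkseq (pl (eval (size x) (LocalSearch 206) (input_state x)) xO) (size x)) in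
  feasible E A /\ forall B : {set 'I_(size L)}, feasible E B -> 100 * #|A| <= 169 * #|B|.
Proof.
case: n E L => [|n] E L cE exB x A; last first.
  by rewrite /A /x encode_instance; apply: local_search_instance.
(* Without vertices there are no links, so the output is empty. *)
split; first by move=> i j [].
move=> B _; apply: (@leq_trans 0) => //.
rewrite leqn0 muln_eq0 /= cards_eq0; apply/eqP/setP=> l.
by case: (edge_of l) => [[]].
Qed.

Section RealBound.
Local Open Scope R_scope.

(* Telescoping [ln (j+1) - ln j >= 1/(j+1)] from [ln 4] to [ln 16] gives [H_16 - H_4 > 1.29]. *)
Lemma ln4_ge : 1.29 <= ln 4.
Proof.
have step y : (0 < y) -> (ln y + 1 / (y + 1) <= ln (y + 1)).
  move=> y0; have h : (0 < y / (y + 1)) by apply: Rdiv_lt_0_compat; lra.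
  have e : ln (y / (y + 1)) = ln y - ln (y + 1).
    rewrite /Rdiv ln_mult ?ln_Rinv //; try lra.
    by apply: Rinv_0_lt_compat; lra.
  have := exp_ineq1_le (ln (y / (y + 1))); rewrite exp_ln // e.
  have -> : (y / (y + 1) = 1 - 1 / (y + 1)) by field; lra.
  by lra.
have e16 : ln 16 = (ln 4 + ln 4) by rewrite -ln_mult; [congr ln|..]; lra.
have h4 := step 4 ltac:(lra); have h5 := step (4 + 1) ltac:(lra).
have h6 := step (4 + 1 + 1) ltac:(lra); have h7 := step (4 + 1 + 1 + 1) ltac:(lra).
have h8 := step 8 ltac:(lra); have h9 := step (8 + 1) ltac:(lra).
have h10 := step (8 + 1 + 1) ltac:(lra); have h11 := step (8 + 1 + 1 + 1) ltac:(lra).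
have h12 := step 12 ltac:(lra); have h13 := step (12 + 1) ltac:(lra).
have h14 := step (12 + 1 + 1) ltac:(lra); have h15 := step (12 + 1 + 1 + 1) ltac:(lra).
have e8 : (4 + 1 + 1 + 1 + 1 = 8) by ring.
have e12 : (8 + 1 + 1 + 1 + 1 = 12) by ring.
have e16' : (12 + 1 + 1 + 1 + 1 = 16) by ring.
rewrite e8 in h7; rewrite e12 in h11; rewrite e16' e16 in h15.
lra.
Qed.

Lemma ratio_le (eps : R) (p q : nat) : (0 < eps) -> (100 * p <= 169 * q)%N ->
  (INR p <= cacap_ratio eps * INR q).
Proof.
move=> e0 /leP/le_INR; rewrite !mult_INR /cacap_ratio.
rewrite (_ : INR 100 = 100); last by rewrite INR_IZR_INZ.
rewrite (_ : INR 169 = 169); last by rewrite INR_IZR_INZ.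
move=> h; have q0 := pos_INR q; have l4 := ln4_ge.
(* The bound on [ln 4] gives a factor above [2.58 - 967 / 1120], which exceeds 1.71. *)
have : (1.69 * INR q <= (2 * ln 4 - 967 / 1120 + eps) * INR q).
  by apply: Rmult_le_compat_r => //; lra.
lra.
Qed.

End RealBound.

Theorem theorem1 :
  forall eps : R, Rlt 0 eps ->
  exists (M : TM) (c d : nat),
    forall (n : nat) (E L : seq ('I_n * 'I_n)),
      is_cactus E ->
      (exists B : {set 'I_(size L)}, feasible E B) ->
      let x := enc_instance E L in
      let cfg := tm_run (c * size x ^ d + c) (tm_init M x) in
      let A := dec_solution (size L) (tm_output cfg) in
      [/\ tm_halted cfg,
          feasible E A &
          forall B : {set 'I_(size L)}, feasible E B ->
            Rle (INR #|A|) (Rmult (cacap_ratio eps) (INR #|B|))].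
Proof.
move=> eps eps0.
have [M [c [d H]]] := machine_correct (wf_LocalSearch 206) (isT : xO < 7) (erefl _).
exists M, c, d => n E L cE exB x cfg A.
have x0 : 0 < size x by rewrite /x /enc_instance size_cat size_enc_nat.
have [halt out] := H x x0.
have [fA rA] := local_search_correct cE exB.
by rewrite /A /cfg out; split=> // B fB; apply: ratio_le => //; apply: rA.
Qed.
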